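(* Let $\{X_n\}$ be the Bessel-like walk described in the context, with drift parameter $\delta\ge -1$, $\kappa=(1+\delta)/2$, and constant $K_0$ and function $L$ as defined there. (a) If $\delta>-1$, then \[ P_0(\tau_0\ge n)\sim \frac{2^{1-\kappa}}{K_0\Gamma(\kappa)}\,n^{-\kappa}L(\sqrt n)\quad\text{as } n\to\infty, \] and, as $n\to\infty$ through even integers, \[ P_0(\tau_0=n)\sim \frac{2^{2-\kappa}\kappa}{K_0\Gamma(\kappa)}\,n^{-(\kappa+1)}L(\sqrt n). \] (b) If $\delta=-1$ and the walk is recurrent (i.e. $M_x\to\infty$ as $x\to\infty$), then \[ P_0(\tau_0\ge n)\sim \frac{1}{K_0\,\nu(n)}\quad\text{as } n\to\infty, \] where $\nu(n)=\sum_{l\le n,\ l\text{ even},\, l\ge 2}\frac{1}{l\,L(\sqrt l)}$.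
   Context: Let $\{X_n\}_{n\ge0}$ be a Markov chain on $\mathbb{Z}_+=\{0,1,2,\dots\}$ with steps $\pm1$, reflecting at $0$ (i.e. $p(0,1)=1$), and for $x\ge1$ transition probabilities $p_x=p(x,x+1)$, $q_x=p(x,x-1)=1-p_x$. A drift parameter $\delta\ge-1$ is fixed and $R_x$ is defined by $p_x=\frac12\left(1-\frac{\delta}{2x}+\frac{R_x}{2}\right)$, where it is assumed that $R_x=o(1/x)$ as $x\to\infty$. Uniform ellipticity is assumed: there is $\epsilon>0$ with $p_x,q_x\in[\epsilon,1-\epsilon]$ for all $x\ge1$. Set $\kappa=(1+\delta)/2$. Define $\lambda_0=1$, $\lambda_x=\prod_{k=1}^x q_k/p_k$ for $x\ge1$, $M_0=0$, $M_x=\sum_{k=0}^{x-1}\lambda_k$ for $x\ge1$ (the scale function), and $L(x)=\exp(R_1+\dots+R_x)$ for integers $x\ge1$, extended to $[1,\infty)$ by linear interpolation ($L$ is slowly varying). There is a constant $K_0>0$ such that $\lambda_x\sim K_0x^{2\kappa-1}L(x)^{-1}$ as $x\to\infty$; $K_0$ denotes this constant. $P_j$ denotes the law of the chain started at $j$, and $\tau_j=\min\{n\ge1:X_n=j\}$ (so under $P_0$, $\tau_0$ is the first return time to $0$). $a_n\sim b_n$ means $a_n/b_n\to1$. *)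

(* Defs.v *)
From Stdlib Require Import Reals ZArith.
From Coquelicot Require Import Coquelicot.
Open Scope R_scope.

Definition trans (p : nat -> R) (x y : nat) : R :=
  match x with
  | O => if Nat.eqb y 1 then 1 else 0
  | S _ => if Nat.eqb y (S x) then p x
           else if Nat.eqb (S y) x then 1 - p x else 0
  end.

(* taboo p n y = P_0(X_n = y, X_k <> 0 for 1 <= k <= n) *)
Fixpoint taboo (p : nat -> R) (n : nat) : nat -> R :=
  match n with
  | O => fun y => if Nat.eqb y 0 then 1 else 0
  | S m => fun y =>
      match y with
      | O => 0
      | S y' => taboo p m y' * trans p y' y + taboo p m (S y) * trans p (S y) y
      end
  end.

(* P_0(tau_0 = n), tau_0 = min{n >= 1 : X_n = 0} *)
Definition ret_eq (p : nat -> R) (n : nat) : R :=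
  match n with
  | O => 0
  | S m => taboo p m 1 * trans p 1 0
  end.

(* P_0(tau_0 > n) = P_0(X_k <> 0 for 1<=k<=n); the walk is at a state <= n at time n *)
Definition survive (p : nat -> R) (n : nat) : R :=
  sum_f_R0 (fun x => taboo p n x) n.

Definition ret_ge (p : nat -> R) (n : nat) : R :=
  match n with
  | O => 1
  | S m => survive p m
  end.

(* R_x from p_x = 1/2 (1 - delta/(2x) + R_x/2) *)
Definition Rerr (p : nat -> R) (delta : R) (x : nat) : R :=
  4 * p x - 2 + delta / INR x.

Fixpoint lambda (p : nat -> R) (x : nat) : R :=
  match x with
  | O => 1
  | S k => lambda p k * ((1 - p (S k)) / p (S k))
  end.

Fixpoint scaleM (p : nat -> R) (x : nat) : R :=
  match x with
  | O => 0
  | S k => scaleM p k + lambda p k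
  end.

Fixpoint sumR (p : nat -> R) (delta : R) (x : nat) : R :=
  match x with
  | O => 0
  | S k => sumR p delta k + Rerr p delta (S k)
  end.

Definition Lnat (p : nat -> R) (delta : R) (x : nat) : R := exp (sumR p delta x).

Definition Lint (p : nat -> R) (delta : R) (x : R) : R :=
  let k := Z.to_nat (Int_part x) in
  Lnat p delta k + (x - INR k) * (Lnat p delta (S k) - Lnat p delta k).

Definition asymp (a b : nat -> R) : Prop :=
  is_lim_seq (fun n => a n / b n) 1.

Definition Gamma (s : R) : R :=
  RInt_gen (fun t => Rpower t (s - 1) * exp (- t)) (at_right 0) (Rbar_locally p_infty).

Definition nu (p : nat -> R) (delta : R) (n : nat) : R :=
  sum_f_R0 (fun l => if (Nat.even l && Nat.leb 2 l)%bool
                     then / (INR l * Lint p delta (sqrt (INR l))) else 0) n.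

(* Main.v *)
(** Write [M] for the scale function and [alive n x] for P_x(tau_0 > n). For [m] of order [sqrt (eps n)],
    the walk started at 1 survives up to time [n] essentially only by reaching [m] before 0, which has
    probability [1 / M m], and then surviving from [m]; the error is controlled by the bound [O(m^2)] on the
    exit time of [(0,m)] together with the a priori estimate [alive n 1 = O(1 / M (sqrt n))]. If [kappa > 0],
    [alive n m] is compared with [F (m^2 / (2 n))], where [F] is the distribution function of the Gamma law
    with exponent [kappa]: up to [o(1/n)] this function solves the backward equation away from 0. Letting
    [eps -> 0], only [F w ~ w^kappa / (kappa Gamma(kappa))] matters. If [kappa = 0], [M] is slowly varying and
    [alive n m] is close to 1 for large [eps], so that P_0(tau_0 >= n) ~ [1 / M (sqrt n)]. The local estimate
    follows by monotone density, since by reversibility P_0(tau_0 = 2 m) is nonincreasing in [m].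
    All statements about the walk are proved by the maximum principle, i.e. induction on time. *)

Require Import Defs.
From Stdlib Require Import Reals Lra Lia Psatz ZArith Classical_Prop.
From Coquelicot Require Import Coquelicot.
Open Scope R_scope.

(** * Regularly varying sequences *)

(** The assumption [R_x = o(1/x)] gives regular variation in a differential form,
    [n (psi(n+1) / psi(n) - 1) -> rho], for [lambda], [M] and [L], so ratio limits and Karamata's
    theorem reduce to telescoping sums. [K0] and [L] stay out of the probabilistic argument: tails
    are normalised by [M (sqrt n)], and [M] is translated only at the end, by
    [M_x ~ x lambda_x / (2 kappa)] if [kappa > 0] and by comparing [nu] with [M] over blocks between
    squares if [kappa = 0]. The first gives the factor [2 kappa / K0]; the 2 in [m^2 / (2 n)] gives
    [2^(-kappa)]. The obstacle is that heat defects o(1/n) add up to an o(1) error over n steps.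
    This is useless from state 1, where the survival probability itself tends to 0, and harmless
    from height of order [sqrt n]. The same difficulty returns in the reduction to that height: the
    exit-time bound gives O(eps) for staying below m, but O(eps / M (sqrt n)) is needed. The time is
    therefore split, one block giving the factor eps and another the survival probability, bounded a
    priori. *)

Lemma lim_eps (u : nat -> R) (l : R) :
  is_lim_seq u l <->
  forall eps, 0 < eps -> exists N, forall n, (N <= n)%nat -> Rabs (u n - l) < eps.
Proof.
  rewrite <- is_lim_seq_spec. split.
  - intros H eps He. destruct (H (mkposreal eps He)) as [N HN].
    exists N. intros n Hn. exact (HN n Hn).
  - intros H eps. destruct (H eps (cond_pos eps)) as [N HN].
    exists N. exact HN.
Qed.

Lemma lim_infty (u : nat -> R) :
  is_lim_seq u p_infty <->
  forall A, exists N, forall n, (N <= n)%nat -> A < u n.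
Proof.
  rewrite <- is_lim_seq_spec. split; intros H A; destruct (H A) as [N HN]; exists N; exact HN.
Qed.

Lemma ev_lt (u : nat -> R) (l a : R) :
  is_lim_seq u l -> l < a -> exists N, forall n, (N <= n)%nat -> u n < a.
Proof.
  intros H Hl. destruct (proj1 (lim_eps u l) H (a - l)) as [N HN]; [lra|].
  exists N. intros n Hn. specialize (HN n Hn). apply Rabs_def2 in HN. lra.
Qed.

Lemma ev_gt (u : nat -> R) (l a : R) :
  is_lim_seq u l -> a < l -> exists N, forall n, (N <= n)%nat -> a < u n.
Proof.
  intros H Hl. destruct (proj1 (lim_eps u l) H (l - a)) as [N HN]; [lra|].
  exists N. intros n Hn. specialize (HN n Hn). apply Rabs_def2 in HN. lra.
Qed.

Lemma lim_between (u : nat -> R) (l : R) :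
  (forall e, 0 < e -> exists N, forall n, (N <= n)%nat -> u n <= l + e) ->
  (forall e, 0 < e -> exists N, forall n, (N <= n)%nat -> l - e <= u n) ->
  is_lim_seq u l.
Proof.
  intros Hu Hl. apply lim_eps. intros eps He.
  destruct (Hu (eps / 2)) as [N1 H1]; [lra|]. destruct (Hl (eps / 2)) as [N2 H2]; [lra|].
  exists (N1 + N2)%nat. intros n Hn.
  specialize (H1 n ltac:(lia)). specialize (H2 n ltac:(lia)). apply Rabs_def1; lra.
Qed.

Lemma lim_ext_from (N : nat) (u v : nat -> R) (l : Rbar) :
  (forall n, (N <= n)%nat -> u n = v n) -> is_lim_seq u l -> is_lim_seq v l.
Proof. intros H. apply is_lim_seq_ext_loc. exists N. exact H. Qed.

Lemma lim_inv_infty (u : nat -> R) :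
  is_lim_seq u p_infty -> is_lim_seq (fun n => / u n) 0.
Proof. intros H. exact (is_lim_seq_inv u p_infty H ltac:(discriminate)). Qed.

Lemma lim_mult_fin (u v : nat -> R) (a b : R) :
  is_lim_seq u a -> is_lim_seq v b -> is_lim_seq (fun n => u n * v n) (a * b).
Proof. intros Hu Hv. apply (is_lim_seq_mult u v a b (a * b) Hu Hv). reflexivity. Qed.

Lemma lim_plus_fin (u v : nat -> R) (a b : R) :
  is_lim_seq u a -> is_lim_seq v b -> is_lim_seq (fun n => u n + v n) (a + b).
Proof. intros Hu Hv. apply (is_lim_seq_plus u v a b (a + b) Hu Hv). reflexivity. Qed.

Lemma lim_div_fin (u v : nat -> R) (a b : R) :
  is_lim_seq u a -> is_lim_seq v b -> b <> 0 -> is_lim_seq (fun n => u n / v n) (a / b).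
Proof.
  intros Hu Hv Hb. apply (is_lim_seq_div u v a b (a / b) Hu Hv).
  - intros E. apply Hb. now inversion E.
  - reflexivity.
Qed.

Lemma lim_val (u : nat -> R) (a b : R) : a = b -> is_lim_seq u a -> is_lim_seq u b.
Proof. now intros ->. Qed.

Lemma lim_scal (u : nat -> R) (k a : R) :
  is_lim_seq u a -> is_lim_seq (fun n => k * u n) (k * a).
Proof. intros H. exact (lim_mult_fin _ _ _ _ (is_lim_seq_const k) H). Qed.

Lemma lim_Rpower (u : nat -> R) (c s : R) :
  0 < c -> is_lim_seq u c -> is_lim_seq (fun n => Rpower (u n) s) (Rpower c s).
Proof.
  intros Hc Hu. apply (is_lim_seq_continuous (fun x => Rpower x s) u c); [|exact Hu].
  apply derivable_continuous_pt. exists (s * Rpower c (s - 1)).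
  apply derivable_pt_lim_power; exact Hc.
Qed.

Lemma ln_le_sub1 (x : R) : 0 < x -> ln x <= x - 1.
Proof.
  intros Hx. generalize (exp_ineq1_le (ln x)). rewrite exp_ln by exact Hx. lra.
Qed.

Lemma ln_ge_sub1 (x : R) : 0 < x -> 1 - / x <= ln x.
Proof.
  intros Hx. generalize (ln_le_sub1 (/ x) (Rinv_0_lt_compat _ Hx)).
  rewrite ln_Rinv by exact Hx. lra.
Qed.

Lemma ln_quotient (x y : R) : 0 < x -> 0 < y -> ln (x / y) = ln x - ln y.
Proof.
  intros Hx Hy. unfold Rdiv. rewrite ln_mult, ln_Rinv; try lra.
  now apply Rinv_0_lt_compat.
Qed.

Lemma INR_gt0 (n : nat) : (1 <= n)%nat -> 0 < INR n.
Proof. intros H. apply lt_0_INR. lia. Qed.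

Definition flr (x : R) : nat := Z.to_nat (Int_part x).

Lemma flr_bounds (x : R) : 0 <= x -> INR (flr x) <= x < INR (flr x) + 1.
Proof.
  intros Hx. destruct (base_Int_part x) as [H1 H2]. unfold flr.
  assert (H0 : (0 <= Int_part x)%Z).
  { apply le_IZR. apply Rnot_lt_le. intros H.
    assert (H3 : (Int_part x <= -1)%Z) by (apply lt_IZR in H; lia).
    apply IZR_le in H3. lra. }
  rewrite INR_IZR_INZ, Z2Nat.id by exact H0. lra.
Qed.

Lemma flr_ge (x : R) (n : nat) : INR n <= x -> (n <= flr x)%nat.
Proof.
  intros H. assert (Hx : 0 <= x) by (generalize (pos_INR n); lra).
  destruct (flr_bounds x Hx) as [_ H2].
  assert (INR n < INR (S (flr x))) by (rewrite S_INR; lra).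
  apply INR_lt in H0. lia.
Qed.

Lemma flr_infty (x : nat -> R) :
  is_lim_seq x p_infty -> is_lim_seq (fun n => INR (flr (x n))) p_infty.
Proof.
  intros H. apply lim_infty. intros A.
  destruct (proj1 (lim_infty x) H (Rmax 0 A + 1)) as [N HN].
  exists N. intros n Hn. specialize (HN n Hn).
  generalize (Rmax_l 0 A) (Rmax_r 0 A). intros H1 H2.
  destruct (flr_bounds (x n)); lra.
Qed.

Lemma flr_equiv (x : nat -> R) :
  is_lim_seq x p_infty -> is_lim_seq (fun n => INR (flr (x n)) / x n) 1.
Proof.
  intros H.
  apply (is_lim_seq_le_le_loc (fun n => 1 - / x n) _ (fun _ => 1)).
  - destruct (proj1 (lim_infty x) H 0) as [N HN]. exists N. intros n Hn.
    specialize (HN n Hn). destruct (flr_bounds (x n)) as [H1 H2]; [lra|].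
    split.
    + apply Rmult_le_reg_r with (x n); [lra|]. field_simplify; lra.
    + apply Rmult_le_reg_r with (x n); [lra|]. field_simplify; lra.
  - apply (lim_val _ (1 + - 1 * 0)); [ring|].
    apply (is_lim_seq_ext (fun n => 1 + -1 * / x n)); [intros n; ring|].
    apply lim_plus_fin; [apply is_lim_seq_const|]. apply lim_scal. now apply lim_inv_infty.
  - apply is_lim_seq_const.
Qed.

Lemma infty_of_ratio (x y : nat -> R) (c : R) :
  0 < c -> is_lim_seq y p_infty -> is_lim_seq (fun n => x n / y n) c ->
  is_lim_seq x p_infty.
Proof.
  intros Hc Hy Hr. apply lim_infty. intros A.
  destruct (ev_gt _ _ (c / 2) Hr) as [N1 H1]; [lra|].
  destruct (proj1 (lim_infty y) Hy (Rmax 0 (A * 2 / c))) as [N2 H2].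
  exists (N1 + N2)%nat. intros n Hn.
  specialize (H1 n ltac:(lia)). specialize (H2 n ltac:(lia)).
  generalize (Rmax_l 0 (A * 2 / c)) (Rmax_r 0 (A * 2 / c)). intros H3 H4.
  assert (Hyp : 0 < y n) by lra.
  assert (H5 : c / 2 * y n < x n).
  { apply Rmult_lt_compat_r with (r := y n) in H1; [|lra].
    replace (x n / y n * y n) with (x n) in H1 by (field; lra). lra. }
  assert (H6 : A * 2 / c < y n) by lra.
  apply Rmult_lt_compat_l with (r := c / 2) in H6; [|lra].
  replace (c / 2 * (A * 2 / c)) with A in H6 by (field; lra). lra.
Qed.

Lemma flr_ratio (x y : nat -> R) (c : R) :
  0 < c -> is_lim_seq y p_infty -> is_lim_seq (fun n => x n / y n) c ->
  is_lim_seq (fun n => INR (flr (x n)) / INR (flr (y n))) c.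
Proof.
  intros Hc Hy Hr.
  assert (Hx := infty_of_ratio x y c Hc Hy Hr).
  assert (H1 := flr_equiv x Hx). assert (H2 := flr_equiv y Hy).
  apply (lim_val _ (1 * c / 1)); [field|].
  destruct (proj1 (lim_infty _) Hx 0) as [N1 P1].
  destruct (proj1 (lim_infty _) Hy 0) as [N2 P2].
  destruct (proj1 (lim_infty _) (flr_infty y Hy) 0) as [N3 P3].
  apply (lim_ext_from (N1 + N2 + N3) (fun n => INR (flr (x n)) / x n * (x n / y n) / (INR (flr (y n)) / y n))).
  - intros n Hn. specialize (P1 n ltac:(lia)). specialize (P2 n ltac:(lia)).
    specialize (P3 n ltac:(lia)). cbv beta in P3. field. lra.
  - apply lim_div_fin; [|exact H2|lra]. now apply lim_mult_fin.
Qed.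

Lemma n_ln1p (u : nat -> R) (rho : R) :
  (forall n, -1 < u n) ->
  is_lim_seq (fun n => INR n * u n) rho ->
  is_lim_seq (fun n => INR n * ln (1 + u n)) rho.
Proof.
  intros Hu H.
  assert (H0 : is_lim_seq u 0).
  { apply (lim_val _ (rho * 0)); [ring|].
    apply (lim_ext_from 1 (fun n => INR n * u n * / INR n)).
    - intros n Hn. generalize (INR_gt0 n Hn). intros. field. lra.
    - apply lim_mult_fin; [exact H|]. apply lim_inv_infty, is_lim_seq_INR. }
  apply (is_lim_seq_le_le_loc (fun n => INR n * u n / (1 + u n)) _ (fun n => INR n * u n)).
  - exists 0%nat. intros n _. specialize (Hu n).
    generalize (ln_le_sub1 (1 + u n) ltac:(lra)) (ln_ge_sub1 (1 + u n) ltac:(lra)) (pos_INR n).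
    intros H1 H2 H3. split.
    + replace (INR n * u n / (1 + u n)) with (INR n * (1 - / (1 + u n))) by (field; lra).
      now apply Rmult_le_compat_l.
    + apply Rmult_le_compat_l; lra.
  - apply (lim_val _ (rho / (1 + 0))); [field|].
    apply lim_div_fin; [exact H| |lra]. apply lim_plus_fin; [apply is_lim_seq_const|exact H0].
  - exact H.
Qed.

(** Normalized regular variation, the discrete form of [x psi'(x) / psi(x) -> rho]. It is stronger
    than convergence of the ratios [psi (c n) / psi n] and passes to partial sums. Positivity starts
    at 1 because [scaleM p 0 = 0]. *)
Definition regvar (psi : nat -> R) (rho : R) : Prop :=
  (forall n, (1 <= n)%nat -> 0 < psi n) /\
  is_lim_seq (fun n => INR n * (psi (S n) / psi n - 1)) rho.

Lemma ln_succ_bounds (n : nat) :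
  (1 <= n)%nat -> / (INR n + 1) <= ln (INR (S n)) - ln (INR n) <= / INR n.
Proof.
  intros Hn. assert (Hp := INR_gt0 n Hn). rewrite S_INR.
  rewrite <- ln_quotient by lra. split.
  - eapply Rle_trans; [|apply ln_ge_sub1; apply Rdiv_lt_0_compat; lra].
    apply Req_le. field. lra.
  - eapply Rle_trans; [apply ln_le_sub1; apply Rdiv_lt_0_compat; lra|].
    apply Req_le. field. lra.
Qed.

(** [h] is the logarithm of the slowly varying part. Its increments are o(1/n), hence eventually at
    most [eps] times those of [ln], and both sides telescope. This takes the place of the uniform
    convergence theorem. *)
Lemma regvar_log (psi : nat -> R) (rho : R) :
  regvar psi rho ->
  let h := fun n => ln (psi n) - rho * ln (INR n) in
  forall eps, 0 < eps -> exists N, (1 <= N)%nat /\ forall a b, (N <= a)%nat -> (a <= b)%nat ->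
    Rabs (h b - h a) <= eps * (ln (INR b) - ln (INR a)).
Proof.
  intros [Hpos Hlim] h eps He.
  assert (H1 : is_lim_seq (fun n => INR n * (h (S n) - h n)) 0).
  { apply (lim_val _ (rho + - rho * 1)); [ring|].
    (* The value at index 0 is a placeholder: [n_ln1p] asks for [-1 < u n] at every index. *)
    set (u := fun n => match n with O => 0 | _ => psi (S n) / psi n - 1 end).
    set (v := fun n => match n with O => 0 | _ => / INR n end).
    apply (lim_ext_from 1 (fun n => INR n * ln (1 + u n) + - rho * (INR n * ln (1 + v n)))).
    - intros n Hn. assert (Hp := INR_gt0 n Hn). unfold h. destruct n as [|n]; [lia|].
      unfold u, v. assert (P1 := Hpos (S n) ltac:(lia)). assert (P2 := Hpos (S (S n)) ltac:(lia)).
      replace (1 + (psi (S (S n)) / psi (S n) - 1)) with (psi (S (S n)) / psi (S n)) by ring.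
      rewrite ln_quotient by assumption.
      replace (1 + / INR (S n)) with (INR (S (S n)) / INR (S n))
        by (rewrite (S_INR (S n)); field; lra).
      rewrite ln_quotient by (try apply INR_gt0; lia || lra). ring.
    - apply lim_plus_fin; [|apply lim_scal]; apply n_ln1p.
      + intros [|n]; unfold u; [lra|].
        assert (P1 := Hpos (S n) ltac:(lia)). assert (P2 := Hpos (S (S n)) ltac:(lia)).
        assert (0 < psi (S (S n)) / psi (S n)) by now apply Rdiv_lt_0_compat. lra.
      + apply (lim_ext_from 1 (fun n => INR n * (psi (S n) / psi n - 1))); [|exact Hlim].
        intros [|n] Hn; [lia|reflexivity].
      + intros [|n]; unfold v; [lra|].
        assert (0 < / INR (S n)) by (apply Rinv_0_lt_compat, INR_gt0; lia). lra.
      + apply (lim_ext_from 1 (fun n => 1)); [|apply is_lim_seq_const].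
        intros [|n] Hn; [lia|]. unfold v. field. apply not_0_INR. lia. }
  destruct (proj1 (lim_eps _ _) H1 (eps / 2)) as [N HN]; [lra|].
  exists (S N). split; [lia|].
  assert (Hstep : forall n, (S N <= n)%nat ->
    Rabs (h (S n) - h n) <= eps * (ln (INR (S n)) - ln (INR n))).
  { intros n Hn. specialize (HN n ltac:(lia)). rewrite Rminus_0_r, Rabs_mult in HN.
    assert (Hp := INR_gt0 n ltac:(lia)). rewrite (Rabs_pos_eq (INR n)) in HN by lra.
    assert (H1n : 1 <= INR n) by (apply (le_INR 1); lia).
    destruct (ln_succ_bounds n ltac:(lia)) as [H2 _].
    apply Rle_trans with (eps * / (INR n + 1)); [|apply Rmult_le_compat_l; lra].
    apply Rmult_le_reg_l with (INR n); [lra|].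
    apply Rle_trans with (eps / 2); [lra|].
    apply Rmult_le_reg_r with (2 * (INR n + 1)); [lra|].
    replace (INR n * (eps * / (INR n + 1)) * (2 * (INR n + 1))) with (2 * eps * INR n) by (field; lra).
    nra. }
  intros a b Ha Hab. induction Hab as [|b Hab IH].
  - rewrite !Rminus_diag, Rabs_R0. lra.
  - specialize (Hstep b ltac:(lia)).
    replace (h (S b) - h a) with ((h (S b) - h b) + (h b - h a)) by ring.
    eapply Rle_trans; [apply Rabs_triang|]. lra.
Qed.

(** As [ln (b n / a n)] stays bounded, [regvar_log] makes the slowly varying parts agree in the
    limit, and only the power [c^rho] survives. General index sequences are needed since the
    arguments will be floors of square roots. *)
Lemma regvar_ratio (psi : nat -> R) (rho : R) (a b : nat -> nat) (c : R) :
  regvar psi rho -> 0 < c ->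
  is_lim_seq (fun n => INR (a n)) p_infty ->
  is_lim_seq (fun n => INR (b n) / INR (a n)) c ->
  is_lim_seq (fun n => psi (b n) / psi (a n)) (Rpower c rho).
Proof.
  intros Hrv Hc Ha Hr. assert (Hlog := regvar_log psi rho Hrv). cbv zeta in Hlog.
  destruct Hrv as [Hpos _].
  set (h := fun n => ln (psi n) - rho * ln (INR n)) in *.
  assert (Hb := infty_of_ratio _ _ c Hc Ha Hr).
  assert (Hln : is_lim_seq (fun n => ln (INR (b n) / INR (a n))) (ln c)).
  { apply (is_lim_seq_continuous ln); [|exact Hr].
    apply derivable_continuous_pt. exists (/ c). now apply derivable_pt_lim_ln. }
  assert (Hh : is_lim_seq (fun n => h (b n) - h (a n)) 0).
  { apply lim_eps. intros eps He.
    set (K := Rabs (ln c) + 1). assert (HK : 0 < K) by (unfold K; generalize (Rabs_pos (ln c)); lra).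
    destruct (Hlog (eps / (2 * K))) as (N & HN1 & HN); [apply Rdiv_lt_0_compat; lra|].
    destruct (proj1 (lim_infty _) Ha (INR N)) as [N1 P1].
    destruct (proj1 (lim_infty _) Hb (INR N)) as [N2 P2].
    destruct (proj1 (lim_eps _ _) Hln 1) as [N3 P3]; [lra|].
    exists (N1 + N2 + N3)%nat. intros n Hn.
    specialize (P1 n ltac:(lia)). specialize (P2 n ltac:(lia)). specialize (P3 n ltac:(lia)).
    cbv beta in P1, P2. apply INR_lt in P1, P2.
    rewrite ln_quotient in P3 by (apply INR_gt0; lia).
    assert (HKb : Rabs (ln (INR (b n)) - ln (INR (a n))) < K).
    { unfold K. replace (ln (INR (b n)) - ln (INR (a n))) with
        ((ln (INR (b n)) - ln (INR (a n)) - ln c) + ln c) by ring.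
      eapply Rle_lt_trans; [apply Rabs_triang|]. lra. }
    assert (HE : 0 < eps / (2 * K)) by (apply Rdiv_lt_0_compat; lra).
    assert (HEK : eps / (2 * K) * K < eps) by (replace (eps / (2 * K) * K) with (eps / 2) by (field; lra); lra).
    rewrite Rminus_0_r.
    apply Rle_lt_trans with (eps / (2 * K) * Rabs (ln (INR (b n)) - ln (INR (a n)))); [|nra].
    destruct (Nat.le_ge_cases (a n) (b n)) as [Hab|Hab].
    - eapply Rle_trans; [apply HN; lia|].
      apply Rmult_le_compat_l; [lra|apply Rle_abs].
    - rewrite Rabs_minus_sym, (Rabs_minus_sym (ln (INR (b n)))).
      eapply Rle_trans; [apply HN; lia|].
      apply Rmult_le_compat_l; [lra|apply Rle_abs]. }
  destruct (proj1 (lim_infty _) Ha 1) as [N1 P1].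
  destruct (proj1 (lim_infty _) Hb 1) as [N2 P2].
  apply (lim_ext_from (N1 + N2) (fun n => exp (h (b n) - h (a n) + rho * ln (INR (b n) / INR (a n))))).
  - intros n Hn. specialize (P1 n ltac:(lia)). specialize (P2 n ltac:(lia)).
    cbv beta in P1, P2. change 1 with (INR 1) in P1, P2. apply INR_lt in P1, P2.
    rewrite ln_quotient by (apply INR_gt0; lia).
    unfold h. match goal with |- exp ?e = _ => replace e with (ln (psi (b n)) - ln (psi (a n))) by ring end.
    rewrite <- ln_quotient by (apply Hpos; lia).
    apply exp_ln. apply Rdiv_lt_0_compat; apply Hpos; lia.
  - unfold Rpower. apply (is_lim_seq_continuous exp).
    + apply derivable_continuous_pt, derivable_pt_exp.
    + apply (lim_val _ (0 + rho * ln c)); [ring|].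
      apply lim_plus_fin; [exact Hh|]. now apply lim_scal.
Qed.

Lemma regvar_flr (psi : nat -> R) (rho : R) (x y : nat -> R) (c : R) :
  regvar psi rho -> 0 < c -> is_lim_seq x p_infty ->
  is_lim_seq (fun n => y n / x n) c ->
  is_lim_seq (fun n => psi (flr (y n)) / psi (flr (x n))) (Rpower c rho).
Proof.
  intros H Hc Hx Hr. apply (regvar_ratio psi rho (fun n => flr (x n)) (fun n => flr (y n)) c H Hc).
  - now apply flr_infty.
  - now apply flr_ratio.
Qed.

(** * Partial sums and Karamata's theorem *)

Fixpoint psum (phi : nat -> R) (n : nat) : R :=
  match n with
  | O => 0
  | S k => psum phi k + phi k
  end.

Lemma psum_sum_f_R0 (phi : nat -> R) (n : nat) : sum_f_R0 phi n = psum phi (S n).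
Proof. induction n as [|n IH]; simpl in *; [ring|]. rewrite IH. ring. Qed.

Lemma psum_le (f g : nat -> R) (n : nat) :
  (forall k, (k < n)%nat -> f k <= g k) -> psum f n <= psum g n.
Proof.
  induction n as [|n IH]; intros H; simpl; [lra|].
  apply Rplus_le_compat; [apply IH; intros; apply H; lia|apply H; lia].
Qed.

Lemma psum_ext (f g : nat -> R) (n : nat) :
  (forall k, (k < n)%nat -> f k = g k) -> psum f n = psum g n.
Proof.
  induction n as [|n IH]; intros H; simpl; [reflexivity|].
  rewrite IH by (intros; apply H; lia). rewrite H by lia. reflexivity.
Qed.

Lemma psum_scal (c : R) (f : nat -> R) (n : nat) : psum (fun k => c * f k) n = c * psum f n.
Proof. induction n as [|n IH]; simpl; [ring|]. rewrite IH. ring. Qed.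

Lemma psum_const (c : R) (n : nat) : psum (fun _ => c) n = INR n * c.
Proof. induction n as [|n IH]; [simpl; ring|]. rewrite S_INR. simpl. rewrite IH. ring. Qed.

Lemma psum_mono (phi : nat -> R) (a b : nat) :
  (forall n, 0 <= phi n) -> (a <= b)%nat -> psum phi a <= psum phi b.
Proof.
  intros H Hab. induction Hab as [|b Hab IH]; [lra|]. simpl. specialize (H b). lra.
Qed.

(** Stolz-Cesaro, read off from the weighted mean theorem [Cesaro] with weights [a] applied to
    [b / a]. *)
Lemma stolz (a b : nat -> R) (l : R) :
  (forall n, 0 < a n) -> is_lim_seq (psum a) p_infty ->
  is_lim_seq (fun n => b n / a n) l ->
  is_lim_seq (fun n => psum b n / psum a n) l.
Proof.
  intros Ha Hinf Hl. apply is_lim_seq_incr_1, is_lim_seq_Reals.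
  assert (HC := Cesaro a (fun n => b n / a n) l).
  intros eps He. destruct (HC (proj1 (is_lim_seq_Reals _ _) Hl) Ha) with (eps := eps) as [N HN].
  - intros A. destruct (proj1 (lim_infty _) Hinf A) as [N HN]. exists N. intros n Hn.
    rewrite psum_sum_f_R0. apply HN. lia.
  - exact He.
  - exists N. intros n Hn. specialize (HN n Hn). rewrite !psum_sum_f_R0 in HN.
    rewrite (psum_ext b (fun k => a k * (b k / a k))); [exact HN|].
    intros k _. specialize (Ha k). field. lra.
Qed.

(** A discrete product rule for [n phi(n)]; it is what makes Stolz applicable in [karamata]. *)
Lemma regvar_increment (phi : nat -> R) (rho : R) :
  (forall n, 0 < phi n) -> regvar phi rho ->
  is_lim_seq (fun n => (INR (S n) * phi (S n) - INR n * phi n) / phi n) (1 + rho).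
Proof.
  intros Hp [_ H].
  set (u := fun n => INR n * (phi (S n) / phi n - 1)) in H.
  apply (lim_val _ (1 + (rho + rho * 0))); [ring|].
  apply (lim_ext_from 1 (fun n => 1 + (u n + u n * / INR n))).
  - intros n Hn. assert (Hn' := INR_gt0 n Hn). specialize (Hp n). unfold u. rewrite S_INR. field. lra.
  - apply lim_plus_fin; [apply is_lim_seq_const|]. apply lim_plus_fin; [exact H|].
    apply lim_mult_fin; [exact H|]. apply lim_inv_infty, is_lim_seq_INR.
Qed.

Lemma psum_telescope (f : nat -> R) (n : nat) :
  psum (fun k => f (S k) - f k) n = f n - f 0%nat.
Proof. induction n as [|n IH]; simpl; [ring|]. rewrite IH. ring. Qed.

Lemma karamata (phi : nat -> R) (rho : R) :
  (forall n, 0 < phi n) -> regvar phi rho -> is_lim_seq (psum phi) p_infty ->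
  is_lim_seq (fun n => INR n * phi n / psum phi n) (1 + rho).
Proof.
  intros Hp Hr Hinf.
  apply (is_lim_seq_ext (fun n => psum (fun k => INR (S k) * phi (S k) - INR k * phi k) n / psum phi n)).
  - intros n. rewrite (psum_telescope (fun k => INR k * phi k)). simpl (INR 0). f_equal. ring.
  - apply stolz; [exact Hp|exact Hinf|]. now apply regvar_increment.
Qed.

(** Since [1 + rho > 0], the sequence [n phi(n)] is eventually increasing, so [phi(n) >= c / n] and
    the partial sums dominate [c ln n] up to a constant. *)
Lemma regvar_diverges (phi : nat -> R) (rho : R) :
  (forall n, 0 < phi n) -> regvar phi rho -> -1 < rho -> is_lim_seq (psum phi) p_infty.
Proof.
  intros Hp Hr Hrho.
  destruct (ev_gt _ _ 0 (regvar_increment phi rho Hp Hr)) as [N HN]; [lra|].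
  set (c := INR (S N) * phi (S N)).
  assert (Hc : 0 < c) by (apply Rmult_lt_0_compat; [apply INR_gt0; lia|apply Hp]).
  assert (Hge : forall n, (S N <= n)%nat -> c <= INR n * phi n).
  { intros n Hn. induction Hn as [|n Hn IH]; [apply Rle_refl|].
    specialize (HN n ltac:(lia)). specialize (Hp n).
    apply Rmult_lt_compat_r with (r := phi n) in HN; [|exact Hp].
    unfold Rdiv in HN. rewrite Rmult_assoc, Rinv_l, Rmult_0_l in HN by lra. lra. }
  assert (Hln : forall n, (S N <= n)%nat -> c * (ln (INR n) - ln (INR (S N))) <= psum phi n).
  { intros n Hn. induction Hn as [|n Hn IH].
    - rewrite Rminus_diag, Rmult_0_r. apply (psum_mono phi 0); [|lia]. intros k. apply Rlt_le, Hp.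
    - simpl psum. destruct (ln_succ_bounds n ltac:(lia)) as [_ H2].
      assert (H3 := Hge n ltac:(lia)). assert (Hn' := INR_gt0 n ltac:(lia)).
      assert (c * / INR n <= phi n).
      { apply Rmult_le_reg_l with (INR n); [lra|].
        replace (INR n * (c * / INR n)) with c by (field; lra). exact H3. }
      nra. }
  apply lim_infty. intros A.
  destruct (proj1 (lim_infty _) is_lim_seq_INR (exp (A / c + ln (INR (S N))))) as [N1 H1].
  exists (S N + N1)%nat. intros n Hn. specialize (H1 n ltac:(lia)). specialize (Hln n ltac:(lia)).
  apply ln_increasing in H1; [|apply exp_pos]. rewrite ln_exp in H1.
  apply Rlt_le_trans with (2 := Hln).
  replace A with (c * (A / c)) at 1 by (field; lra). nra.
Qed.

(** The increment of [psum phi] is [phi] itself, so the definition of [regvar] becomes the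
    conclusion of [karamata]. *)
Lemma regvar_psum (phi : nat -> R) (rho : R) :
  (forall n, 0 < phi n) -> regvar phi rho -> is_lim_seq (psum phi) p_infty ->
  regvar (psum phi) (1 + rho).
Proof.
  intros Hp Hr Hinf.
  assert (Hpos : forall n, (1 <= n)%nat -> 0 < psum phi n).
  { intros [|n] Hn; [lia|]. simpl. assert (H := psum_mono phi 0 n (fun k => Rlt_le _ _ (Hp k)) ltac:(lia)).
    simpl in H. specialize (Hp n). lra. }
  split; [exact Hpos|].
  apply (lim_ext_from 1 (fun n => INR n * phi n / psum phi n)); [|now apply karamata].
  intros n Hn. simpl. specialize (Hpos n Hn). field. lra.
Qed.

(** * The walk killed at 0 *)

Section Walk.
Variable p : nat -> R.
Hypothesis Hp : forall x, (1 <= x)%nat -> 0 < p x < 1.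

(* The value 0 at state 0 kills the walk there. *)
Definition step (f : nat -> R) (x : nat) : R :=
  match x with
  | O => 0
  | S y => p x * f (S x) + (1 - p x) * f y
  end.

(* P_x(tau_0 > n) for x >= 1. *)
Fixpoint alive (n : nat) : nat -> R :=
  match n with
  | O => fun x => match x with O => 0 | S _ => 1 end
  | S k => step (alive k)
  end.

(* The probability that the walk started at [x] stays in (0,m) up to time [n]. *)
Fixpoint confined (m n : nat) : nat -> R :=
  match n with
  | O => fun x => if Nat.ltb x m then (match x with O => 0 | S _ => 1 end) else 0
  | S k => fun x => if Nat.ltb x m then step (confined m k) x else 0
  end.

Lemma step_S f y : step f (S y) = p (S y) * f (S (S y)) + (1 - p (S y)) * f y.
Proof. reflexivity. Qed.

Lemma step_le f g y :
  f (S (S y)) <= g (S (S y)) -> f y <= g y -> step f (S y) <= step g (S y).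
Proof. intros H1 H2. simpl. destruct (Hp (S y)); [lia|]. nra. Qed.

Lemma alive_0 n : alive n 0 = 0.
Proof. destruct n; reflexivity. Qed.

Lemma alive_bounds n x : 0 <= alive n x <= 1.
Proof.
  revert x. induction n as [|n IH]; intros [|x]; simpl; try lra.
  generalize (IH (S (S x))) (IH x). destruct (Hp (S x)); [lia|]. nra.
Qed.

Lemma alive_decr n x : alive (S n) x <= alive n x.
Proof.
  revert x. induction n as [|n IH]; intros [|x].
  - simpl; lra.
  - generalize (alive_bounds 1 (S x)). intros H. change (alive 0 (S x)) with 1. lra.
  - rewrite !alive_0. lra.
  - change (step (alive (S n)) (S x) <= step (alive n) (S x)). apply step_le; apply IH.
Qed.

Lemma alive_antitone n k x : (n <= k)%nat -> alive k x <= alive n x.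
Proof.
  intros H. induction H as [|k H IH]; [lra|]. eapply Rle_trans; [apply alive_decr|exact IH].
Qed.

Lemma confined_out m n x : (m <= x)%nat -> confined m n x = 0.
Proof. intros H. destruct n; simpl; replace (Nat.ltb x m) with false; try reflexivity; symmetry; apply Nat.ltb_ge; lia. Qed.

Lemma confined_0 m n : confined m n 0 = 0.
Proof. destruct n; simpl; destruct (Nat.ltb 0 m); reflexivity. Qed.

Lemma confined_in m n x : (x < m)%nat -> confined m (S n) x = step (confined m n) x.
Proof. intros H. simpl confined. apply Nat.ltb_lt in H. rewrite H. reflexivity. Qed.

Lemma confined_init m x : (S x < m)%nat -> confined m 0 (S x) = 1.
Proof. intros H. simpl confined. apply Nat.ltb_lt in H. rewrite H. reflexivity. Qed.

Lemma confined_le_alive m n x : 0 <= confined m n x <= alive n x.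
Proof.
  revert x. induction n as [|n IH]; intros x.
  - simpl. destruct (Nat.ltb x m), x; lra.
  - destruct (Nat.lt_ge_cases x m) as [H|H].
    + rewrite confined_in by exact H. destruct x as [|x]; [simpl; lra|].
      split.
      * simpl. generalize (IH (S (S x))) (IH x). destruct (Hp (S x)); [lia|]. nra.
      * apply step_le; apply IH.
    + rewrite confined_out by exact H. generalize (alive_bounds (S n) x). lra.
Qed.

Lemma confined_decr m n x : confined m (S n) x <= confined m n x.
Proof.
  revert x. induction n as [|n IH]; intros x.
  - destruct (Nat.lt_ge_cases x m) as [H|H].
    + destruct x as [|x]; [rewrite !confined_0; lra|].
      rewrite (confined_init m x H). generalize (confined_le_alive m 1 (S x)) (alive_bounds 1 (S x)). lra.
    + rewrite !confined_out by exact H. lra.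
  - destruct (Nat.lt_ge_cases x m) as [H|H].
    + destruct x as [|x]; [rewrite !confined_0; lra|].
      rewrite !(fun k => confined_in m k (S x) H). apply step_le; apply IH.
    + rewrite !confined_out by exact H. lra.
Qed.

Lemma confined_antitone m n k x : (n <= k)%nat -> confined m k x <= confined m n x.
Proof.
  intros H. induction H as [|k H IH]; [lra|]. eapply Rle_trans; [apply confined_decr|exact IH].
Qed.

(** Markov property at time [n]: the last [k] steps cost a factor at most [s], wherever the walk
    then is. *)
Lemma confined_split m n k s x :
  (forall y, confined m k y <= s) -> confined m (n + k) x <= s * confined m n x.
Proof.
  intros Hs. revert x. induction n as [|n IH]; intros x; simpl Nat.add.
  - destruct (Nat.lt_ge_cases x m) as [H|H].
    + destruct x as [|x]; [rewrite !confined_0; lra|].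
      rewrite (confined_init m x H), Rmult_1_r. apply Hs.
    + rewrite !confined_out by exact H. lra.
  - destruct (Nat.lt_ge_cases x m) as [H|H].
    + rewrite !confined_in by exact H. destruct x as [|x]; [simpl; lra|].
      simpl. generalize (IH (S (S x))) (IH x). destruct (Hp (S x)); [lia|]. nra.
    + rewrite !confined_out by exact H. lra.
Qed.

(** [W] is a supersolution for the expected exit time of (0,m), which is the sum over [k] of
    [confined m k x]. As [confined] decreases in time, [n] times its value at time [n] is at most
    that sum: Markov's inequality for the exit time. *)
Lemma confined_time m (W : nat -> R) :
  (forall x, (x <= m)%nat -> 0 <= W x) ->
  (forall x, (1 <= x < m)%nat -> 1 + step W x <= W x) ->
  forall n x, (x <= m)%nat -> INR n * confined m n x <= W x.
Proof.
  intros H0 HW.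
  assert (Hsum : forall n x, (x <= m)%nat -> psum (fun k => confined m k x) n <= W x).
  { induction n as [|n IH]; intros x Hx; [apply H0, Hx|].
    assert (Hz : forall x, (forall k, confined m k x = 0) -> psum (fun k => confined m k x) (S n) = 0).
    { intros y Hy. rewrite (psum_ext _ (fun _ => 0)) by (intros; apply Hy). rewrite psum_const. ring. }
    destruct (Nat.eq_dec x m) as [->|Hne].
    { rewrite Hz by (intros; apply confined_out; lia). apply H0; lia. }
    destruct x as [|x].
    { rewrite Hz by (intros; apply confined_0). apply H0; lia. }
    assert (Hshift : forall j, psum (fun k => confined m k (S x)) (S j) =
      1 + step (fun y => psum (fun k => confined m k y) j) (S x)).
    { induction j as [|j IHj].
      - cbn [psum]. rewrite confined_init by lia. simpl. ring.
      - change (psum (fun k => confined m k (S x)) (S (S j))) with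
          (psum (fun k => confined m k (S x)) (S j) + confined m (S j) (S x)).
        rewrite IHj, confined_in by lia. simpl. ring. }
    rewrite Hshift. eapply Rle_trans; [|apply HW; lia].
    apply Rplus_le_compat_l. apply step_le; apply IH; lia. }
  intros n x Hx. eapply Rle_trans; [|apply (Hsum n x Hx)].
  rewrite <- psum_const. apply psum_le. intros k Hk. apply confined_antitone. lia.
Qed.

(** * Scale function and hitting probabilities *)

Lemma lambda_pos x : 0 < lambda p x.
Proof.
  induction x as [|x IH]; simpl; [lra|]. destruct (Hp (S x)); [lia|].
  apply Rmult_lt_0_compat; [exact IH|]. apply Rdiv_lt_0_compat; lra.
Qed.

Lemma lambda_balance x : p (S x) * lambda p (S x) = (1 - p (S x)) * lambda p x.
Proof. simpl. destruct (Hp (S x)); [lia|]. field. lra. Qed.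

Lemma scaleM_psum x : scaleM p x = psum (lambda p) x.
Proof. induction x as [|x IH]; simpl; [reflexivity|]. now rewrite IH. Qed.

Lemma scaleM_pos x : (1 <= x)%nat -> 0 < scaleM p x.
Proof.
  destruct x as [|x]; [lia|]. intros _. induction x as [|x IH]; simpl in *; [lra|].
  generalize (lambda_pos (S x)). simpl. lra.
Qed.

Lemma scaleM_nonneg x : 0 <= scaleM p x.
Proof. destruct x; [simpl; lra|]. apply Rlt_le, scaleM_pos. lia. Qed.

Lemma scaleM_mono x y : (x <= y)%nat -> scaleM p x <= scaleM p y.
Proof. intros H. induction H as [|y H IH]; [lra|]. simpl. generalize (lambda_pos y). lra. Qed.

Lemma step_scaleM x : step (scaleM p) (S x) = scaleM p (S x).
Proof.
  rewrite step_S. assert (H := lambda_balance x).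
  change (scaleM p (S (S x))) with (scaleM p x + lambda p x + lambda p (S x)).
  change (scaleM p (S x)) with (scaleM p x + lambda p x). nra.
Qed.

(** A walk that survives [j + k] steps either stays in (0,m) for the first [j], or reaches [m]
    before 0 and still has at least [k] steps to survive. As [M] is harmonic, the right side solves
    the backward equation inside (0,m); at [m] it dominates because [alive] decreases in time. *)
Lemma alive_upper m k j x : (1 <= m)%nat -> (x <= m)%nat ->
  alive (j + k) x <= scaleM p x / scaleM p m * alive k m + confined m j x.
Proof.
  intros Hm. assert (HM := scaleM_pos m Hm). revert x. induction j as [|j IH]; intros x Hx.
  - simpl Nat.add. destruct (Nat.eq_dec x m) as [->|Hne].
    + rewrite confined_out by lia. unfold Rdiv. rewrite Rinv_r by lra. lra.
    + destruct x as [|x]; [rewrite alive_0, confined_0; simpl; lra|].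
      rewrite confined_init by lia.
      assert (0 <= scaleM p (S x) / scaleM p m * alive k m).
      { apply Rmult_le_pos; [|apply alive_bounds].
        apply Rdiv_le_0_compat; [apply scaleM_nonneg|exact HM]. }
      generalize (alive_bounds k (S x)). lra.
  - destruct (Nat.eq_dec x m) as [->|Hne].
    + rewrite confined_out by lia. unfold Rdiv. rewrite Rinv_r by lra.
      generalize (alive_antitone k (S j + k) m ltac:(lia)). lra.
    + destruct x as [|x]; [rewrite alive_0, confined_0; simpl; lra|].
      rewrite confined_in by lia. rewrite <- step_scaleM.
      change (alive (S j + k)) with (step (alive (j + k))).
      eapply Rle_trans.
      * apply (step_le _ (fun y => scaleM p y / scaleM p m * alive k m + confined m j y)); apply IH; lia.
      * rewrite !step_S. apply Req_le. field. lra.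
Qed.

(** It is enough to reach [m] before 0 and then to survive [n] more steps. In the induction the time
    [j] grows only up to [n], so [alive j m] stays above the fixed value [alive n m]. *)
Lemma alive_lower m n x : (1 <= m)%nat -> (x <= m)%nat ->
  scaleM p x / scaleM p m * alive n m <= alive n x.
Proof.
  intros Hm Hx. assert (HM := scaleM_pos m Hm).
  cut (forall j y, (j <= n)%nat -> (y <= m)%nat ->
     scaleM p y / scaleM p m * alive n m <= alive j y).
  { intros H. apply H; lia. }
  clear x Hx. induction j as [|j IH]; intros y Hj Hy.
  - destruct y as [|y]; [simpl; lra|]. change (alive 0 (S y)) with 1.
    generalize (alive_bounds n m) (scaleM_mono _ _ Hy) (scaleM_nonneg (S y)). intros H1 H2 H3.
    assert (scaleM p (S y) / scaleM p m <= 1).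
    { apply Rmult_le_reg_r with (scaleM p m); [lra|]. unfold Rdiv.
      rewrite Rmult_assoc, Rinv_l; lra. }
    assert (0 <= scaleM p (S y) / scaleM p m) by (apply Rdiv_le_0_compat; lra). nra.
  - destruct (Nat.eq_dec y m) as [->|Hne].
    + unfold Rdiv. rewrite Rinv_r by lra. generalize (alive_antitone (S j) n m Hj). lra.
    + destruct y as [|y]; [simpl; lra|].
      rewrite <- step_scaleM. change (alive (S j)) with (step (alive j)).
      eapply Rle_trans.
      * apply Req_le. symmetry. rewrite step_S.
        instantiate (1 := step (fun x => scaleM p x / scaleM p m * alive n m) (S y)).
        rewrite step_S. field. lra.
      * apply (step_le (fun x => scaleM p x / scaleM p m * alive n m)); apply IH; lia.
Qed.

(** * Taboo probabilities as the adjoint of the backward equation *)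

Lemma taboo_beyond n y : (n < y)%nat -> taboo p n y = 0.
Proof.
  revert y. induction n as [|n IH]; intros [|y] H; try lia; [reflexivity|].
  simpl. rewrite !IH by lia. ring.
Qed.

Lemma taboo_S_0 n : taboo p (S n) 0 = 0.
Proof. reflexivity. Qed.

Lemma trans_up x : trans p (S x) (S (S x)) = p (S x).
Proof. unfold trans. rewrite Nat.eqb_refl. reflexivity. Qed.

Lemma trans_down x : trans p (S x) x = 1 - p (S x).
Proof.
  unfold trans. replace (Nat.eqb x (S (S x))) with false by (symmetry; apply Nat.eqb_neq; lia).
  now rewrite Nat.eqb_refl.
Qed.

Lemma taboo_SS n y :
  taboo p (S (S n)) (S y) = taboo p (S n) y * p y + taboo p (S n) (S (S y)) * (1 - p (S (S y))).
Proof.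
  change (taboo p (S (S n)) (S y)) with
    (taboo p (S n) y * trans p y (S y) + taboo p (S n) (S (S y)) * trans p (S (S y)) (S y)).
  rewrite trans_down. destruct y; [rewrite taboo_S_0; ring|]. now rewrite trans_up.
Qed.

(** Summation by parts moves one step of the forward recursion onto [f]. Cutting at [N] leaves two
    boundary terms, which vanish because the taboo law at time [n + 1] lives on states at most
    [n + 1]. *)
Lemma taboo_dual n N f : (n + 2 < N)%nat -> f 0%nat = 0 ->
  psum (fun x => taboo p (S (S n)) x * f x) N = psum (fun x => taboo p (S n) x * step f x) N.
Proof.
  intros HN Hf. destruct N as [|N]; [lia|].
  assert (H : forall N, psum (fun x => taboo p (S (S n)) x * f x) (S N) =
    psum (fun x => taboo p (S n) x * step f x) (S N) - taboo p (S n) N * p N * f (S N)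
    + taboo p (S n) (S N) * (1 - p (S N)) * f N).
  { clear HN N. induction N as [|N IH].
    - cbn [psum]. rewrite !taboo_S_0, Hf. simpl. ring.
    - change (psum (fun x => taboo p (S (S n)) x * f x) (S (S N))) with
        (psum (fun x => taboo p (S (S n)) x * f x) (S N) + taboo p (S (S n)) (S N) * f (S N)).
      rewrite IH, taboo_SS.
      change (psum (fun x => taboo p (S n) x * step f x) (S (S N))) with
        (psum (fun x => taboo p (S n) x * step f x) (S N) + taboo p (S n) (S N) * step f (S N)).
      rewrite step_S. ring. }
  rewrite H, !(taboo_beyond (S n)) by lia. ring.
Qed.

Lemma taboo_one y : taboo p 1 y = match y with 1%nat => 1 | _ => 0 end.
Proof.
  destruct y as [|[|y]]; [reflexivity| |].
  - simpl. ring.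
  - simpl. ring.
Qed.

Lemma psum_taboo_one f N : (2 <= N)%nat -> psum (fun x => taboo p 1 x * f x) N = f 1%nat.
Proof.
  intros H. induction H as [|N H IH].
  - cbn [psum]. rewrite !taboo_one. ring.
  - cbn [psum]. rewrite IH, taboo_one. destruct N as [|[|N]]; [lia|lia|]. ring.
Qed.

Lemma survive_psum n N f : (forall x, f (S x) = 1) -> (n + 1 < N)%nat ->
  survive p (S n) = psum (fun x => taboo p (S n) x * f x) N.
Proof.
  intros Hf HN. unfold survive. rewrite psum_sum_f_R0. induction HN as [|m HN IH].
  - replace (S (n + 1)) with (S (S n)) by lia. apply psum_ext. intros [|k] _.
    + rewrite taboo_S_0. ring.
    + rewrite Hf. ring.
  - rewrite IH. cbn [psum]. rewrite (taboo_beyond (S n) m) by lia. ring.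
Qed.

(** The first step leads from 0 to 1, hence the shift by one. Time is passed from the forward law to
    the backward function one unit at a time; the cutoff [j + k + 3] is the same at every stage. *)
Lemma survive_alive n : survive p (S n) = alive n 1.
Proof.
  rewrite (survive_psum n (n + 3) (alive 0)) by (reflexivity || lia).
  assert (H : forall j k, psum (fun x => taboo p (S j) x * alive k x) (j + k + 3) = alive (j + k) 1).
  { induction j as [|j IH]; intros k.
    - apply psum_taboo_one. lia.
    - rewrite taboo_dual by (lia || apply alive_0). change (step (alive k)) with (alive (S k)).
      replace (S j + k + 3)%nat with (j + S k + 3)%nat by lia. rewrite IH. f_equal. lia. }
  specialize (H n 0%nat). rewrite Nat.add_0_r in H. exact H.
Qed.

Lemma survive_diff n : survive p n - survive p (S n) = ret_eq p (S n).
Proof.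
  destruct n as [|n].
  - rewrite survive_alive. unfold survive, ret_eq. simpl. ring.
  - rewrite (survive_psum (S n) (n + 3) (alive 0)) by (reflexivity || lia).
    rewrite taboo_dual by (lia || reflexivity).
    rewrite (survive_psum n (n + 3) (alive 0)) by (reflexivity || lia).
    unfold ret_eq. rewrite trans_down.
    (* [alive 0] and [step (alive 0)] differ only at state 1, by the probability [1 - p 1] of
       stepping to 0. *)
    assert (H : forall N, (2 <= N)%nat ->
      psum (fun x => taboo p (S n) x * alive 0 x) N - psum (fun x => taboo p (S n) x * step (alive 0) x) N
      = taboo p (S n) 1 * (1 - p 1%nat)).
    { intros N HN. induction HN as [|N HN IH].
      - cbn [psum]. rewrite !taboo_S_0. simpl step. simpl alive. ring.
      - cbn [psum]. destruct N as [|[|N]]; [lia|lia|].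
        assert (E : step (alive 0) (S (S N)) = alive 0 (S (S N))) by (simpl; ring).
        rewrite E, <- IH. ring. }
    apply H. lia.
Qed.

Lemma taboo_parity n y : Nat.odd (n + y) = true -> taboo p n y = 0.
Proof.
  revert y. induction n as [|n IH]; intros [|y] H; try reflexivity; [discriminate|].
  simpl. rewrite !IH; [ring| |].
  - replace (n + S (S y))%nat with (S n + S y)%nat by lia. exact H.
  - replace (S n + S y)%nat with (S (S (n + y))) in H by lia. exact H.
Qed.

Lemma ret_eq_odd m : ret_eq p (2 * m + 1) = 0.
Proof.
  replace (2 * m + 1)%nat with (S (2 * m)) by lia. unfold ret_eq.
  rewrite taboo_parity; [ring|]. rewrite Nat.odd_add, Nat.odd_mul. simpl. reflexivity.
Qed.

Lemma ret_ge_diff n : ret_ge p n - ret_ge p (S n) = ret_eq p n.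
Proof.
  destruct n as [|n]; [|apply survive_diff].
  simpl. unfold survive. simpl. ring.
Qed.

(** * Reversibility and monotonicity of the return probabilities *)

Definition edge (y : nat) : R := match y with O => 0 | S _ => / lambda p y end.
(** Reversible measure of the walk: [rev_measure y * p y = / lambda p y] is the conductance [edge y]
    between [y] and [y + 1]. Both are set to 0 at 0, where the walk is killed. *)
Definition rev_measure (y : nat) : R := match y with O => 0 | S _ => / (p y * lambda p y) end.
(** Density of the taboo law at time [n + 1] with respect to [rev_measure]. The shift makes [dens 0]
    the density of a unit mass at state 1. *)
Definition dens (n y : nat) : R := match y with O => 0 | S _ => taboo p (S n) y * (p y * lambda p y) end.

Lemma p_lambda_pos y : 0 < p (S y) * lambda p (S y).
Proof. apply Rmult_lt_0_compat; [apply Hp; lia|apply lambda_pos]. Qed.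

(** Detailed balance turns the forward recursion for the density into the backward operator. *)
Lemma dens_S n : forall y, dens (S n) y = step (dens n) y.
Proof.
  intros [|y]; [reflexivity|]. unfold dens at 1. rewrite taboo_SS, step_S.
  generalize (p_lambda_pos y) (p_lambda_pos (S y)) (lambda_balance (S y)) (lambda_balance y). intros H1 H2 H3 H4.
  replace (dens n (S (S y))) with (taboo p (S n) (S (S y)) * ((1 - p (S (S y))) * lambda p (S y)))
    by (rewrite <- H3; reflexivity).
  destruct y as [|y].
  - rewrite taboo_S_0. simpl dens. ring.
  - change (dens n (S y)) with (taboo p (S n) (S y) * (p (S y) * lambda p (S y))).
    transitivity (taboo p (S n) (S y) * p (S y) * ((1 - p (S (S y))) * lambda p (S y)) +
      taboo p (S n) (S (S (S y))) * (1 - p (S (S (S y)))) * (p (S (S y)) * lambda p (S (S y)))).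
    + rewrite <- H4. ring.
    + ring.
Qed.

Definition inner (f g : nat -> R) (N : nat) : R := psum (fun y => rev_measure y * f y * g y) N.

(** The case distinction restores the conductance [/ lambda p 0] of the edge between 0 and 1, which
    [edge] suppresses. *)
Lemma rev_measure_step f g y : g 0%nat = 0 ->
  rev_measure (S y) * step f (S y) * g (S y) =
  edge (S y) * f (S (S y)) * g (S y) + (match y with O => / lambda p 0 | S _ => edge y end) * f y * g (S y).
Proof.
  intros Hg. rewrite step_S. unfold rev_measure, edge.
  generalize (Hp (S y) ltac:(lia)) (lambda_balance y) (lambda_pos (S y)) (lambda_pos y). intros H0 H1 H2 H3.
  assert (E : / lambda p y = (1 - p (S y)) * / (p (S y) * lambda p (S y))).
  { rewrite H1. field. lra. }
  assert (E' : / lambda p (S y) = p (S y) * / (p (S y) * lambda p (S y))) by (field; lra).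
  replace (match y with O => / lambda p 0 | S _ => match y with O => 0 | S _ => / lambda p y end end)
    with (/ lambda p y) by (destruct y; reflexivity).
  rewrite E, E'. ring.
Qed.

(** Written as a sum over edges, the form is symmetric in [f] and [g] up to a boundary term at the
    cutoff, which carries a value at [S N] and vanishes. *)
Lemma inner_symm f g N : f 0%nat = 0 -> g 0%nat = 0 -> f (S N) = 0 -> g (S N) = 0 ->
  inner (step f) g (S N) = inner f (step g) (S N).
Proof.
  intros Hf Hg HfN HgN. unfold inner.
  assert (H : forall f g, f 0%nat = 0 -> g 0%nat = 0 -> forall N,
    psum (fun y => rev_measure y * step f y * g y) (S N) =
    psum (fun y => edge y * (f (S y) * g y + f y * g (S y))) (S N) - edge N * f N * g (S N)).
  { clear - Hp. intros f g Hf Hg. induction N as [|N IH].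
    - simpl. ring.
    - change (psum (fun y => rev_measure y * step f y * g y) (S (S N))) with
       (psum (fun y => rev_measure y * step f y * g y) (S N) + rev_measure (S N) * step f (S N) * g (S N)).
      rewrite IH, (rev_measure_step f g N Hg).
      change (psum (fun y => edge y * (f (S y) * g y + f y * g (S y))) (S (S N))) with
       (psum (fun y => edge y * (f (S y) * g y + f y * g (S y))) (S N) +
        edge (S N) * (f (S (S N)) * g (S N) + f (S N) * g (S (S N)))).
      destruct N as [|N]; [rewrite Hf; ring|]. ring. }
  rewrite (H f g Hf Hg).
  rewrite (psum_ext (fun y => rev_measure y * f y * step g y) (fun y => rev_measure y * step g y * f y))
    by (intros; ring).
  rewrite (H g f Hg Hf), HfN, HgN.
  rewrite (psum_ext (fun y => edge y * (g (S y) * f y + g y * f (S y)))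
    (fun y => edge y * (f (S y) * g y + f y * g (S y)))) by (intros; ring). ring.
Qed.

Lemma edge_nonneg y : 0 <= edge y.
Proof. destruct y; [apply Rle_refl|]. apply Rlt_le, Rinv_0_lt_compat, lambda_pos. Qed.

(** By convexity [(step f)^2 <= step (f^2)], and the integral of a nonnegative function against the
    reversible measure does not increase under the killed step. The auxiliary inequality keeps the
    boundary terms, so that it can be proved by induction on the cutoff. *)
Lemma inner_contract f N : f 0%nat = 0 -> f (S N) = 0 ->
  inner (step f) (step f) (S N) <= inner f f (S N).
Proof.
  intros Hf HfN. unfold inner.
  assert (H : forall N, psum (fun y => rev_measure y * step f y * step f y) (S N) <=
    psum (fun y => rev_measure y * f y * f y) (S N)
    + edge N * (f (S N) * f (S N)) - edge N * (f N * f N)).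
  { clear N HfN. induction N as [|K IH].
    - cbn [psum edge rev_measure]. lra.
    - change (psum (fun y => rev_measure y * step f y * step f y) (S (S K))) with
        (psum (fun y => rev_measure y * step f y * step f y) (S K) + rev_measure (S K) * step f (S K) * step f (S K)).
      change (psum (fun y => rev_measure y * f y * f y) (S (S K))) with
        (psum (fun y => rev_measure y * f y * f y) (S K) + rev_measure (S K) * f (S K) * f (S K)).
      generalize (Hp (S K) ltac:(lia)) (lambda_balance K) (lambda_pos (S K)) (lambda_pos K). intros H0 H1 H2 H3.
      set (r := rev_measure (S K)).
      assert (Hr : 0 < r) by (unfold r, rev_measure; apply Rinv_0_lt_compat, p_lambda_pos).
      assert (E' : edge (S K) = p (S K) * r) by (unfold edge, r, rev_measure; field; lra).
      assert (El : (1 - p (S K)) * r = / lambda p K) by (unfold r, rev_measure; rewrite H1; field; lra).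
      assert (E : edge K <= (1 - p (S K)) * r).
      { rewrite El. destruct K; [simpl; lra|apply Rle_refl]. }
      assert (Ef : edge K * (f K * f K) = (1 - p (S K)) * r * (f K * f K)).
      { rewrite El. destruct K; [rewrite Hf; ring|reflexivity]. }
      assert (Hc : step f (S K) * step f (S K) <=
        p (S K) * (f (S (S K)) * f (S (S K))) + (1 - p (S K)) * (f K * f K)).
      { rewrite step_S. set (a := f (S (S K))). set (b := f K). set (q := p (S K)) in *.
        assert (0 <= q * (1 - q) * ((a - b) * (a - b))) by
          (apply Rmult_le_pos; [apply Rmult_le_pos; lra|apply Rle_0_sqr]). nra. }
      apply Rmult_le_compat_l with (r := r) in Hc; [|lra].
      assert (Hsq := Rle_0_sqr (f (S K))). unfold Rsqr in Hsq.
      apply Rmult_le_compat_r with (r := f (S K) * f (S K)) in E; [|exact Hsq].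
      rewrite E'. rewrite Ef in IH. nra. }
  specialize (H N). rewrite HfN in H.
  assert (0 <= edge N * (f N * f N)) by (apply Rmult_le_pos; [apply edge_nonneg|apply Rle_0_sqr]). lra.
Qed.

Lemma dens_beyond n y : (S n < y)%nat -> dens n y = 0.
Proof. intros H. destruct y; [reflexivity|]. unfold dens. rewrite taboo_beyond by lia. ring. Qed.

Lemma inner_dens_shift i j N : (i + j + 2 < N)%nat ->
  inner (dens (S i)) (dens j) (S N) = inner (dens i) (dens (S j)) (S N).
Proof.
  intros H. unfold inner.
  rewrite (psum_ext _ (fun y => rev_measure y * step (dens i) y * dens j y))
    by (intros; now rewrite dens_S).
  rewrite (psum_ext (fun y => rev_measure y * dens i y * dens (S j) y)
    (fun y => rev_measure y * dens i y * step (dens j) y))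
    by (intros; now rewrite dens_S).
  apply inner_symm; reflexivity || (apply dens_beyond; lia).
Qed.

(* Reversibility: the return probability is a squared norm of the density at half time. *)
Lemma ret_eq_inner m N : (2 * m + 2 < N)%nat ->
  ret_eq p (2 * m + 2) = inner (dens m) (dens m) (S N).
Proof.
  intros HN.
  assert (H : forall i j, (i + j <= 2 * m)%nat ->
     inner (dens i) (dens j) (S N) = inner (dens 0) (dens (i + j)) (S N)).
  { induction i as [|i IH]; intros j Hj; [reflexivity|].
    rewrite inner_dens_shift by lia. rewrite IH by lia. f_equal. f_equal. lia. }
  rewrite H by lia.
  (* [dens 0] is the unit mass at 1 divided by the reversible measure, so pairing with it evaluates
     at 1. *)
  assert (E : forall f K, inner (dens 0) f (S (S K)) = f 1%nat).
  { intros f K. unfold inner. induction K as [|K IH].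
    - cbn [psum]. unfold dens, rev_measure. rewrite !taboo_one.
      generalize (Hp 1%nat ltac:(lia)) (lambda_pos 1). intros H1 H2. field. lra.
    - change (psum (fun y => rev_measure y * dens 0 y * f y) (S (S (S K)))) with
        (psum (fun y => rev_measure y * dens 0 y * f y) (S (S K)) + rev_measure (S (S K)) * dens 0 (S (S K)) * f (S (S K))).
      rewrite IH, (dens_beyond 0) by lia. ring. }
  destruct N as [|N]; [lia|]. rewrite E.
  replace (2 * m + 2)%nat with (S (S (m + m))) by lia. unfold ret_eq. rewrite trans_down.
  unfold dens. replace (p 1%nat * lambda p 1) with (1 - p 1%nat) by (rewrite lambda_balance; simpl; ring).
  reflexivity.
Qed.

(** Both sides are squared norms, and passing to the next even time applies the contraction [step]
    once. *)
Lemma ret_eq_decr m : ret_eq p (2 * S (S m)) <= ret_eq p (2 * S m).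
Proof.
  replace (2 * S (S m))%nat with (2 * S m + 2)%nat by lia.
  replace (2 * S m)%nat with (2 * m + 2)%nat at 2 by lia.
  rewrite (ret_eq_inner (S m) (2 * m + 6)), (ret_eq_inner m (2 * m + 6)) by lia.
  unfold inner at 1.
  rewrite (psum_ext _ (fun y => rev_measure y * step (dens m) y * step (dens m) y))
    by (intros; now rewrite dens_S).
  apply inner_contract; [reflexivity|apply dens_beyond; lia].
Qed.

End Walk.

(** * Scale function and exit times *)

Lemma finite_bound (u : nat -> R) (N : nat) : exists B, 0 < B /\ forall n, (n < N)%nat -> u n <= B.
Proof.
  induction N as [|N (B & HB & H)].
  - exists 1. split; [lra|]. intros; lia.
  - exists (Rmax B (u N)). split; [generalize (Rmax_l B (u N)); lra|].
    intros n Hn. destruct (Nat.eq_dec n N) as [->|Hne]; [apply Rmax_r|].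
    eapply Rle_trans; [apply H; lia|apply Rmax_l].
Qed.

Lemma lim_bounded (u : nat -> R) (l : R) : is_lim_seq u l -> exists B, 0 < B /\ forall n, u n <= B.
Proof.
  intros H. destruct (ev_lt u l (l + 1) H ltac:(lra)) as [N HN].
  destruct (finite_bound u N) as (B & HB & HB').
  exists (Rmax B (l + 1)). split; [generalize (Rmax_l B (l + 1)); lra|].
  intros n. destruct (Nat.lt_ge_cases n N) as [Hn|Hn].
  - eapply Rle_trans; [apply HB', Hn|apply Rmax_l].
  - eapply Rle_trans; [apply Rlt_le, HN, Hn|apply Rmax_r].
Qed.

Lemma sqrt_infty (x : nat -> R) : is_lim_seq x p_infty -> is_lim_seq (fun n => sqrt (x n)) p_infty.
Proof.
  intros H. apply lim_infty. intros A. destruct (proj1 (lim_infty x) H (Rsqr (Rmax 0 A))) as [N HN].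
  exists N. intros n Hn. specialize (HN n Hn).
  apply Rle_lt_trans with (Rmax 0 A); [apply Rmax_r|].
  rewrite <- (sqrt_Rsqr (Rmax 0 A)) by apply Rmax_l.
  apply sqrt_lt_1_alt. split; [apply Rle_0_sqr|exact HN].
Qed.

Lemma Rpower_sqrt_base (c s : R) : 0 < c -> Rpower (sqrt c) s = Rpower c (s / 2).
Proof.
  intros Hc. rewrite <- (Rpower_sqrt c) by exact Hc. rewrite Rpower_mult. f_equal. field.
Qed.

Lemma sqrt_ratio (x y : nat -> R) (c : R) :
  0 < c -> is_lim_seq x p_infty -> is_lim_seq (fun n => y n / x n) c ->
  is_lim_seq (fun n => sqrt (y n) / sqrt (x n)) (sqrt c).
Proof.
  intros Hc Hx Hr. assert (Hy := infty_of_ratio y x c Hc Hx Hr).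
  destruct (proj1 (lim_infty _) Hx 0) as [N1 P1].
  apply (lim_ext_from N1 (fun n => sqrt (y n / x n))).
  - intros n Hn. apply sqrt_div_alt, P1, Hn.
  - apply (is_lim_seq_continuous sqrt); [|exact Hr]. apply continuity_pt_sqrt. lra.
Qed.

Lemma regvar_sqrt (psi : nat -> R) (rho : R) (x y : nat -> R) (c : R) :
  regvar psi rho -> 0 < c -> is_lim_seq x p_infty ->
  is_lim_seq (fun n => y n / x n) c ->
  is_lim_seq (fun n => psi (flr (sqrt (y n))) / psi (flr (sqrt (x n)))) (Rpower c (rho / 2)).
Proof.
  intros H Hc Hx Hr. rewrite <- Rpower_sqrt_base by exact Hc.
  apply (regvar_flr psi rho (fun n => sqrt (x n)) (fun n => sqrt (y n))); [exact H| | |].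
  - now apply sqrt_lt_R0.
  - now apply sqrt_infty.
  - now apply sqrt_ratio.
Qed.

Lemma lim_ratio_scal (c : R) : 0 < c -> is_lim_seq (fun n => c * INR n / INR n) c.
Proof.
  intros Hc. apply (lim_ext_from 1 (fun _ => c)); [|apply is_lim_seq_const].
  intros n Hn. generalize (INR_gt0 n Hn). intros. field. lra.
Qed.

Lemma lim_scal_INR (c : R) : 0 < c -> is_lim_seq (fun n => c * INR n) p_infty.
Proof.
  intros Hc. exact (infty_of_ratio _ INR c Hc is_lim_seq_INR (lim_ratio_scal c Hc)).
Qed.

Section Bessel.
Variables (p : nat -> R) (delta : R).
Hypothesis HR : is_lim_seq (fun x => INR x * Rerr p delta x) 0.
Variable eps0 : R.
Hypothesis Heps0 : 0 < eps0.
Hypothesis Hell : forall x, (1 <= x)%nat -> eps0 <= p x <= 1 - eps0.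

Lemma p_bounds x : (1 <= x)%nat -> 0 < p x < 1.
Proof. intros H. specialize (Hell x H). lra. Qed.

Lemma Rerr_lim : is_lim_seq (Rerr p delta) 0.
Proof.
  apply (lim_val _ (0 * 0)); [ring|].
  apply (lim_ext_from 1 (fun n => INR n * Rerr p delta n * / INR n)).
  - intros n Hn. generalize (INR_gt0 n Hn). intros. field. lra.
  - apply lim_mult_fin; [exact HR|]. apply lim_inv_infty, is_lim_seq_INR.
Qed.

Lemma drift_lim : is_lim_seq (fun x => INR x * (2 * p x - 1)) (- delta / 2).
Proof.
  apply (lim_val _ (/ 2 * 0 + - delta / 2)); [field|].
  apply (lim_ext_from 1 (fun x => / 2 * (INR x * Rerr p delta x) + - delta / 2)).
  - intros n Hn. generalize (INR_gt0 n Hn). intros. unfold Rerr. field. lra.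
  - apply lim_plus_fin; [|apply is_lim_seq_const]. apply lim_scal, HR.
Qed.

Lemma p_lim : is_lim_seq p (1 / 2).
Proof.
  apply (lim_val _ (/ 2 + / 2 * (- delta / 2 * 0))); [field|].
  apply (lim_ext_from 1 (fun x => / 2 + / 2 * (INR x * (2 * p x - 1) * / INR x))).
  - intros n Hn. generalize (INR_gt0 n Hn). intros. field. lra.
  - apply lim_plus_fin; [apply is_lim_seq_const|]. apply lim_scal, lim_mult_fin; [exact drift_lim|].
    apply lim_inv_infty, is_lim_seq_INR.
Qed.

Lemma drift_succ_lim : is_lim_seq (fun x => INR x * (2 * p (S x) - 1)) (- delta / 2).
Proof.
  apply (lim_val _ (- delta / 2 + -1 * (2 * (1 / 2) + - 1))); [field|].
  apply (is_lim_seq_ext (fun x => INR (S x) * (2 * p (S x) - 1) + -1 * (2 * p (S x) + -1))).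
  - intros n. rewrite S_INR. ring.
  - apply lim_plus_fin; [exact (proj1 (is_lim_seq_incr_1 _ _) drift_lim)|].
    apply lim_scal, lim_plus_fin; [|apply is_lim_seq_const].
    apply lim_scal. exact (proj1 (is_lim_seq_incr_1 _ _) p_lim).
Qed.

Lemma lambda_regvar : regvar (lambda p) delta.
Proof.
  split; [intros; apply lambda_pos, p_bounds|].
  apply (lim_val _ (-1 * (- delta / 2) / (1 / 2))); [field|].
  apply (is_lim_seq_ext (fun n => -1 * (INR n * (2 * p (S n) - 1)) / p (S n))).
  - intros n. simpl lambda. assert (H := p_bounds (S n) ltac:(lia)).
    assert (H1 := lambda_pos p p_bounds n). field. lra.
  - apply lim_div_fin; [|exact (proj1 (is_lim_seq_incr_1 _ _) p_lim)|lra].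
    apply lim_scal, drift_succ_lim.
Qed.

Lemma inv_lambda_regvar : regvar (fun n => / lambda p n) (- delta).
Proof.
  split; [intros; apply Rinv_0_lt_compat, lambda_pos, p_bounds|].
  apply (lim_val _ (- delta / 2 / (1 - 1 / 2))); [field|].
  apply (is_lim_seq_ext (fun n => INR n * (2 * p (S n) - 1) / (1 - p (S n)))).
  - intros n. simpl lambda. assert (H := p_bounds (S n) ltac:(lia)).
    assert (H1 := lambda_pos p p_bounds n). field. lra.
  - apply lim_div_fin; [exact drift_succ_lim| |lra].
    apply (is_lim_seq_minus _ _ 1 (1 / 2)); [apply is_lim_seq_const| |reflexivity].
    exact (proj1 (is_lim_seq_incr_1 _ _) p_lim).
Qed.

Lemma Lnat_pos n : 0 < Lnat p delta n.
Proof. apply exp_pos. Qed.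

Lemma Lnat_regvar : regvar (Lnat p delta) 0.
Proof.
  split; [intros; apply Lnat_pos|].
  assert (Hs : is_lim_seq (fun n => INR n * Rerr p delta (S n)) 0).
  { apply (lim_val _ (0 + -1 * 0)); [ring|].
    apply (is_lim_seq_ext (fun n => INR (S n) * Rerr p delta (S n) + -1 * Rerr p delta (S n))).
    - intros n. rewrite S_INR. ring.
    - apply lim_plus_fin; [exact (proj1 (is_lim_seq_incr_1 _ _) HR)|].
      apply lim_scal. exact (proj1 (is_lim_seq_incr_1 _ _) Rerr_lim). }
  apply (is_lim_seq_le_le (fun n => INR n * Rerr p delta (S n)) _
    (fun n => INR n * Rerr p delta (S n) * exp (Rerr p delta (S n)))).
  - intros n. unfold Lnat. simpl sumR. rewrite exp_plus. set (a := Rerr p delta (S n)).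
    replace (exp (sumR p delta n) * exp a / exp (sumR p delta n)) with (exp a)
      by (field; generalize (exp_pos (sumR p delta n)); lra).
    assert (H1 := exp_ineq1_le a). assert (H2 := exp_ineq1_le (- a)). rewrite exp_Ropp in H2.
    assert (H3 := exp_pos a). assert (H4 := pos_INR n). split.
    + apply Rmult_le_compat_l; lra.
    + rewrite Rmult_assoc. apply Rmult_le_compat_l; [exact H4|].
      apply Rmult_le_compat_r with (r := exp a) in H2; [|lra]. rewrite Rinv_l in H2; lra.
  - exact Hs.
  - apply (lim_val _ (0 * exp 0)); [ring|]. apply lim_mult_fin; [exact Hs|].
    apply (is_lim_seq_continuous exp).
    + apply derivable_continuous_pt, derivable_pt_exp.
    + exact (proj1 (is_lim_seq_incr_1 _ _) Rerr_lim).
Qed.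

Hypothesis HM : is_lim_seq (scaleM p) p_infty.

Lemma psum_lambda_infty : is_lim_seq (psum (lambda p)) p_infty.
Proof. apply (is_lim_seq_ext (scaleM p)); [apply scaleM_psum|exact HM]. Qed.

Lemma scaleM_regvar : regvar (scaleM p) (1 + delta).
Proof.
  destruct (regvar_psum (lambda p) delta (lambda_pos p p_bounds) lambda_regvar psum_lambda_infty) as [H1 H2].
  split.
  - intros n Hn. apply scaleM_pos; [exact p_bounds|exact Hn].
  - apply (is_lim_seq_ext (fun n => INR n * (psum (lambda p) (S n) / psum (lambda p) n - 1))); [|exact H2].
    intros n. now rewrite !scaleM_psum.
Qed.

Lemma scaleM_lambda : is_lim_seq (fun n => INR n * lambda p n / scaleM p n) (1 + delta).
Proof.
  apply (is_lim_seq_ext (fun n => INR n * lambda p n / psum (lambda p) n)).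
  - intros n. now rewrite scaleM_psum.
  - apply karamata; [apply lambda_pos, p_bounds|exact lambda_regvar|exact psum_lambda_infty].
Qed.

Definition speed (z : nat) : R := psum (fun y => / (p (S y) * lambda p (S y))) z.
(* The general solution of [step W x = W x - 1] for x >= 1. *)
Definition exit_fun (A B : R) (x : nat) : R := A + psum (fun z => lambda p z * (B - speed z)) x.

Lemma speed_mono a b : (a <= b)%nat -> speed a <= speed b.
Proof.
  intros H. apply psum_mono; [|exact H]. intros n.
  apply Rlt_le, Rinv_0_lt_compat, p_lambda_pos, p_bounds.
Qed.

Lemma speed_nonneg a : 0 <= speed a.
Proof. apply (speed_mono 0 a). lia. Qed.

Lemma exit_fun_step A B x : 1 + step p (exit_fun A B) (S x) = exit_fun A B (S x).
Proof.
  rewrite step_S. unfold exit_fun. cbn [psum].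
  assert (H := lambda_balance p p_bounds x). assert (H1 := p_lambda_pos p p_bounds x).
  change (speed (S x)) with (speed x + / (p (S x) * lambda p (S x))).
  set (S0 := psum _ x). set (g := speed x) in *.
  assert (E : p (S x) * lambda p (S x) * / (p (S x) * lambda p (S x)) = 1) by (apply Rinv_r; lra).
  set (i := / (p (S x) * lambda p (S x))) in *.
  set (a := p (S x)) in *. set (l1 := lambda p (S x)) in *. set (l0 := lambda p x) in *.
  replace (l1 * (B - (g + i))) with (l1 * (B - g) - l1 * i) by ring.
  replace (1 + (a * (A + (S0 + l0 * (B - g) + (l1 * (B - g) - l1 * i))) + (1 - a) * (A + S0)))
    with (1 - a * l1 * i + A + S0 + a * l0 * (B - g) + a * l1 * (B - g)) by ring.
  rewrite E, H. ring.
Qed.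

(** It suffices to give [confined_time] a solution [exit_fun A B] that is nonnegative and O(m^2) on
    [0,m]. The solution that is flat at 0 requires index [- delta > -1] for [/ lambda], the one that
    is flat at [m] requires index [1 + delta > 0] for [M]. Neither covers the whole range of
    [delta]; they overlap, and separating them at 0 is one convenient choice. *)
Lemma exit_time_bound : exists C, 0 < C /\ forall m n x, (x <= m)%nat ->
  INR n * confined p m n x <= C * (INR m * INR m).
Proof.
  assert (Hlp := lambda_pos p p_bounds).
  destruct (Rle_lt_dec delta 0) as [Hneg|Hpos].
  - (* even reflected at 0 the walk exits in time O(m^2): its stationary measure 1/lambda has index > -1 *)
    assert (Hi : forall n, 0 < / lambda p n) by (intros; apply Rinv_0_lt_compat, Hlp).
    assert (Hdiv := regvar_diverges _ _ Hi inv_lambda_regvar ltac:(lra)).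
    assert (HK := karamata _ _ Hi inv_lambda_regvar Hdiv).
    assert (HK' : is_lim_seq (fun n => psum (fun k => / lambda p k) n / (INR n * / lambda p n)) (/ (1 + - delta))).
    { apply (is_lim_seq_ext (fun n => / (INR n * / lambda p n / psum (fun k => / lambda p k) n))).
      - intros n. rewrite Rinv_div. reflexivity.
      - apply (is_lim_seq_inv _ (1 + - delta)); [exact HK|]. intros E. inversion E. lra. }
    destruct (lim_bounded _ _ HK') as (D & HD & HD').
    assert (Hsp : forall z, lambda p z * speed z <= / eps0 * (D + 1) * INR z).
    { intros [|z]; [unfold speed; simpl; lra|].
      assert (H1 : speed (S z) <= / eps0 * psum (fun y => / lambda p y) (S (S z))).
      { apply Rle_trans with (/ eps0 * psum (fun y => / lambda p (S y)) (S z)).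
        - rewrite <- psum_scal. apply psum_le. intros k _. rewrite Rinv_mult.
          apply Rmult_le_compat_r; [apply Rlt_le, Hi|]. apply Rinv_le_contravar; [lra|]. apply Hell. lia.
        - apply Rmult_le_compat_l; [apply Rlt_le, Rinv_0_lt_compat; lra|].
          assert (E : forall f n, psum f (S n) = f 0%nat + psum (fun k => f (S k)) n).
          { intros f. induction n as [|n IH]; [simpl; ring|].
            change (psum f (S (S n))) with (psum f (S n) + f (S n)). rewrite IH. simpl. ring. }
          rewrite (E _ (S z)). specialize (Hi 0%nat). lra. }
      assert (H2 : psum (fun y => / lambda p y) (S z) <= D * (INR (S z) * / lambda p (S z))).
      { specialize (HD' (S z)). cbv beta in HD'.
        assert (H3 : 0 < INR (S z) * / lambda p (S z)) by (apply Rmult_lt_0_compat; [apply INR_gt0; lia|apply Hi]).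
        apply Rmult_le_compat_r with (r := INR (S z) * / lambda p (S z)) in HD'; [|lra].
        unfold Rdiv in HD'. rewrite Rmult_assoc, Rinv_l in HD'; lra. }
      change (psum (fun y => / lambda p y) (S (S z))) with
        (psum (fun y => / lambda p y) (S z) + / lambda p (S z)) in H1.
      assert (H5 : 1 <= INR (S z)) by (apply (le_INR 1); lia).
      assert (H6 : speed (S z) <= / eps0 * (D + 1) * INR (S z) * / lambda p (S z)).
      { eapply Rle_trans; [exact H1|]. rewrite !Rmult_assoc.
        apply Rmult_le_compat_l; [apply Rlt_le, Rinv_0_lt_compat; lra|].
        specialize (Hi (S z)). nra. }
      apply Rmult_le_compat_l with (r := lambda p (S z)) in H6; [|apply Rlt_le, Hlp].
      eapply Rle_trans; [exact H6|]. specialize (Hlp (S z)). clear - Hlp Heps0.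
      generalize dependent (lambda p (S z)). intros l Hl. apply Req_le. field. lra. }
    set (C := / eps0 * (D + 1)) in *.
    assert (HC : 0 < C) by (apply Rmult_lt_0_compat; [apply Rinv_0_lt_compat|]; lra).
    exists C. split; [exact HC|]. intros m n x Hx.
    (* [B = 0] makes [W] flat at 0, as for reflection, and this [A] makes it vanish at [m]. *)
    set (W := exit_fun (psum (fun z => lambda p z * speed z) m) 0).
    assert (Hneg' : forall k, psum (fun z => lambda p z * (0 - speed z)) k = - psum (fun z => lambda p z * speed z) k).
    { intros k. replace (- psum (fun z => lambda p z * speed z) k) with (-1 * psum (fun z => lambda p z * speed z) k) by ring.
      rewrite <- psum_scal. apply psum_ext. intros; ring. }
    assert (Hnn : forall z, 0 <= lambda p z * speed z).
    { intros z. apply Rmult_le_pos; [apply Rlt_le, Hlp|apply speed_nonneg]. }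
    eapply Rle_trans; [apply (confined_time p p_bounds m W)|].
    + intros y Hy. unfold W, exit_fun. rewrite Hneg'.
      generalize (psum_mono _ y m Hnn Hy). lra.
    + intros [|y] Hy; [lia|]. apply Req_le, exit_fun_step.
    + exact Hx.
    + unfold W, exit_fun. rewrite Hneg'.
      apply Rle_trans with (psum (fun z => lambda p z * speed z) m).
      * generalize (psum_mono _ 0 x Hnn ltac:(lia)). simpl. lra.
      * apply Rle_trans with (psum (fun _ => C * INR m) m).
        -- apply psum_le. intros k Hk. eapply Rle_trans; [apply Hsp|].
           apply Rmult_le_compat_l; [lra|]. apply le_INR. lia.
        -- rewrite psum_const. lra.
  - (* summation by parts reduces the exit time to M_y / lambda_y = O(y) *)
    assert (HK' : is_lim_seq (fun n => scaleM p n / (INR n * lambda p n)) (/ (1 + delta))).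
    { apply (is_lim_seq_ext (fun n => / (INR n * lambda p n / scaleM p n))).
      - intros n. apply Rinv_div.
      - apply (is_lim_seq_inv _ (1 + delta)); [exact scaleM_lambda|]. intros E. inversion E. lra. }
    destruct (lim_bounded _ _ HK') as (D & HD & HD').
    set (C := / eps0 * D).
    assert (Hi0 : 0 < / eps0) by (apply Rinv_0_lt_compat; lra).
    assert (HC : 0 < C) by (apply Rmult_lt_0_compat; lra).
    assert (Hsp : forall y, scaleM p (S y) * / (p (S y) * lambda p (S y)) <= C * INR (S y)).
    { intros y. specialize (HD' (S y)). cbv beta in HD'. assert (He1 := Hell (S y) ltac:(lia)).
      assert (H1 := INR_gt0 (S y) ltac:(lia)). specialize (Hlp (S y)).
      assert (H3 : 0 < INR (S y) * lambda p (S y)) by (apply Rmult_lt_0_compat; lra).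
      apply Rmult_le_compat_r with (r := INR (S y)) in HD'; [|lra].
      replace (scaleM p (S y) / (INR (S y) * lambda p (S y)) * INR (S y)) with (scaleM p (S y) * / lambda p (S y))
        in HD' by (field; lra).
      rewrite Rinv_mult. unfold C.
      assert (/ p (S y) <= / eps0) by (apply Rinv_le_contravar; lra).
      assert (0 <= scaleM p (S y) * / lambda p (S y)).
      { apply Rmult_le_pos; [apply scaleM_nonneg, p_bounds|apply Rlt_le, Rinv_0_lt_compat; lra]. }
      assert (0 < / p (S y)) by (apply Rinv_0_lt_compat; lra).
      replace (scaleM p (S y) * (/ p (S y) * / lambda p (S y))) with
        (/ p (S y) * (scaleM p (S y) * / lambda p (S y))) by ring.
      rewrite Rmult_assoc. apply Rmult_le_compat; lra. }
    exists C. split; [exact HC|]. intros m n x Hx.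
    (* Here [W] vanishes at 0 and is flat at [m]. *)
    set (W := exit_fun 0 (speed m)).
    assert (Hnn : forall a b, (a <= b)%nat -> (b <= m)%nat ->
      psum (fun z => lambda p z * (speed m - speed z)) a <= psum (fun z => lambda p z * (speed m - speed z)) b).
    { intros a b Hab. induction Hab as [|b Hab IH]; intros Hb; [lra|]. cbn [psum].
      assert (0 <= lambda p b * (speed m - speed b)).
      { apply Rmult_le_pos; [apply Rlt_le, Hlp|]. generalize (speed_mono b m ltac:(lia)). lra. }
      specialize (IH ltac:(lia)). lra. }
    eapply Rle_trans; [apply (confined_time p p_bounds m W)|].
    + intros y Hy. unfold W, exit_fun. generalize (Hnn 0%nat y ltac:(lia) Hy). simpl. lra.
    + intros [|y] Hy; [lia|]. apply Req_le, exit_fun_step.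
    + exact Hx.
    + unfold W, exit_fun. rewrite Rplus_0_l. eapply Rle_trans; [apply (Hnn x m Hx); lia|].
      assert (Hparts : forall k, psum (fun z => lambda p z * (speed m - speed z)) k =
        scaleM p k * (speed m - speed k) + psum (fun y => scaleM p (S y) * / (p (S y) * lambda p (S y))) k).
      { induction k as [|k IH]; [simpl; ring|]. cbn [psum]. rewrite IH.
        change (speed (S k)) with (speed k + / (p (S k) * lambda p (S k))).
        change (scaleM p (S k)) with (scaleM p k + lambda p k). ring. }
      rewrite Hparts, Rminus_diag, Rmult_0_r, Rplus_0_l.
      apply Rle_trans with (psum (fun _ => C * INR m) m).
      * apply psum_le. intros k Hk. eapply Rle_trans; [apply Hsp|].
        apply Rmult_le_compat_l; [lra|]. apply le_INR. lia.
      * rewrite psum_const. lra.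
Qed.

(** * A priori bound on the diffusive scale *)

Definition Mq (y : R) : R := scaleM p (flr (sqrt y)).

Lemma Mq_ratio (x y : nat -> R) c : 0 < c -> is_lim_seq x p_infty ->
  is_lim_seq (fun n => y n / x n) c ->
  is_lim_seq (fun n => Mq (y n) / Mq (x n)) (Rpower c ((1 + delta) / 2)).
Proof. intros. apply (regvar_sqrt (scaleM p)); [exact scaleM_regvar|assumption..]. Qed.

Lemma flr_sqrt_sq y : 0 <= y -> INR (flr (sqrt y)) * INR (flr (sqrt y)) <= y.
Proof.
  intros Hy. destruct (flr_bounds (sqrt y) (sqrt_pos y)) as [H _].
  rewrite <- (sqrt_sqrt y Hy) at 3. apply Rmult_le_compat; try apply pos_INR; exact H.
Qed.

Lemma flr_sqrt_pos y : 1 <= y -> (1 <= flr (sqrt y))%nat.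
Proof. intros Hy. apply flr_ge. simpl. rewrite <- sqrt_1. apply sqrt_le_1_alt, Hy. Qed.

Lemma Mq_pos y : 1 <= y -> 0 < Mq y.
Proof. intros Hy. apply scaleM_pos; [exact p_bounds|apply flr_sqrt_pos, Hy]. Qed.

Lemma flr_scal_ratio c : 0 < c -> is_lim_seq (fun n => INR (flr (c * INR n)) / INR n) c.
Proof.
  intros Hc. assert (Hinf := lim_scal_INR c Hc). assert (H := flr_equiv _ Hinf).
  apply (lim_val _ (1 * c)); [ring|].
  apply (lim_ext_from 1 (fun n => INR (flr (c * INR n)) / (c * INR n) * (c * INR n / INR n))).
  - intros n Hn. generalize (INR_gt0 n Hn). intros. field. lra.
  - apply lim_mult_fin; [exact H|now apply lim_ratio_scal].
Qed.

(** Strong induction, halving the time. With [m] of order [sqrt (e n)], a surviving walk either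
    reaches [m], which contributes [1 / M m], or survives the first half and stays below [m] during
    the second, which contributes [2 C e] times the survival probability at time [n / 2]. *)
Lemma alive_crude : exists C, 0 < C /\ forall n, Mq (INR n) * alive p n 1 <= C.
Proof.
  destruct exit_time_bound as (C & HC & Hexit).
  set (kap := (1 + delta) / 2).
  set (Lam := Rpower 2 kap).
  (* [Lam] is the limit of [Mq n / Mq (n / 2)]. This choice turns the recursive factor
     [2 C e (Lam + 1)] into 1/2, so that a bound [B2 >= 2 D] reproduces itself:
     [D + B2 / 2 <= B2]. *)
  set (e := / (4 * C * (Lam + 1))).
  assert (HLam : 0 < Lam) by apply exp_pos.
  assert (He : 0 < e) by (apply Rinv_0_lt_compat; repeat apply Rmult_lt_0_compat; lra).
  set (h := fun n => flr (/ 2 * INR n)).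
  assert (Hh := flr_scal_ratio (/ 2) ltac:(lra)). fold h in Hh.
  assert (Hhinf : is_lim_seq (fun n => INR (h n)) p_infty) by (apply flr_infty, lim_scal_INR; lra).
  assert (H1 : is_lim_seq (fun n => Mq (INR n) / Mq (INR (h n))) Lam).
  { apply Mq_ratio; [lra|exact Hhinf|].
    apply (is_lim_seq_ext (fun n => / (INR (h n) / INR n))); [intros; apply Rinv_div|].
    replace (Finite 2) with (Rbar_inv (/ 2)) by (simpl; f_equal; field).
    apply is_lim_seq_inv; [exact Hh|]. intros E. inversion E. lra. }
  assert (H2 : is_lim_seq (fun n => Mq (INR n) / Mq (e * INR n)) (Rpower (/ e) kap)).
  { apply Mq_ratio; [now apply Rinv_0_lt_compat|now apply lim_scal_INR|].
    apply (lim_ext_from 1 (fun _ => / e)); [|apply is_lim_seq_const].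
    intros n Hn. generalize (INR_gt0 n Hn). intros. field. lra. }
  destruct (ev_lt _ _ (Lam + 1) H1) as [N1 P1]; [lra|].
  destruct (ev_lt _ _ (Rpower (/ e) kap + 1) H2) as [N2 P2]; [lra|].
  set (D := Rpower (/ e) kap + 1) in *.
  assert (HD : 0 < D) by (unfold D, Rpower; generalize (exp_pos (kap * ln (/ e))); lra).
  destruct (proj1 (lim_infty _) (lim_scal_INR e He) 1) as [N3 P3].
  destruct (proj1 (lim_infty _) Hhinf 1) as [N4 P4].
  set (N := (N1 + N2 + N3 + N4 + 1)%nat).
  destruct (finite_bound (fun n => Mq (INR n) * alive p n 1) N) as (B & HB & HB').
  exists (Rmax B (2 * D)). split; [generalize (Rmax_l B (2 * D)); lra|].
  assert (HBm := Rmax_l B (2 * D)). assert (HBm2 := Rmax_r B (2 * D)).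
  set (B2 := Rmax B (2 * D)) in *.
  induction n as [n IH] using (well_founded_induction Wf_nat.lt_wf).
  destruct (Nat.lt_ge_cases n N) as [Hn|Hn].
  { eapply Rle_trans; [apply HB', Hn|lra]. }
  unfold N in Hn.
  specialize (P1 n ltac:(lia)). specialize (P2 n ltac:(lia)).
  specialize (P3 n ltac:(lia)). specialize (P4 n ltac:(lia)). cbv beta in P1, P2, P3, P4.
  assert (Hn0 := INR_gt0 n ltac:(lia)).
  destruct (flr_bounds (/ 2 * INR n)) as [Hh1 Hh2]; [lra|]. fold (h n) in Hh1, Hh2.
  assert (Hhn : (h n < n)%nat) by (apply INR_lt; lra).
  specialize (IH (h n) Hhn).
  set (m := flr (sqrt (e * INR n))).
  assert (Hm : (1 <= m)%nat) by (apply flr_sqrt_pos; lra).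
  assert (Hm2 : INR m * INR m <= e * INR n) by (apply flr_sqrt_sq; lra).
  assert (Hk : 0 < INR (n - h n)) by (apply INR_gt0; lia).
  assert (Hk2 : INR n / 2 <= INR (n - h n)) by (rewrite minus_INR by lia; lra).
  assert (Hs : forall y, confined p m (n - h n) y <= 2 * C * e).
  { intros y. destruct (Nat.le_gt_cases y m) as [Hy|Hy].
    - specialize (Hexit m (n - h n)%nat y Hy).
      apply Rmult_le_reg_l with (INR (n - h n)); [exact Hk|].
      assert (0 <= C * e) by (apply Rlt_le, Rmult_lt_0_compat; lra). nra.
    - rewrite confined_out by lia. apply Rlt_le. repeat apply Rmult_lt_0_compat; lra. }
  assert (Hc := confined_split p p_bounds m (h n) (n - h n) _ 1 Hs).
  replace (h n + (n - h n))%nat with n in Hc by lia.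
  assert (Hu := alive_upper p p_bounds m 0 n 1 Hm Hm).
  rewrite Nat.add_0_r in Hu.
  replace (scaleM p 1) with 1 in Hu by (simpl; ring).
  assert (HMm : 0 < scaleM p m) by (apply scaleM_pos; [exact p_bounds|exact Hm]).
  assert (HMh := Mq_pos (INR (h n)) ltac:(lra)).
  assert (HMn : 0 < Mq (INR n)) by (apply Mq_pos; lra).
  change (Mq (e * INR n)) with (scaleM p m) in P2.
  destruct (confined_le_alive p p_bounds m (h n) 1) as [_ Hca].
  destruct (alive_bounds p p_bounds 0 m) as [_ Ha0].
  destruct (alive_bounds p p_bounds (h n) 1) as [Hah _].
  assert (Hce : 0 < 2 * C * e) by (repeat apply Rmult_lt_0_compat; lra).
  assert (Hu2 : alive p n 1 <= / scaleM p m + 2 * C * e * alive p (h n) 1).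
  { assert (1 / scaleM p m * alive p 0 m <= / scaleM p m).
    { unfold Rdiv. rewrite Rmult_1_l. rewrite <- (Rmult_1_r (/ scaleM p m)) at 2.
      apply Rmult_le_compat_l; [apply Rlt_le, Rinv_0_lt_compat, HMm|exact Ha0]. }
    assert (2 * C * e * confined p m (h n) 1 <= 2 * C * e * alive p (h n) 1) by (apply Rmult_le_compat_l; lra).
    lra. }
  apply Rmult_le_compat_l with (r := Mq (INR n)) in Hu2; [|lra].
  eapply Rle_trans; [exact Hu2|].
  replace (Mq (INR n) * (/ scaleM p m + 2 * C * e * alive p (h n) 1)) with
    (Mq (INR n) / scaleM p m + 2 * C * e * (Mq (INR n) / Mq (INR (h n))) * (Mq (INR (h n)) * alive p (h n) 1))
    by (field; lra).
  assert (Hq : 2 * C * e * (Mq (INR n) / Mq (INR (h n))) <= / 2).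
  { apply Rle_trans with (2 * C * e * (Lam + 1)); [apply Rmult_le_compat_l; lra|].
    apply Req_le. unfold e. field. lra. }
  assert (Hb : 0 <= Mq (INR (h n)) * alive p (h n) 1) by (apply Rmult_le_pos; lra).
  apply Rle_trans with (D + / 2 * B2); [|lra].
  apply Rplus_le_compat; [lra|].
  apply Rle_trans with (/ 2 * (Mq (INR (h n)) * alive p (h n) 1)); [|lra].
  apply Rmult_le_compat_r; assumption.
Qed.

End Bessel.

(** * The incomplete Gamma function *)

Lemma nondecr_of_deriv (f df : R -> R) (a b : R) :
  a <= b -> (forall x, a <= x <= b -> is_derive f x (df x)) ->
  (forall x, a <= x <= b -> 0 <= df x) -> f a <= f b.
Proof.
  intros Hab Hd Hp.
  destruct (MVT_gen f a b df) as (c & Hc & E).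
  - rewrite Rmin_left, Rmax_right by lra. intros x Hx. apply Hd. lra.
  - rewrite Rmin_left, Rmax_right by lra. intros x Hx.
    apply derivable_continuous_pt. exists (df x). apply is_derive_Reals, Hd. lra.
  - rewrite Rmin_left, Rmax_right in Hc by lra. specialize (Hp c Hc). nra.
Qed.

Lemma exp_le (x y : R) : x <= y -> exp x <= exp y.
Proof. intros [H| ->]; [now apply Rlt_le, exp_increasing|apply Rle_refl]. Qed.

Lemma exp_neg_le1 (x : R) : 0 <= x -> exp (- x) <= 1.
Proof. intros H. rewrite <- exp_0. apply exp_le. lra. Qed.

Lemma is_derive_Rpower (s w : R) : 0 < w -> is_derive (fun x => Rpower x s) w (s * Rpower w (s - 1)).
Proof. intros H. apply is_derive_Reals. now apply derivable_pt_lim_power. Qed.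

Lemma Rpower_pos (x s : R) : 0 < Rpower x s.
Proof. apply exp_pos. Qed.

Lemma Rpower_pred (w s : R) : 0 < w -> Rpower w (s - 1) = Rpower w s / w.
Proof.
  intros H. unfold Rminus. rewrite Rpower_plus, Rpower_Ropp, Rpower_1 by exact H. reflexivity.
Qed.

Lemma is_derive_value (f : R -> R) (x l l' : R) : l = l' -> is_derive f x l -> is_derive f x l'.
Proof. now intros ->. Qed.

Section IncompleteGamma.
Variable kap : R.
Hypothesis Hkap : 0 < kap.

Definition gker (t : R) : R := Rpower t (kap - 1) * exp (- t).

Lemma gker_pos t : 0 < gker t.
Proof. apply Rmult_lt_0_compat; apply exp_pos. Qed.

(** Logarithmic derivative of [gker]; in the Taylor expansion it is [F'' / F']. *)
Definition gker_ratio (w : R) : R := (kap - 1) / w - 1.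

Lemma gker_derive w : 0 < w -> is_derive gker w (gker w * gker_ratio w).
Proof.
  intros Hw. unfold gker.
  assert (H1 := is_derive_Rpower (kap - 1) w Hw).
  assert (H2 : is_derive (fun t => exp (- t)) w (- exp (- w))) by (auto_derive; [trivial|ring]).
  assert (H := is_derive_mult _ _ w _ _ H1 H2 Rmult_comm).
  eapply is_derive_value; [|exact H]. unfold plus, mult; simpl. unfold gker_ratio.
  rewrite (Rpower_pred w (kap - 1)) by exact Hw. field. lra.
Qed.

Lemma gker_continuous w : 0 < w -> continuous gker w.
Proof. intros H. apply (ex_derive_continuous gker). eexists. now apply gker_derive. Qed.

(** Based at 1 because the integrand is unbounded at 0 when [kap < 1]; the limits at the two ends
    are taken separately. *)
Definition gprim (w : R) : R := RInt gker 1 w.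

Lemma gker_ex_RInt a b : 0 < a -> 0 < b -> ex_RInt gker a b.
Proof.
  intros Ha Hb. apply (@ex_RInt_continuous R_CompleteNormedModule). intros z Hz. apply gker_continuous.
  apply Rlt_le_trans with (Rmin a b); [now apply Rmin_glb_lt|apply Hz].
Qed.

Lemma gprim_derive w : 0 < w -> is_derive gprim w (gker w).
Proof.
  intros Hw. apply (is_derive_RInt gker gprim 1); [|now apply gker_continuous].
  exists (mkposreal w Hw). intros y Hy. apply (@RInt_correct R_CompleteNormedModule), gker_ex_RInt; [lra|].
  assert (H := proj1 (Rabs_def2 _ _ Hy)). assert (H' := proj2 (Rabs_def2 _ _ Hy)).
  unfold minus, plus, opp in H'; simpl in H'. lra.
Qed.

Lemma gprim_RInt a b : 0 < a -> 0 < b -> is_RInt gker a b (gprim b - gprim a).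
Proof.
  intros Ha Hb.
  assert (H := is_RInt_derive gprim gker a b). apply H.
  - intros x Hx. apply gprim_derive. apply Rlt_le_trans with (Rmin a b); [now apply Rmin_glb_lt|apply Hx].
  - intros x Hx. apply gker_continuous. apply Rlt_le_trans with (Rmin a b); [now apply Rmin_glb_lt|apply Hx].
Qed.

Lemma gprim_mono v w : 0 < v -> v <= w -> gprim v <= gprim w.
Proof.
  intros Hv Hw. apply (nondecr_of_deriv gprim gker); [exact Hw| |].
  - intros x Hx. apply gprim_derive. lra.
  - intros x _. apply Rlt_le, gker_pos.
Qed.

(** On [[v, w]] the factor [exp (- t)] lies between [exp (- w)] and 1; the upper bound is used here,
    the lower one in [gprim_lower]. Neither degenerates as [v] tends to 0. *)
Lemma gprim_upper v w : 0 < v -> v <= w -> gprim w - gprim v <= (Rpower w kap - Rpower v kap) / kap.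
Proof.
  intros Hv Hw.
  assert (H : Rpower v kap / kap - gprim v <= Rpower w kap / kap - gprim w).
  { apply (nondecr_of_deriv (fun x => Rpower x kap / kap - gprim x)
      (fun x => Rpower x (kap - 1) - gker x)); [exact Hw| |].
    - intros x Hx. apply (is_derive_minus (fun x => Rpower x kap / kap) gprim).
      + replace (Rpower x (kap - 1)) with (/ kap * (kap * Rpower x (kap - 1))) by (field; lra).
        apply (is_derive_ext (fun x => / kap * Rpower x kap)); [intros; unfold Rdiv; apply Rmult_comm|].
        apply is_derive_scal, is_derive_Rpower. lra.
      + apply gprim_derive. lra.
    - intros x Hx. unfold gker. generalize (Rpower_pos x (kap - 1)). intros H1.
      assert (exp (- x) <= 1) by (apply exp_neg_le1; lra). nra. }
  lra.
Qed.

Lemma gprim_lower v w : 0 < v -> v <= w ->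
  exp (- w) * ((Rpower w kap - Rpower v kap) / kap) <= gprim w - gprim v.
Proof.
  intros Hv Hw.
  assert (H : gprim v - exp (- w) * (Rpower v kap / kap) <= gprim w - exp (- w) * (Rpower w kap / kap)).
  { apply (nondecr_of_deriv (fun x => gprim x - exp (- w) * (Rpower x kap / kap))
      (fun x => gker x - exp (- w) * Rpower x (kap - 1))); [exact Hw| |].
    - intros x Hx. apply (is_derive_minus gprim (fun x => exp (- w) * (Rpower x kap / kap))).
      + apply gprim_derive. lra.
      + replace (exp (- w) * Rpower x (kap - 1)) with
          (exp (- w) / kap * (kap * Rpower x (kap - 1))) by (field; lra).
        apply (is_derive_ext (fun x => exp (- w) / kap * Rpower x kap)); [intros; apply Rminus_diag_uniq; field; lra|].
        apply is_derive_scal, is_derive_Rpower. lra.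
    - intros x Hx. unfold gker. generalize (Rpower_pos x (kap - 1)). intros H1.
      assert (exp (- w) <= exp (- x)) by (apply exp_le; lra). nra. }
  lra.
Qed.

Lemma gprim_bounded : exists B, forall w, 1 <= w -> gprim w <= B.
Proof.
  set (k := Rabs (kap - 1)). assert (Hk : 0 <= k) by apply Rabs_pos.
  (* In [ln (a x) <= a x - 1] the slope [a] is so small that [k a <= 1/2]: the power is absorbed by
     half of the exponential, and [gker x <= C exp (- x / 2)]. *)
  set (a := / (2 * (k + 1))). assert (Ha : 0 < a) by (apply Rinv_0_lt_compat; lra).
  set (C := exp (k * (-1 - ln a))).
  exists (2 * C). intros w Hw.
  assert (Hker : forall x, 1 <= x -> gker x <= C * exp (- (x / 2))).
  { intros x Hx. unfold gker, C, Rpower. rewrite <- !exp_plus. apply exp_le.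
    assert (Hln : 0 <= ln x) by (rewrite <- ln_1; apply Rcomplements.ln_le; lra).
    assert (H1 : (kap - 1) * ln x <= k * ln x) by (apply Rmult_le_compat_r; [exact Hln|apply Rle_abs]).
    assert (H2 := ln_le_sub1 (a * x) ltac:(nra)). rewrite ln_mult in H2 by lra.
    assert (H3 : k * ln x <= k * (a * x - 1 - ln a)) by (apply Rmult_le_compat_l; lra).
    assert (H4 : k * a <= / 2).
    { unfold a. apply Rmult_le_reg_r with (2 * (k + 1)); [lra|].
      replace (k * / (2 * (k + 1)) * (2 * (k + 1))) with k by (field; lra). lra. }
    nra. }
  assert (H1 : - 2 * C * exp (- (1 / 2)) - gprim 1 <= - 2 * C * exp (- (w / 2)) - gprim w).
  { apply (nondecr_of_deriv (fun x => - 2 * C * exp (- (x / 2)) - gprim x)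
      (fun x => C * exp (- (x / 2)) - gker x)); [exact Hw| |].
    - intros x Hx. apply (is_derive_minus (fun x => - 2 * C * exp (- (x / 2))) gprim).
      + auto_derive; [trivial|]. unfold Rdiv. field.
      + apply gprim_derive. lra.
    - intros x Hx. generalize (Hker x ltac:(lra)). lra. }
  assert (E : gprim 1 = 0) by (unfold gprim; rewrite RInt_point; reflexivity).
  assert (HC : 0 < C) by apply exp_pos.
  assert (0 < exp (- (w / 2))) by apply exp_pos.
  assert (exp (- (1 / 2)) <= 1) by (apply exp_neg_le1; lra). nra.
Qed.

Lemma gprim_sup : exists l, (forall w, 0 < w -> gprim w <= l) /\
  forall e, 0 < e -> exists W, 1 <= W /\ forall w, W <= w -> l - e < gprim w.
Proof.
  destruct gprim_bounded as (B & HB).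
  destruct (completeness (fun y => exists w, 1 <= w /\ y = gprim w)) as (l & Hub & Hlub).
  - exists B. intros y (w & Hw & ->). now apply HB.
  - exists (gprim 1), 1. split; [lra|reflexivity].
  - exists l. split.
    + intros w Hw. apply Rle_trans with (gprim (Rmax w 1)).
      * apply gprim_mono; [exact Hw|apply Rmax_l].
      * apply Hub. exists (Rmax w 1). split; [apply Rmax_r|reflexivity].
    + intros e He. apply NNPP. intros Hn.
      assert (l <= l - e); [|lra]. apply Hlub. intros y (w & Hw & ->).
      apply Rnot_lt_le. intros Hlt. apply Hn. exists w. split; [exact Hw|].
      intros w' Hw'. apply Rlt_le_trans with (1 := Hlt). apply gprim_mono; lra.
Qed.

Lemma gprim_inf : exists l, (forall w, 0 < w -> l <= gprim w) /\
  forall e, 0 < e -> exists W, 0 < W /\ forall w, 0 < w -> w <= W -> gprim w < l + e.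
Proof.
  destruct (completeness (fun y => exists w, 0 < w <= 1 /\ y = - gprim w)) as (l & Hub & Hlub).
  - exists (Rpower 1 kap / kap - gprim 1). intros y (w & Hw & ->).
    generalize (gprim_upper w 1 ltac:(lra) ltac:(lra)) (Rpower_pos w kap). intros H1 H2.
    assert (0 < Rpower w kap / kap) by (apply Rdiv_lt_0_compat; lra). lra.
  - exists (- gprim 1), 1. split; [lra|reflexivity].
  - exists (- l). split.
    + intros w Hw. apply Rle_trans with (gprim (Rmin w 1)).
      * assert (- gprim (Rmin w 1) <= l); [|lra]. apply Hub. exists (Rmin w 1). split; [|reflexivity].
        split; [apply Rmin_glb_lt; lra|apply Rmin_r].
      * apply gprim_mono; [apply Rmin_glb_lt; lra|apply Rmin_l].
    + intros e He. apply NNPP. intros Hn.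
      assert (l <= l - e); [|lra]. apply Hlub. intros y (w & Hw & ->).
      apply Rnot_lt_le. intros Hlt. apply Hn. exists w. split; [lra|].
      intros w' H0 Hw'. generalize (gprim_mono w' w H0 Hw'). lra.
Qed.

(* The distribution function of the Gamma law, which is that of [x^2 / (2 T)] for the hitting time [T]
   of 0 by the limiting Bessel process started at [x]. *)
Lemma gamma_cdf : 0 < Gamma kap /\ exists F : R -> R,
  (forall w, w <= 0 -> F w = 0) /\
  (forall w, 0 < w -> is_derive F w (gker w / Gamma kap)) /\
  (forall w, 0 <= F w <= 1) /\
  (forall v w, v <= w -> F v <= F w) /\
  (forall e, 0 < e -> exists W, 0 < W /\ forall w, W <= w -> 1 - e < F w) /\
  (forall w, 0 < w -> exp (- w) * Rpower w kap / (kap * Gamma kap) <= F w <= Rpower w kap / (kap * Gamma kap)).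
Proof.
  destruct gprim_sup as (ls & Hs1 & Hs2). destruct gprim_inf as (li & Hi1 & Hi2).
  assert (HG : Gamma kap = ls - li).
  { unfold Gamma. apply is_RInt_gen_unique. intros P (e & He).
    destruct (Hs2 (e / 2)) as (W1 & HW1 & P1); [generalize (cond_pos e); lra|].
    destruct (Hi2 (e / 2)) as (W2 & HW2 & P2); [generalize (cond_pos e); lra|].
    apply Filter_prod with (fun a => 0 < a < W2) (fun b => W1 < b).
    - exists (mkposreal W2 HW2). intros y Hy Hy0. split; [exact Hy0|].
      apply Rabs_def2 in Hy. unfold minus, plus, opp in Hy; simpl in Hy. lra.
    - exists W1. intros y Hy. exact Hy.
    - intros a b Ha Hb. exists (gprim b - gprim a). split.
      + apply gprim_RInt; simpl; lra.
      + apply He. specialize (P1 b ltac:(lra)). specialize (P2 a ltac:(lra) ltac:(lra)).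
        specialize (Hs1 b ltac:(lra)). specialize (Hi1 a ltac:(lra)).
        apply Rabs_def1; unfold minus, plus, opp; simpl; lra. }
  assert (Hlt : li < ls).
  { apply Rle_lt_trans with (gprim 1); [apply Hi1; lra|].
    apply Rlt_le_trans with (gprim 2); [|apply Hs1; lra].
    assert (H := gprim_lower 1 2 ltac:(lra) ltac:(lra)).
    assert (H1 : Rpower 1 kap < Rpower 2 kap) by (apply Rlt_Rpower_l; lra).
    assert (0 < exp (- (2)) * ((Rpower 2 kap - Rpower 1 kap) / kap)); [|lra].
    apply Rmult_lt_0_compat; [apply exp_pos|]. apply Rdiv_lt_0_compat; lra. }
  rewrite HG. set (G := ls - li). assert (HG0 : 0 < G) by (unfold G; lra).
  split; [exact HG0|].
  (* The value 0 at [w = 0] corresponds to the killed state. *)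
  exists (fun w => if Rlt_dec 0 w then (gprim w - li) / G else 0).
  assert (HF : forall w, 0 <= (if Rlt_dec 0 w then (gprim w - li) / G else 0) <= 1).
  { intros w. destruct (Rlt_dec 0 w) as [Hw|Hw]; [|lra].
    specialize (Hs1 w Hw). specialize (Hi1 w Hw). split.
    - apply Rdiv_le_0_compat; lra.
    - apply Rmult_le_reg_r with G; [exact HG0|]. unfold Rdiv. rewrite Rmult_assoc, Rinv_l by lra.
      unfold G. lra. }
  split; [|split; [|split; [|split; [|split]]]].
  - intros w Hw. destruct (Rlt_dec 0 w); [lra|reflexivity].
  - intros w Hw. apply (is_derive_ext_loc (fun w => (gprim w - li) / G)).
    + exists (mkposreal w Hw). intros y Hy. apply Rabs_def2 in Hy.
      unfold minus, plus, opp in Hy; simpl in Hy. destruct (Rlt_dec 0 y); [reflexivity|lra].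
    + apply (is_derive_ext (fun w => / G * (gprim w + - li))); [intros; apply Rminus_diag_uniq; unfold Rdiv; ring|].
      unfold Rdiv. rewrite Rmult_comm. apply is_derive_scal.
      eapply is_derive_value; [|apply (is_derive_plus gprim (fun _ => - li) w (gker w) 0)].
      * unfold plus; simpl; ring.
      * now apply gprim_derive.
      * exact (@is_derive_const R_AbsRing R_NormedModule (- li) w).
  - exact HF.
  - intros v w Hvw. destruct (Rlt_dec 0 v) as [Hv|Hv].
    + destruct (Rlt_dec 0 w); [|lra]. apply Rmult_le_compat_r; [apply Rlt_le, Rinv_0_lt_compat, HG0|].
      generalize (gprim_mono v w Hv Hvw). lra.
    + apply HF.
  - intros e He. destruct (Hs2 (e * G)) as (W & HW & P); [now apply Rmult_lt_0_compat|].
    exists W. split; [lra|]. intros w Hw. destruct (Rlt_dec 0 w) as [H0|H0]; [|lra].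
    specialize (P w Hw). apply Rmult_lt_reg_r with G; [exact HG0|].
    unfold Rdiv. rewrite (Rmult_assoc _ (/ G)), Rinv_l by lra. unfold G in *. nra.
  - intros w Hw. split.
    + destruct (Rlt_dec 0 w) as [H0|H0]; [|lra].
    replace (exp (- w) * Rpower w kap / (kap * G)) with (exp (- w) * Rpower w kap / kap / G) by (field; lra).
    apply Rmult_le_compat_r; [apply Rlt_le, Rinv_0_lt_compat, HG0|].
    apply le_epsilon. intros e He.
    (* [v] is so small that [v^kap / kap <= e]: the lower limit of integration is sent to 0. *)
    set (v := Rmin w (Rpower (e * kap) (/ kap))).
    assert (Hv : 0 < v) by (apply Rmin_glb_lt; [exact H0|apply Rpower_pos]).
    assert (Hvp : Rpower v kap <= e * kap).
    { apply Rle_trans with (Rpower (Rpower (e * kap) (/ kap)) kap).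
      * apply Rle_Rpower_l; [lra|]. split; [exact Hv|apply Rmin_r].
      * rewrite Rpower_mult, Rinv_l, Rpower_1; [apply Rle_refl|now apply Rmult_lt_0_compat|lra]. }
    assert (H1 := gprim_lower v w Hv (Rmin_l _ _)). specialize (Hi1 v Hv).
    assert (H2 : exp (- w) * (Rpower v kap / kap) <= e).
    { apply Rle_trans with (1 * e); [|lra]. apply Rmult_le_compat.
      * apply Rlt_le, exp_pos.
      * apply Rlt_le, Rdiv_lt_0_compat; [apply Rpower_pos|exact Hkap].
      * apply exp_neg_le1. lra.
      * apply Rmult_le_reg_r with kap; [exact Hkap|]. unfold Rdiv. rewrite Rmult_assoc, Rinv_l; lra. }
    unfold Rdiv in *. nra.
    + destruct (Rlt_dec 0 w) as [H0|H0]; [|lra].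
    replace (Rpower w kap / (kap * G)) with (Rpower w kap / kap / G) by (field; lra).
    apply Rmult_le_compat_r; [apply Rlt_le, Rinv_0_lt_compat, HG0|].
    apply le_epsilon. intros e He.
    destruct (Hi2 e He) as (W & HW & P). set (v := Rmin w W).
    assert (Hv : 0 < v) by (now apply Rmin_glb_lt).
    specialize (P v Hv (Rmin_r _ _)). assert (H1 := gprim_upper v w Hv (Rmin_l _ _)).
    assert (0 < Rpower v kap / kap) by (apply Rdiv_lt_0_compat; [apply Rpower_pos|exact Hkap]).
    unfold Rdiv in *. lra.
Qed.

End IncompleteGamma.

(** * The backward equation for the limiting profile *)

(** Mean value theorem. Applied in turn to [F''], [F'] and [F] minus their Taylor polynomials, it
    builds the cubic remainder of [taylor3]. *)
Lemma small_of_deriv (f df : R -> R) (d C : R) (k : nat) :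
  f 0 = 0 ->
  (forall s, Rabs s <= Rabs d -> is_derive f s (df s)) ->
  (forall s, Rabs s <= Rabs d -> Rabs (df s) <= C * Rabs s ^ k) ->
  0 <= C -> Rabs (f d) <= C * Rabs d ^ S k.
Proof.
  intros H0 Hd Hb HC.
  assert (Hin : forall s, Rmin 0 d <= s <= Rmax 0 d -> Rabs s <= Rabs d).
  { intros s. unfold Rmin, Rmax. destruct (Rle_dec 0 d) as [H|H]; intros Hs.
    - rewrite !Rabs_pos_eq by lra. lra.
    - rewrite !Rabs_left1 by lra. lra. }
  destruct (MVT_gen f 0 d df) as (c & Hc & E).
  - intros s Hs. apply Hd, Hin. lra.
  - intros s Hs. apply derivable_continuous_pt. exists (df s). apply is_derive_Reals, Hd, Hin, Hs.
  - apply Hin in Hc. rewrite H0, !Rminus_0_r in E. rewrite E, Rabs_mult.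
    specialize (Hb c Hc). simpl. rewrite (Rmult_comm (Rabs d)), <- Rmult_assoc.
    apply Rmult_le_compat_r; [apply Rabs_pos|]. eapply Rle_trans; [exact Hb|].
    apply Rmult_le_compat_l; [exact HC|]. apply pow_incr. split; [apply Rabs_pos|exact Hc].
Qed.

Section Kernel.
Variable kap : R.
Variable c : R.
Variable F : R -> R.
Hypothesis HF : forall w, 0 < w -> is_derive F w (gker kap w * c).

Lemma gker_bound lo hi : 0 < lo -> lo <= hi -> exists B, 0 < B /\ forall w, lo <= w <= hi -> gker kap w <= B.
Proof.
  intros H0 H. destruct (continuity_ab_maj (gker kap) lo hi H) as (x & Hx & _).
  - intros w Hw. apply continuity_pt_filterlim, (gker_continuous kap w). lra.
  - exists (gker kap x). split; [apply gker_pos|exact Hx].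
Qed.

Lemma gker_ratio_bound lo w : 0 < lo -> lo <= w -> Rabs (gker_ratio kap w) <= Rabs (kap - 1) / lo + 1.
Proof.
  intros H0 H. unfold gker_ratio. unfold Rminus at 1. eapply Rle_trans; [apply Rabs_triang|].
  rewrite Rabs_Ropp, Rabs_R1. apply Rplus_le_compat_r. unfold Rdiv. rewrite Rabs_mult.
  apply Rmult_le_compat_l; [apply Rabs_pos|]. rewrite Rabs_inv, (Rabs_pos_eq w) by lra.
  apply Rinv_le_contravar; lra.
Qed.

Lemma gker_derive2 w : 0 < w ->
  is_derive (fun w => gker kap w * gker_ratio kap w) w
    (gker kap w * (gker_ratio kap w * gker_ratio kap w - (kap - 1) / (w * w))).
Proof.
  intros Hw.
  assert (H1 := gker_derive kap w Hw).
  assert (H2 : is_derive (gker_ratio kap) w (- (kap - 1) / (w * w))).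
  { unfold gker_ratio. auto_derive; [lra|]. field. lra. }
  assert (H := is_derive_mult _ _ w _ _ H1 H2 Rmult_comm).
  eapply is_derive_value; [|exact H]. unfold plus, mult; simpl. field. lra.
Qed.

(** Displacements up to [a / 2] keep [w + d] above [a / 2], away from the singularity of the kernel
    at 0; this makes the constant uniform in [w]. *)
Lemma taylor3 a b : 0 < a -> a <= b -> exists K, 0 < K /\ forall w d, a <= w <= b -> Rabs d <= a / 2 ->
  Rabs (F (w + d) - F w - gker kap w * c * d - gker kap w * gker_ratio kap w * c * d * d / 2) <= K * Rabs d ^ 3.
Proof.
  intros Ha Hab. destruct (gker_bound (a / 2) (b + a / 2)) as (B & HB & HB'); [lra|lra|].
  set (r := Rabs (kap - 1) / (a / 2) + 1).
  set (r2 := Rabs (kap - 1) / (a / 2 * (a / 2))).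
  assert (Hk := Rabs_pos (kap - 1)).
  assert (Hr : 0 < r) by (unfold r; assert (0 <= Rabs (kap - 1) / (a / 2)) by (apply Rdiv_le_0_compat; lra); lra).
  assert (Hr2 : 0 <= r2) by (unfold r2; apply Rdiv_le_0_compat; [lra|apply Rmult_lt_0_compat; lra]).
  set (K := (Rabs c + 1) * (B * (r * r + r2))).
  assert (Hc := Rabs_pos c).
  assert (HK : 0 < K) by (unfold K; repeat apply Rmult_lt_0_compat; nra).
  exists K. split; [exact HK|]. intros w d Hw Hd.
  assert (Hpos : forall s, Rabs s <= Rabs d -> a / 2 <= w + s <= b + a / 2).
  { intros s Hs. assert (H : Rabs s <= a / 2) by lra. apply Rabs_le_between in H. lra. }
  assert (Hshift : forall (g dg : R -> R) s, is_derive g (w + s) (dg (w + s)) ->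
    is_derive (fun s => g (w + s)) s (dg (w + s))).
  { intros g dg s H. assert (H1 : is_derive (fun s => w + s) s 1) by (auto_derive; [trivial|ring]).
    assert (H2 := is_derive_comp g (fun s => w + s) s _ _ H H1).
    eapply is_derive_value; [|exact H2]. unfold scal; simpl. unfold mult; simpl. ring. }
  set (f1 := gker kap w) in *. set (f2 := gker kap w * gker_ratio kap w) in *.
  assert (S1 : forall s, Rabs s <= Rabs d ->
    Rabs ((gker kap (w + s) * gker_ratio kap (w + s) - f2) * c) <= K * Rabs s ^ 1).
  { intros s Hs.
    apply (small_of_deriv (fun s => (gker kap (w + s) * gker_ratio kap (w + s) - f2) * c)
      (fun s => (gker kap (w + s) * (gker_ratio kap (w + s) * gker_ratio kap (w + s) - (kap - 1) / ((w + s) * (w + s)))) * c)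
      s K 0).
    - unfold f2. rewrite Rplus_0_r. ring.
    - intros u Hu. assert (Hp := Hpos u ltac:(lra)).
      apply (is_derive_ext (fun s => c * (gker kap (w + s) * gker_ratio kap (w + s)) + - (f2 * c)));
        [intros; apply Rminus_diag_uniq; ring|].
      eapply is_derive_value; [|apply (is_derive_plus (fun s => c * (gker kap (w + s) * gker_ratio kap (w + s))) (fun _ => - (f2 * c)))].
      2:{ apply is_derive_scal. apply (Hshift (fun w => gker kap w * gker_ratio kap w)
            (fun w => gker kap w * (gker_ratio kap w * gker_ratio kap w - (kap - 1) / (w * w)))).
          apply gker_derive2. lra. }
      2:{ exact (@is_derive_const R_AbsRing R_NormedModule (- (f2 * c)) u). }
      unfold plus, zero; simpl. ring.
    - intros u Hu. assert (Hp := Hpos u ltac:(lra)). rewrite pow_O, Rmult_1_r, Rabs_mult.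
      rewrite Rabs_mult, (Rabs_pos_eq (gker kap (w + u))) by apply Rlt_le, gker_pos.
      unfold K. rewrite Rmult_comm. apply Rmult_le_compat; [apply Rabs_pos| |lra|].
      + apply Rmult_le_pos; [apply Rlt_le, gker_pos|apply Rabs_pos].
      + apply Rmult_le_compat; [apply Rlt_le, gker_pos|apply Rabs_pos|apply HB', Hp|].
        unfold Rminus at 1. eapply Rle_trans; [apply Rabs_triang|]. rewrite Rabs_Ropp.
        assert (Hrb := gker_ratio_bound (a / 2) (w + u) ltac:(lra) ltac:(lra)). fold r in Hrb.
        apply Rplus_le_compat.
        * rewrite Rabs_mult. apply Rmult_le_compat; (apply Rabs_pos || exact Hrb).
        * unfold r2, Rdiv. rewrite Rabs_mult. apply Rmult_le_compat_l; [exact Hk|].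
          assert (0 < a * / 2 * (a * / 2)) by nra.
          assert (a * / 2 * (a * / 2) <= (w + u) * (w + u)) by (apply Rmult_le_compat; lra).
          rewrite Rabs_pos_eq by (apply Rlt_le, Rinv_0_lt_compat; lra).
          apply Rinv_le_contravar; assumption.
    - lra. }
  assert (S2 : forall s, Rabs s <= Rabs d ->
    Rabs ((gker kap (w + s) - f1 - f2 * s) * c) <= K * Rabs s ^ 2).
  { intros s Hs.
    apply (small_of_deriv (fun s => (gker kap (w + s) - f1 - f2 * s) * c)
      (fun s => (gker kap (w + s) * gker_ratio kap (w + s) - f2) * c) s K 1).
    - unfold f1. rewrite Rplus_0_r. ring.
    - intros u Hu. assert (Hp := Hpos u ltac:(lra)).
      apply (is_derive_ext (fun s => c * gker kap (w + s) + c * (- f1 - f2 * s)));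
        [intros; apply Rminus_diag_uniq; ring|].
      eapply is_derive_value; [|apply (is_derive_plus (fun s => c * gker kap (w + s)) (fun s => c * (- f1 - f2 * s)))].
      2:{ apply is_derive_scal. apply (Hshift (gker kap) (fun w => gker kap w * gker_ratio kap w)).
          apply gker_derive. lra. }
      2:{ instantiate (1 := c * (- f2)). auto_derive; [trivial|ring]. }
      unfold plus; simpl. ring.
    - intros u Hu. apply S1. lra.
    - lra. }
  apply (small_of_deriv (fun s => F (w + s) - F w - f1 * c * s - f2 * c * s * s / 2)
    (fun s => (gker kap (w + s) - f1 - f2 * s) * c) d K 2).
  - rewrite Rplus_0_r. field.
  - intros u Hu. assert (Hp := Hpos u Hu).
    apply (is_derive_ext (fun s => F (w + s) + (- F w - f1 * c * s - f2 * c * s * s / 2)));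
      [intros; apply Rminus_diag_uniq; ring|].
    eapply is_derive_value; [|apply (is_derive_plus (fun s => F (w + s)) (fun s => - F w - f1 * c * s - f2 * c * s * s / 2))].
    2:{ apply (Hshift F (fun w => gker kap w * c)). apply HF. lra. }
    2:{ instantiate (1 := - f1 * c - f2 * c * u). auto_derive; [trivial|field]. }
    unfold plus; simpl. ring.
  - exact S2.
  - lra.
Qed.

End Kernel.

Section Defect.
Variables (p : nat -> R) (delta : R).
Hypothesis Hp : forall x, (1 <= x)%nat -> 0 < p x < 1.
Hypothesis Hdrift : is_lim_seq (fun x => INR x * (2 * p x - 1)) (- delta / 2).
Let kap := (1 + delta) / 2.
Variables (c : R) (F : R -> R).
Hypothesis HF : forall w, 0 < w -> is_derive F w (gker kap w * c).

(* [x^2 / (2 t)] solves the limiting parabolic equation after composition with [F]: the first-order terms cancel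
   because [w F''(w) = (kap - 1 - w) F'(w)]. *)
Lemma heat_defect a b eps : 0 < a -> a <= b -> 0 < eps -> exists T, 2 <= T /\ forall t x, T <= t -> (1 <= x)%nat ->
  a <= INR x * INR x / (2 * t) <= b ->
  Rabs (p x * F ((INR x + 1) * (INR x + 1) / (2 * (t - 1)))
    + (1 - p x) * F ((INR x - 1) * (INR x - 1) / (2 * (t - 1)))
    - F (INR x * INR x / (2 * t))) <= eps / t.
Proof.
  intros Ha Hab Heps.
  destruct (taylor3 kap c F HF a b Ha Hab) as (K & HK & HT).
  destruct (gker_bound kap a b Ha Hab) as (B & HB & HB').
  (* One step of the walk moves the argument of [F] by at most [D / sqrt (t - 1)]. *)
  set (D := b + 1 + 2 * sqrt b).
  set (rb := Rabs (kap - 1) / a + 1).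
  set (r2 := 2 * b + (b + 1) * (b + 1) + 2 * (b + 1) * (1 + Rabs delta)).
  set (cc := Rabs c + 1).
  assert (Hc0 := Rabs_pos c). assert (Hd0 := Rabs_pos delta). assert (Hsb := sqrt_pos b).
  assert (Hk0 := Rabs_pos (kap - 1)).
  assert (HD : 0 < D) by (unfold D; lra).
  assert (Hrb : 0 < rb) by (unfold rb; assert (0 <= Rabs (kap - 1) / a) by (apply Rdiv_le_0_compat; lra); lra).
  assert (Hr2 : 0 < r2) by (unfold r2; nra).
  assert (Hcc : 0 < cc) by (unfold cc; lra).
  set (c1 := B * cc * rb * r2).
  assert (Hc1 : 0 < c1) by (unfold c1; repeat apply Rmult_lt_0_compat; assumption).
  set (e1 := Rmin 1 (eps / 4 / (B * cc))).
  assert (HBc : 0 < B * cc) by (now apply Rmult_lt_0_compat).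
  assert (He1 : 0 < e1) by (apply Rmin_glb_lt; [lra|]; apply Rdiv_lt_0_compat; lra).
  destruct (proj1 (lim_eps _ _) Hdrift e1 He1) as [X HX].
  set (Q := c1 + 2 * K * D ^ 3).
  assert (HQ : 0 < Q).
  { unfold Q. assert (0 < D ^ 3) by now apply pow_lt. assert (0 < K * D ^ 3) by (now apply Rmult_lt_0_compat). nra. }
  assert (Hsa : 0 < sqrt a) by now apply sqrt_lt_R0.
  set (V := 1 + 2 * D / a + Q * 4 / eps + INR X / sqrt a).
  assert (HV1 : 0 < 2 * D / a) by (apply Rdiv_lt_0_compat; lra).
  assert (HV2 : 0 < Q * 4 / eps) by (apply Rdiv_lt_0_compat; lra).
  assert (HV3 : 0 <= INR X / sqrt a) by (apply Rdiv_le_0_compat; [apply pos_INR|lra]).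
  assert (HV : 1 <= V) by (unfold V; lra).
  exists (V * V + 1). split; [nra|]. intros t x Ht Hx Hw.
  set (s := t - 1). assert (Hs : V * V <= s) by (unfold s; lra).
  assert (Hs1 : 1 <= s) by nra.
  set (v := sqrt s). assert (Hvv : v * v = s) by (apply sqrt_sqrt; lra).
  assert (Hv : V <= v).
  { unfold v. rewrite <- (sqrt_square V) by lra. now apply sqrt_le_1_alt. }
  set (w := INR x * INR x / (2 * t)) in *.
  assert (Hx0 := INR_gt0 x Hx).
  set (y := INR x) in *.
  assert (Hts : t = s + 1) by (unfold s; ring).
  assert (Hy2 : y * y = 2 * w * (s + 1)) by (unfold w; rewrite Hts; field; lra).
  assert (Hyv : y <= 2 * sqrt b * v).
  { apply Rsqr_incr_0; [|lra|].
    - unfold Rsqr. replace (2 * sqrt b * v * (2 * sqrt b * v)) with (4 * (sqrt b * sqrt b) * (v * v)) by ring.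
      rewrite sqrt_sqrt, Hvv, Hy2 by lra. nra.
    - apply Rmult_le_pos; [lra|lra]. }
  assert (HyX : INR X <= y).
  { apply Rle_trans with (sqrt a * v).
    - apply Rle_trans with (sqrt a * (INR X / sqrt a)); [apply Req_le; field; lra|].
      apply Rmult_le_compat_l; [lra|]. unfold V in Hv. lra.
    - apply Rsqr_incr_0; [|apply Rmult_le_pos; lra|lra].
      unfold Rsqr. replace (sqrt a * v * (sqrt a * v)) with ((sqrt a * sqrt a) * (v * v)) by ring.
      rewrite sqrt_sqrt, Hvv, Hy2 by lra. nra. }
  assert (HXx : (X <= x)%nat) by (apply INR_le; exact HyX).
  specialize (HX x HXx). fold y in HX.
  set (eta := y * (2 * p x - 1) - - delta / 2) in HX.
  assert (Heta1 : Rabs eta <= 1) by (generalize (Rmin_l 1 (eps / 4 / (B * cc))); unfold e1 in HX; lra).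
  assert (Heta2 : B * cc * Rabs eta <= eps / 4).
  { apply Rle_trans with (B * cc * (eps / 4 / (B * cc))).
    - apply Rmult_le_compat_l; [lra|]. generalize (Rmin_r 1 (eps / 4 / (B * cc))). unfold e1 in HX. lra.
    - apply Req_le. field. lra. }
  set (dp := (w + 1 / 2 + y) / s). set (dm := (w + 1 / 2 - y) / s).
  assert (Ep : (y + 1) * (y + 1) / (2 * s) = w + dp).
  { unfold dp. apply Rmult_eq_reg_r with (2 * s); [|lra].
    replace ((w + (w + 1 / 2 + y) / s) * (2 * s)) with (2 * w * s + 2 * w + 1 + 2 * y) by (field; lra).
    replace ((y + 1) * (y + 1) / (2 * s) * (2 * s)) with (y * y + 2 * y + 1) by (field; lra). lra. }
  assert (Em : (y - 1) * (y - 1) / (2 * s) = w + dm).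
  { unfold dm. apply Rmult_eq_reg_r with (2 * s); [|lra].
    replace ((w + (w + 1 / 2 - y) / s) * (2 * s)) with (2 * w * s + 2 * w + 1 - 2 * y) by (field; lra).
    replace ((y - 1) * (y - 1) / (2 * s) * (2 * s)) with (y * y - 2 * y + 1) by (field; lra). lra. }
  rewrite Ep, Em.
  assert (Hdv : forall d, Rabs d <= w + 1 / 2 + y -> Rabs (d / s) <= D / v).
  { intros d Hd. unfold Rdiv at 1. rewrite Rabs_mult, Rabs_inv, (Rabs_pos_eq s) by lra.
    apply Rmult_le_reg_r with s; [lra|]. rewrite Rmult_assoc, Rinv_l, Rmult_1_r by lra.
    replace (D / v * s) with (D * v) by (rewrite <- Hvv; field; lra). unfold D. nra. }
  assert (Hdp : Rabs dp <= D / v).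
  { apply Hdv. rewrite Rabs_pos_eq; lra. }
  assert (Hdm : Rabs dm <= D / v).
  { apply Hdv. apply Rabs_le. lra. }
  assert (HDv : D / v <= a / 2).
  { apply Rmult_le_reg_r with v; [lra|]. unfold Rdiv at 1. rewrite Rmult_assoc, Rinv_l, Rmult_1_r by lra.
    apply Rle_trans with (a / 2 * (2 * D / a)); [apply Req_le; field; lra|].
    apply Rmult_le_compat_l; [lra|]. unfold V in Hv. lra. }
  assert (Tp := HT w dp Hw ltac:(lra)). assert (Tm := HT w dm Hw ltac:(lra)).
  set (f1 := gker kap w) in *. set (q := gker_ratio kap w) in *.
  set (Rp := F (w + dp) - F w - f1 * c * dp - f1 * q * c * dp * dp / 2) in *.
  set (Rm := F (w + dm) - F w - f1 * c * dm - f1 * q * c * dm * dm / 2) in *.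
  set (rr := 2 * w + (w + 1 / 2) * (w + 1 / 2) + 2 * (w + 1 / 2) * (eta - delta / 2)).
  assert (Hqw : q * w = kap - 1 - w) by (unfold q, gker_ratio; field; lra).
  assert (Hkd : kap - 1 = delta / 2 - 1 / 2) by (unfold kap; field).
  assert (Epx : y * (2 * p x - 1) = eta - delta / 2) by (unfold eta; field).
  (* The mean displacement is [(w + 1/2 - delta/2 + eta) / s] and the mean square is about
     [2 w / s]. Since [q w = kap - 1 - w] and [kap - 1 = delta/2 - 1/2], the terms of order [1 / s]
     cancel except for the small [eta / s]; a term of order [1 / s^2] and the Taylor remainders are
     left. *)
  assert (EE : p x * F (w + dp) + (1 - p x) * F (w + dm) - F w =
    p x * Rp + (1 - p x) * Rm + f1 * c * (eta / s + q * rr / (2 * (s * s)))).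
  { assert (M1 : p x * dp + (1 - p x) * dm = (w + 1 / 2 + (eta - delta / 2)) / s).
    { rewrite <- Epx. unfold dp, dm. field. lra. }
    assert (M2 : p x * (dp * dp) + (1 - p x) * (dm * dm) = 2 * w / s + rr / (s * s)).
    { transitivity (((w + 1 / 2) * (w + 1 / 2) + y * y + 2 * (w + 1 / 2) * (y * (2 * p x - 1))) / (s * s)).
      - unfold dp, dm. field. lra.
      - rewrite Epx, Hy2. unfold rr. field. lra. }
    transitivity (p x * Rp + (1 - p x) * Rm + f1 * c * (p x * dp + (1 - p x) * dm)
      + f1 * c * q / 2 * (p x * (dp * dp) + (1 - p x) * (dm * dm))).
    - unfold Rp, Rm. field.
    - rewrite M1, M2. replace (w + 1 / 2 + (eta - delta / 2)) with (eta - q * w) by (rewrite Hqw, Hkd; ring).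
      field. lra. }
  rewrite EE. clear EE.
  assert (Hrr : Rabs rr <= r2).
  { unfold rr, r2.
    assert (Hed : Rabs (eta - delta / 2) <= 1 + Rabs delta).
    { unfold Rminus. eapply Rle_trans; [apply Rabs_triang|]. rewrite Rabs_Ropp.
      unfold Rdiv. rewrite Rabs_mult, (Rabs_pos_eq (/ 2)) by lra. lra. }
    apply Rabs_le_between in Hed. apply Rabs_le. split; nra. }
  assert (Hq : Rabs q <= rb) by (apply gker_ratio_bound; lra).
  assert (Hf1 : 0 < f1 <= B) by (split; [apply gker_pos|now apply HB']).
  assert (Hfc : Rabs (f1 * c) <= B * cc).
  { rewrite Rabs_mult, (Rabs_pos_eq f1) by lra. unfold cc. apply Rmult_le_compat; lra. }
  assert (HD3 : forall d, Rabs d <= D / v -> K * Rabs d ^ 3 <= K * D ^ 3 / (v * s)).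
  { intros d Hd. apply Rle_trans with (K * (D / v) ^ 3).
    - apply Rmult_le_compat_l; [lra|]. apply pow_incr. split; [apply Rabs_pos|exact Hd].
    - apply Req_le. rewrite <- Hvv. field. lra. }
  assert (Tp' := Rle_trans _ _ _ Tp (HD3 dp Hdp)). assert (Tm' := Rle_trans _ _ _ Tm (HD3 dm Hdm)).
  set (Z := K * D ^ 3 / (v * s)) in *.
  destruct (Hp x Hx) as [Hp0 Hp1].
  assert (HZ : Rabs (p x * Rp + (1 - p x) * Rm) <= Z).
  { eapply Rle_trans; [apply Rabs_triang|]. rewrite !Rabs_mult, (Rabs_pos_eq (p x)), (Rabs_pos_eq (1 - p x)) by lra. nra. }
  assert (Hmain : Rabs (f1 * c * (eta / s + q * rr / (2 * (s * s)))) <= eps / 4 / s + c1 / (s * v)).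
  { rewrite Rabs_mult. apply Rle_trans with (B * cc * (Rabs eta / s + rb * r2 / (s * v))).
    - apply Rmult_le_compat; [apply Rabs_pos|apply Rabs_pos|exact Hfc|].
      eapply Rle_trans; [apply Rabs_triang|]. apply Rplus_le_compat.
      + unfold Rdiv. rewrite Rabs_mult, Rabs_inv, (Rabs_pos_eq s) by lra. lra.
      + unfold Rdiv. rewrite !Rabs_mult, Rabs_inv, (Rabs_pos_eq (2 * (s * s))) by nra.
        assert (0 < s * v) by (apply Rmult_lt_0_compat; lra).
        assert (Hvs : v <= s) by (rewrite <- Hvv; nra).
        apply Rmult_le_compat.
        * apply Rmult_le_pos; apply Rabs_pos.
        * apply Rlt_le, Rinv_0_lt_compat. nra.
        * apply Rmult_le_compat; (apply Rabs_pos || assumption).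
        * apply Rinv_le_contravar; nra.
    - rewrite Rmult_plus_distr_l. apply Rplus_le_compat.
      + unfold Rdiv at 1. rewrite <- Rmult_assoc. unfold Rdiv at 2.
        apply Rmult_le_compat_r; [apply Rlt_le, Rinv_0_lt_compat; lra|exact Heta2].
      + apply Req_le. unfold c1. field. lra. }
  eapply Rle_trans; [apply Rabs_triang|].
  apply Rle_trans with (Z + (eps / 4 / s + c1 / (s * v))); [lra|].
  apply Rle_trans with (eps / 2 / s).
  - assert (HQv : Q / v <= eps / 4).
    { apply Rmult_le_reg_r with v; [lra|]. unfold Rdiv at 1. rewrite Rmult_assoc, Rinv_l, Rmult_1_r by lra.
      apply Rle_trans with (eps / 4 * (Q * 4 / eps)); [apply Req_le; field; lra|].
      apply Rmult_le_compat_l; [lra|]. unfold V in Hv. lra. }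
    apply Rle_trans with ((Q / v + eps / 4) / s).
    + assert (HZ2 : 0 <= K * D ^ 3 / (v * s)).
      { apply Rdiv_le_0_compat; [apply Rmult_le_pos; [lra|apply pow_le; lra]|apply Rmult_lt_0_compat; lra]. }
      replace ((Q / v + eps / 4) / s) with (2 * (K * D ^ 3 / (v * s)) + (eps / 4 / s + c1 / (s * v))).
      * unfold Z. lra.
      * unfold Q. field. lra.
    + unfold Rdiv at 1. unfold Rdiv at 3. apply Rmult_le_compat_r; [apply Rlt_le, Rinv_0_lt_compat; lra|lra].
  - rewrite Hts. apply Rmult_le_reg_r with (s * (s + 1)); [nra|].
    replace (eps / 2 / s * (s * (s + 1))) with (eps / 2 * (s + 1)) by (field; lra).
    replace (eps / (s + 1) * (s * (s + 1))) with (eps * s) by (field; lra). nra.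
Qed.

End Defect.

(** * Survival from height of order sqrt n *)

Lemma lim_small_inv (A : R) : 0 < A -> is_lim_seq (fun n => / (INR n + A)) 0.
Proof.
  intros HA. apply lim_inv_infty. apply (is_lim_seq_le_p_loc INR); [|exact is_lim_seq_INR].
  exists 0%nat. intros n _. lra.
Qed.

Section WeakLimit.
Variables (p : nat -> R) (delta : R).
Hypothesis Hdelta : -1 < delta.
Hypothesis HR : is_lim_seq (fun x => INR x * Rerr p delta x) 0.
Variable eps0 : R.
Hypothesis Heps0 : 0 < eps0.
Hypothesis Hell : forall x, (1 <= x)%nat -> eps0 <= p x <= 1 - eps0.
Let kap := (1 + delta) / 2.
Let Hkap : 0 < kap.
Proof. unfold kap. lra. Qed.
Let Hp := p_bounds p eps0 Heps0 Hell.

Lemma drift_bounded : exists C, 0 < C /\ forall x, Rabs (INR x * (2 * p x - 1)) <= C.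
Proof.
  apply (lim_bounded (fun x => Rabs (INR x * (2 * p x - 1))) (Rabs (- delta / 2))).
  apply (is_lim_seq_abs _ (- delta / 2)). exact (drift_lim p delta HR).
Qed.

Lemma step_square C : (forall x, Rabs (INR x * (2 * p x - 1)) <= C) ->
  forall y, step p (fun x => INR x * INR x) (S y) <= INR (S y) * INR (S y) + (1 + 2 * C).
Proof.
  intros HC y. specialize (HC (S y)). apply Rabs_le_between in HC.
  rewrite step_S, !S_INR in *. nra.
Qed.

Lemma scaleM_infty : is_lim_seq (scaleM p) p_infty.
Proof.
  apply (is_lim_seq_ext (psum (lambda p))); [intros; symmetry; apply scaleM_psum|].
  apply (regvar_diverges _ delta); [apply lambda_pos, Hp|now apply (lambda_regvar p delta HR eps0)|exact Hdelta].
Qed.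

Variable F : R -> R.
Variable G : R.
Hypothesis HG : 0 < G.
Hypothesis F_neg : forall w, w <= 0 -> F w = 0.
Hypothesis F_derive : forall w, 0 < w -> is_derive F w (gker kap w / G).
Hypothesis F_range : forall w, 0 <= F w <= 1.
Hypothesis F_mono : forall v w, v <= w -> F v <= F w.
Hypothesis F_top : forall e, 0 < e -> exists W, 0 < W /\ forall w, W <= w -> 1 - e < F w.
Hypothesis F_zero : forall w, 0 < w ->
  exp (- w) * Rpower w kap / (kap * G) <= F w <= Rpower w kap / (kap * G).

Lemma F_small e : 0 < e -> exists a, 0 < a /\ F a <= e.
Proof.
  intros He. assert (HkG : 0 < e * (kap * G)) by (apply Rmult_lt_0_compat; [exact He|now apply Rmult_lt_0_compat]).
  exists (Rpower (e * (kap * G)) (/ kap)). split; [apply Rpower_pos|].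
  eapply Rle_trans; [apply F_zero, Rpower_pos|].
  rewrite Rpower_mult, Rinv_l, Rpower_1 by lra. apply Req_le. field. split; lra.
Qed.

Lemma F_defect a b eps : 0 < a -> a <= b -> 0 < eps -> exists T, 2 <= T /\ forall t y, T <= t ->
  a <= INR (S y) * INR (S y) / (2 * t) <= b ->
  Rabs (step p (fun x => F (INR x * INR x / (2 * (t - 1)))) (S y) - F (INR (S y) * INR (S y) / (2 * t))) <= eps / t.
Proof.
  intros Ha Hab He.
  destruct (heat_defect p delta Hp (drift_lim p delta HR) (/ G) F F_derive a b eps Ha Hab He) as (T & HT & H).
  exists T. split; [exact HT|]. intros t y Ht Hy. specialize (H t (S y) Ht ltac:(lia) Hy).
  rewrite step_S. rewrite (S_INR (S y)). replace (INR y) with (INR (S y) - 1) by (rewrite S_INR; ring). exact H.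
Qed.

(* Comparison with a subsolution: [F] shifted in time by [theta n], corrected for the heat defect
   and cut off at large [x] by the submartingale bound [x^2 + C k]. *)
Lemma alive_ge_cdf w0 w1 w2 tau : 0 < w1 -> w1 < w0 -> 0 < tau ->
  exists N, forall n m, (N <= n)%nat -> 2 * w0 * INR n <= INR m * INR m <= 2 * w2 * INR n ->
  F w1 - tau <= alive p n m.
Proof.
  intros Hw1 Hw01 Htau.
  destruct drift_bounded as (C0 & HC0 & HC0').
  set (C := 1 + 2 * C0).
  (* Chosen so that [(1 + theta) w1 = w0]: after the time shift by [theta n] the argument of [F] at
     the start is still at least [w1]. The shift also makes the time large enough for [F_defect]
     from the first step on. *)
  set (theta := w0 / w1 - 1).
  assert (Htheta : 0 < theta).
  { unfold theta. assert (1 < w0 / w1); [|lra]. apply Rmult_lt_reg_r with w1; [lra|].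
    unfold Rdiv. rewrite Rmult_assoc, Rinv_l; lra. }
  set (sg := tau / 3).
  destruct (F_small sg) as (a & Ha & HFa); [unfold sg; lra|].
  set (w2' := Rmax w2 0). assert (Hw2 : w2 <= w2' /\ 0 <= w2') by (split; [apply Rmax_l|apply Rmax_r]).
  set (BB := (2 * w2' + C) / sg).
  assert (HBB : 0 < BB) by (apply Rdiv_lt_0_compat; unfold C, sg; lra).
  set (b := Rmax a (BB / (2 * theta))).
  destruct (F_defect a b (sg * theta)) as (T & HT & Hdef);
    [exact Ha|apply Rmax_l|apply Rmult_lt_0_compat; unfold sg; lra|].
  destruct (proj1 (lim_infty _) (lim_scal_INR theta Htheta) T) as [N1 P1].
  exists (S N1). intros n m Hn Hm. specialize (P1 n ltac:(lia)). cbv beta in P1.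
  assert (Hn0 := INR_gt0 n ltac:(lia)).
  set (s := theta * INR n) in *.
  set (e := sg / INR n).
  assert (He : 0 < e) by (apply Rdiv_lt_0_compat; unfold sg; lra).
  (* The constant [sg] pays for arguments below [a], where [F <= sg]. The term [e k] collects the
     heat defects, at most [sg] in [n] steps. The quadratic term makes [v] nonpositive at large [x],
     and [BB] is such that at the start it is at most [sg]. *)
  set (v := fun (k x : nat) => F (INR x * INR x / (2 * (s + INR k))) - sg - e * INR k
     - (INR x * INR x + C * INR k) / (BB * INR n)).
  assert (HBn : 0 < BB * INR n) by now apply Rmult_lt_0_compat.
  assert (Hz : forall k x, 0 <= (INR x * INR x + C * INR k) / (BB * INR n)).
  { intros k x. apply Rdiv_le_0_compat; [|exact HBn]. generalize (pos_INR x) (pos_INR k). intros.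
    apply Rplus_le_le_0_compat; apply Rmult_le_pos; unfold C; lra. }
  assert (Hcl : forall k x, v k x <= alive p k x).
  { induction k as [|k IH]; intros x.
    - destruct x as [|x].
      + unfold v. specialize (Hz 0%nat 0%nat). simpl INR in *. simpl alive.
        rewrite F_neg by (apply Req_le; field; lra). rewrite Rmult_0_r. unfold sg. lra.
      + unfold v. simpl alive. specialize (Hz 0%nat (S x)). destruct (F_range (INR (S x) * INR (S x) / (2 * (s + INR 0)))).
        change (INR 0) with 0 in *. rewrite (Rmult_0_r e). unfold sg. lra.
    - assert (Hk0 := pos_INR (S k)).
      assert (Hek : 0 <= e * INR (S k)) by (apply Rmult_le_pos; lra).
      destruct (alive_bounds p Hp (S k) x) as [Hal _].
      set (t := s + INR (S k)).
      destruct (Rle_lt_dec (INR x * INR x / (2 * t)) a) as [Hlo|Hlo].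
      { apply Rle_trans with 0; [|exact Hal]. unfold v. fold t. specialize (Hz (S k) x).
        generalize (F_mono _ _ Hlo). lra. }
      destruct (Rle_lt_dec 1 ((INR x * INR x + C * INR (S k)) / (BB * INR n))) as [Hhi|Hhi].
      { apply Rle_trans with 0; [|exact Hal]. unfold v. fold t.
        destruct (F_range (INR x * INR x / (2 * t))). unfold sg in *. lra. }
      destruct x as [|x].
      { exfalso. change (INR 0) with 0 in Hlo. unfold t in Hlo.
        replace (0 * 0 / (2 * (s + INR (S k)))) with 0 in Hlo by (field; lra). lra. }
      assert (Hsk : INR (S k) = INR k + 1) by apply S_INR.
      assert (Hb : INR (S x) * INR (S x) / (2 * t) <= b).
      { apply Rle_trans with (BB / (2 * theta)); [|apply Rmax_r].
        apply Rmult_lt_compat_r with (r := BB * INR n) in Hhi; [|exact HBn].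
        unfold Rdiv in Hhi. rewrite Rmult_assoc, Rinv_l in Hhi by lra.
        assert (HCk : 0 <= C * INR (S k)) by (apply Rmult_le_pos; unfold C; lra).
        apply Rle_trans with (BB * INR n / (2 * s)).
        - unfold Rdiv. apply Rmult_le_compat.
          + apply Rle_0_sqr.
          + apply Rlt_le, Rinv_0_lt_compat. unfold t. lra.
          + lra.
          + apply Rinv_le_contravar; unfold t; lra.
        - apply Req_le. unfold s. field. lra. }
      assert (Hd := Hdef t x ltac:(unfold t; lra) (conj (Rlt_le _ _ Hlo) Hb)).
      assert (Het : sg * theta / t <= e).
      { unfold e. apply Rmult_le_reg_r with (t * INR n); [apply Rmult_lt_0_compat; unfold t; lra|].
        replace (sg * theta / t * (t * INR n)) with (sg * s) by (unfold s; field; unfold t; lra).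
        replace (sg / INR n * (t * INR n)) with (sg * t) by (field; lra).
        apply Rmult_le_compat_l; [unfold sg; lra|]. unfold t; lra. }
      apply Rabs_le_between in Hd.
      change (alive p (S k)) with (step p (alive p k)).
      apply Rle_trans with (step p (v k) (S x)); [|apply step_le; [exact Hp|apply IH|apply IH]].
      assert (Et : t - 1 = s + INR k) by (unfold t; lra). rewrite Et in Hd.
      assert (Hsq := step_square C0 HC0' x). fold C in Hsq.
      assert (Ev : step p (v k) (S x) = step p (fun y => F (INR y * INR y / (2 * (s + INR k)))) (S x)
         - sg - e * INR k - (step p (fun y => INR y * INR y) (S x) + C * INR k) / (BB * INR n)).
      { rewrite !step_S. unfold v. field. lra. }
      rewrite Ev. unfold v. fold t. rewrite Hsk.
      assert ((step p (fun y => INR y * INR y) (S x) + C * INR k) / (BB * INR n)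
        <= (INR (S x) * INR (S x) + C * (INR k + 1)) / (BB * INR n)).
      { apply Rmult_le_compat_r; [apply Rlt_le, Rinv_0_lt_compat, HBn|]. lra. }
      lra. }
  eapply Rle_trans; [|apply Hcl]. unfold v.
  assert (H1 : F w1 <= F (INR m * INR m / (2 * (s + INR n)))).
  { apply F_mono. apply Rmult_le_reg_r with (2 * (s + INR n)); [unfold s; nra|].
    replace (INR m * INR m / (2 * (s + INR n)) * (2 * (s + INR n))) with (INR m * INR m) by (field; unfold s; nra).
    replace (w1 * (2 * (s + INR n))) with (2 * w0 * INR n) by (unfold s, theta; field; lra). lra. }
  assert (H2 : e * INR n = sg) by (unfold e; field; lra).
  assert (H3 : (INR m * INR m + C * INR n) / (BB * INR n) <= sg).
  { apply Rmult_le_reg_r with (BB * INR n); [exact HBn|].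
    unfold Rdiv. rewrite Rmult_assoc, Rinv_l, Rmult_1_r by lra.
    replace (sg * (BB * INR n)) with ((2 * w2' + C) * INR n) by (unfold BB; field; unfold sg; lra). nra. }
  unfold sg in *. lra.
Qed.

(** From below [sqrt (eta n)] the walk seldom reaches height [sqrt (eta1 n)], as the ratio of the
    values of [M] is about [u^kap], and it seldom stays below that height for [theta n] steps, by
    the exit-time bound. *)
Lemma alive_low_start theta sg : 0 < theta -> 0 < sg -> exists eta N, 0 < eta /\
  forall n x, (N <= n)%nat -> INR x * INR x <= eta * INR n -> alive p (flr (theta * INR n)) x <= sg.
Proof.
  intros Htheta Hsg.
  destruct (exit_time_bound p delta HR eps0 Heps0 Hell scaleM_infty) as (C & HC & Hexit).
  (* With this [eta1] the exit-time bound after [theta n / 2] steps is [sg / 4]. *)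
  set (eta1 := sg * theta / (8 * C)).
  assert (Heta1 : 0 < eta1) by (unfold eta1; apply Rdiv_lt_0_compat; [now apply Rmult_lt_0_compat|lra]).
  set (u := Rmin 1 (Rpower (sg / 4) (/ kap))).
  assert (Hu : 0 < u) by (apply Rmin_glb_lt; [lra|apply Rpower_pos]).
  set (eta := eta1 * u). assert (Heta : 0 < eta) by now apply Rmult_lt_0_compat.
  assert (Huk : Rpower u kap <= sg / 4).
  { apply Rle_trans with (Rpower (Rpower (sg / 4) (/ kap)) kap).
    - apply Rle_Rpower_l; [lra|]. split; [exact Hu|apply Rmin_r].
    - rewrite Rpower_mult, Rinv_l, Rpower_1; lra. }
  assert (HMr := Mq_ratio p delta HR eps0 Heps0 Hell scaleM_infty (fun n => eta1 * INR n) (fun n => eta * INR n) u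
    Hu (lim_scal_INR eta1 Heta1)).
  destruct (ev_lt _ _ (sg / 2) (HMr ltac:(
    apply (lim_ext_from 1 (fun _ => u)); [|apply is_lim_seq_const];
    intros n Hn; generalize (INR_gt0 n Hn); intros; unfold eta; field; lra))) as [N1 P1]; [fold kap; lra|].
  destruct (ev_gt _ _ (theta / 2) (flr_scal_ratio theta Htheta)) as [N2 P2]; [lra|].
  destruct (proj1 (lim_infty _) (lim_scal_INR eta1 Heta1) 1) as [N3 P3].
  exists eta, (S (N1 + N2 + N3)). split; [exact Heta|]. intros n x Hn Hx.
  specialize (P1 n ltac:(lia)). specialize (P2 n ltac:(lia)). specialize (P3 n ltac:(lia)). cbv beta in P1, P2, P3.
  assert (Hn0 := INR_gt0 n ltac:(lia)).
  set (j := flr (theta * INR n)) in *. set (m := flr (sqrt (eta1 * INR n))).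
  assert (Hm : (1 <= m)%nat) by (apply flr_sqrt_pos; lra).
  assert (Hxs : INR x <= sqrt (eta * INR n)).
  { rewrite <- (sqrt_square (INR x)) by apply pos_INR. now apply sqrt_le_1_alt. }
  assert (Hxe : (x <= flr (sqrt (eta * INR n)))%nat) by now apply flr_ge.
  assert (Hxm : (x <= m)%nat).
  { apply flr_ge. eapply Rle_trans; [exact Hxs|]. apply sqrt_le_1_alt. apply Rmult_le_compat_r; [lra|].
    unfold eta. generalize (Rmin_l 1 (Rpower (sg / 4) (/ kap))). fold u. nra. }
  assert (Hua := alive_upper p Hp m 0 j x Hm Hxm). rewrite Nat.add_0_r in Hua.
  eapply Rle_trans; [exact Hua|].
  assert (HMm : 0 < scaleM p m) by (now apply scaleM_pos).
  assert (H1 : scaleM p x / scaleM p m * alive p 0 m <= sg / 2).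
  { destruct (alive_bounds p Hp 0 m) as [_ Ha].
    assert (0 <= scaleM p x / scaleM p m) by (apply Rdiv_le_0_compat; [now apply scaleM_nonneg|lra]).
    apply Rle_trans with (scaleM p x / scaleM p m * 1); [now apply Rmult_le_compat_l|]. rewrite Rmult_1_r.
    apply Rle_trans with (Mq p (eta * INR n) / Mq p (eta1 * INR n)); [|lra].
    apply Rmult_le_compat_r; [apply Rlt_le, Rinv_0_lt_compat, HMm|]. now apply scaleM_mono. }
  assert (H2 : confined p m j x <= sg / 2).
  { assert (Hj : theta / 2 * INR n < INR j).
    { apply Rmult_lt_compat_r with (r := INR n) in P2; [|exact Hn0].
      unfold Rdiv in P2. rewrite (Rmult_assoc (INR j)), Rinv_l in P2 by lra. unfold Rdiv. lra. }
    assert (Hj0 : 0 < INR j) by nra.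
    specialize (Hexit m j x Hxm). assert (Hm2 := flr_sqrt_sq (eta1 * INR n) ltac:(lra)). fold m in Hm2.
    apply Rmult_le_reg_l with (INR j); [exact Hj0|]. eapply Rle_trans; [exact Hexit|].
    apply Rle_trans with (C * (eta1 * INR n)); [apply Rmult_le_compat_l; lra|].
    replace (C * (eta1 * INR n)) with (sg / 4 * (theta / 2 * INR n)) by (unfold eta1; field; lra). nra. }
  lra.
Qed.

(** Comparison with a supersolution. Since [F] is small near 0 whereas [alive] starts at 1, the
    comparison begins only after [j], about [theta n], steps: by then low starting points have
    survival probability at most [sg], and at the others the shifted [F] exceeds [1 - sg]. *)
Lemma alive_le_cdf w0 w1 tau : 0 < w0 -> w0 < w1 -> 0 < tau ->
  exists N, forall n m, (N <= n)%nat -> INR m * INR m <= 2 * w0 * INR n ->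
  alive p n m <= F w1 + tau.
Proof.
  intros Hw0 Hw01 Htau.
  (* Giving up [theta n] steps leaves [(1 - theta) n = (w0 / w1) n], so the argument of [F] at the
     start is still at most [w1]. *)
  set (theta := 1 - w0 / w1).
  assert (Htheta : 0 < theta < 1).
  { unfold theta. assert (0 < w0 / w1 < 1); [|lra]. split; [apply Rdiv_lt_0_compat; lra|].
    apply Rmult_lt_reg_r with w1; [lra|]. unfold Rdiv. rewrite Rmult_assoc, Rinv_l; lra. }
  set (sg := tau / 2).
  destruct (alive_low_start theta sg) as (eta & N0 & Heta & Hlow); [lra|unfold sg; lra|].
  destruct (F_top sg) as (W & HW & HFW); [unfold sg; lra|].
  (* The shift [th n] is so short that at [k = 0] every [x] with [x^2 > eta n] has argument at least
     [W]. *)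
  set (th := eta / (2 * W)).
  assert (Hth : 0 < th) by (apply Rdiv_lt_0_compat; lra).
  (* A lower bound for the argument at such [x] as long as the shifted time is at most
     [(th + 1) n]. *)
  set (a := Rmin W (eta / (2 * (th + 2)))).
  assert (Ha : 0 < a) by (apply Rmin_glb_lt; [lra|apply Rdiv_lt_0_compat; lra]).
  destruct (F_defect a W (sg * th)) as (T & HT & Hdef);
    [exact Ha|apply Rmin_l|apply Rmult_lt_0_compat; unfold sg; lra|].
  destruct (proj1 (lim_infty _) (lim_scal_INR th Hth) T) as [N1 P1].
  exists (S (N0 + N1)). intros n m Hn Hm. specialize (P1 n ltac:(lia)). cbv beta in P1.
  assert (Hn0 := INR_gt0 n ltac:(lia)). assert (Hn1 : 1 <= INR n) by (apply (le_INR 1); lia).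
  set (s := th * INR n) in *. set (e := sg / INR n).
  assert (He : 0 < e) by (apply Rdiv_lt_0_compat; unfold sg; lra).
  set (j := flr (theta * INR n)) in *.
  destruct (flr_bounds (theta * INR n)) as [Hj1 Hj2]; [apply Rmult_le_pos; lra|]. fold j in Hj1, Hj2.
  assert (Hjn : (j <= n)%nat) by (apply INR_le; nra).
  set (v := fun (k x : nat) => F (INR x * INR x / (2 * (s + INR k))) + e * INR k + sg).
  assert (Hcl : forall k x, (k <= n)%nat -> alive p (k + j) x <= v k x).
  { induction k as [|k IH]; intros x Hk.
    - simpl Nat.add. unfold v. destruct (F_range (INR x * INR x / (2 * (s + INR 0)))) as [Hf _].
      change (INR 0) with 0 in *. rewrite (Rmult_0_r e).
      destruct (Rle_lt_dec (INR x * INR x) (eta * INR n)) as [Hlo|Hlo].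
      + generalize (Hlow n x ltac:(lia) Hlo). fold j. lra.
      + destruct (alive_bounds p Hp j x) as [_ Hal].
        assert (HWw : W <= INR x * INR x / (2 * (s + 0))).
        { apply Rmult_le_reg_r with (2 * (s + 0)); [lra|].
          unfold Rdiv. rewrite (Rmult_assoc (INR x * INR x)), Rinv_l by lra.
          replace (W * (2 * (s + 0))) with (eta * INR n) by (unfold s, th; field; lra). lra. }
        specialize (HFW _ HWw). lra.
    - assert (Hk0 := pos_INR (S k)).
      assert (Hek : 0 <= e * INR (S k)) by (apply Rmult_le_pos; lra).
      destruct (alive_bounds p Hp (S k + j) x) as [_ Hal].
      set (t := s + INR (S k)).
      destruct (F_range (INR x * INR x / (2 * t))) as [Hf _].
      destruct (Rle_lt_dec (INR x * INR x) (eta * INR n)) as [Hlo|Hlo].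
      { unfold v. fold t. generalize (alive_antitone p Hp j (S k + j) x ltac:(lia)) (Hlow n x ltac:(lia) Hlo).
        fold j. lra. }
      destruct (Rle_lt_dec W (INR x * INR x / (2 * t))) as [Hhi|Hhi].
      { unfold v. fold t. specialize (HFW _ Hhi). lra. }
      destruct x as [|x].
      { exfalso. change (INR 0) with 0 in Hlo. nra. }
      assert (Hsk : INR (S k) = INR k + 1) by apply S_INR.
      assert (Hkn : INR (S k) <= INR n) by (apply le_INR; lia).
      assert (Hlo' : a <= INR (S x) * INR (S x) / (2 * t)).
      { apply Rle_trans with (eta / (2 * (th + 2))); [apply Rmin_r|].
        apply Rle_trans with (eta * INR n / (2 * t)).
        - apply Rmult_le_reg_r with (2 * (th + 2) * (2 * t)); [apply Rmult_lt_0_compat; unfold t; lra|].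
          replace (eta / (2 * (th + 2)) * (2 * (th + 2) * (2 * t))) with (eta * (2 * t)) by (field; lra).
          replace (eta * INR n / (2 * t) * (2 * (th + 2) * (2 * t))) with (eta * (INR n * (2 * (th + 2))))
            by (field; unfold t; lra).
          apply Rmult_le_compat_l; [lra|]. unfold t, s. nra.
        - apply Rmult_le_compat_r; [apply Rlt_le, Rinv_0_lt_compat; unfold t; lra|lra]. }
      assert (Hd := Hdef t x ltac:(unfold t; lra) (conj Hlo' (Rlt_le _ _ Hhi))).
      assert (Het : sg * th / t <= e).
      { unfold e. apply Rmult_le_reg_r with (t * INR n); [apply Rmult_lt_0_compat; unfold t; lra|].
        replace (sg * th / t * (t * INR n)) with (sg * s) by (unfold s; field; unfold t; lra).
        replace (sg / INR n * (t * INR n)) with (sg * t) by (field; lra).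
        apply Rmult_le_compat_l; [unfold sg; lra|]. unfold t; lra. }
      apply Rabs_le_between in Hd.
      change (alive p (S k + j)) with (step p (alive p (k + j))).
      apply Rle_trans with (step p (v k) (S x)); [apply step_le; [exact Hp|apply IH; lia|apply IH; lia]|].
      assert (Et : t - 1 = s + INR k) by (unfold t; lra). rewrite Et in Hd.
      assert (Ev : step p (v k) (S x) = step p (fun y => F (INR y * INR y / (2 * (s + INR k)))) (S x)
         + e * INR k + sg).
      { rewrite !step_S. unfold v. ring. }
      rewrite Ev. unfold v. fold t. rewrite Hsk. lra. }
  specialize (Hcl (n - j)%nat m ltac:(lia)). replace (n - j + j)%nat with n in Hcl by lia.
  eapply Rle_trans; [exact Hcl|]. unfold v. rewrite minus_INR by exact Hjn.
  assert (H1 : F (INR m * INR m / (2 * (s + (INR n - INR j)))) <= F w1).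
  { apply F_mono.
    assert (Hq : (1 - theta) * INR n <= s + (INR n - INR j)) by lra.
    assert (Hq0 : 0 < (1 - theta) * INR n) by (apply Rmult_lt_0_compat; lra).
    apply Rmult_le_reg_r with (2 * (s + (INR n - INR j))); [lra|].
    unfold Rdiv at 1. rewrite (Rmult_assoc (INR m * INR m)), Rinv_l, Rmult_1_r by lra.
    eapply Rle_trans; [exact Hm|].
    apply Rle_trans with (w1 * (2 * ((1 - theta) * INR n))).
    - apply Req_le. unfold theta. field. lra.
    - apply Rmult_le_compat_l; lra. }
  assert (H2 : e * (INR n - INR j) <= sg).
  { apply Rle_trans with (e * INR n); [apply Rmult_le_compat_l; [lra|]; generalize (pos_INR j); lra|].
    apply Req_le. unfold e. field. lra. }
  unfold sg in *. lra.
Qed.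

End WeakLimit.

(** * Tail asymptotics *)

Lemma lim_flr_sqrt (u : nat -> R) (l : R) :
  is_lim_seq u l -> is_lim_seq (fun n => u (flr (sqrt (INR n)))) l.
Proof.
  intros H. apply lim_eps. intros e He. destruct (proj1 (lim_eps u l) H e He) as [N HN].
  exists (N * N)%nat. intros n Hn. apply HN. apply flr_ge.
  rewrite <- (sqrt_square (INR N)) by apply pos_INR. apply sqrt_le_1_alt.
  rewrite <- mult_INR. now apply le_INR.
Qed.

(** Monotonicity of [f] bounds the drop of [a] over a window by its length times [f] at either end.
    For windows between [m] and [(1 + h) m] or [(1 - h) m] the normalised drop tends to a difference
    quotient of [x^(-kap)] at 1, up to sign, and its derivative there is [- kap]. *)
Lemma monotone_density (a f : nat -> R) (kap : R) (N0 : nat) :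
  (forall m, (N0 <= m)%nat -> 0 < a m) ->
  (forall m, a m - a (S m) = f m) ->
  (forall m, (1 <= m)%nat -> f (S m) <= f m) ->
  (forall c, 0 < c -> is_lim_seq (fun m => a (flr (c * INR m)) / a m) (Rpower c (- kap))) ->
  is_lim_seq (fun m => INR m * f m / a m) kap.
Proof.
  intros Ha Hd Hf Hrv.
  assert (Hmon : forall i j, (1 <= i)%nat -> (i <= j)%nat -> f j <= f i).
  { intros i j Hi Hij. induction Hij as [|j Hij IH]; [lra|]. specialize (Hf j ltac:(lia)). lra. }
  assert (Hge : forall i j, (1 <= i)%nat -> (i <= j)%nat -> (INR j - INR i) * f j <= a i - a j).
  { intros i j Hi Hij. induction Hij as [|j Hij IH]; [lra|].
    rewrite S_INR. specialize (Hf j ltac:(lia)). specialize (Hd j).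
    assert (INR i <= INR j) by (apply le_INR; lia). nra. }
  assert (Hle : forall i j, (1 <= i)%nat -> (i <= j)%nat -> a i - a j <= (INR j - INR i) * f i).
  { intros i j Hi Hij. induction Hij as [|j Hij IH]; [lra|].
    rewrite S_INR. assert (H := Hmon i j Hi Hij). specialize (Hd j). lra. }
  assert (Hder : forall e, 0 < e -> exists h, 0 < h < 1 /\
     Rabs ((Rpower (1 + h) (- kap) - 1) / h - - kap) < e /\
     Rabs ((Rpower (1 + - h) (- kap) - 1) / - h - - kap) < e).
  { intros e He. destruct (derivable_pt_lim_power 1 (- kap) ltac:(lra) e He) as (d & Hdd).
    assert (Hd0 := cond_pos d).
    set (h := Rmin (d / 2) (1 / 2)).
    assert (Hh : 0 < h) by (apply Rmin_glb_lt; lra).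
    assert (Hh1 : h <= d / 2) by apply Rmin_l. assert (Hh2 : h <= 1 / 2) by apply Rmin_r.
    assert (E1 : forall s, Rpower 1 s = 1) by (intros s; unfold Rpower; rewrite ln_1, Rmult_0_r; apply exp_0).
    exists h. split; [lra|]. rewrite !E1 in Hdd. rewrite Rmult_1_r in Hdd. split.
    - apply Hdd; [lra|]. rewrite Rabs_pos_eq; lra.
    - apply Hdd; [lra|]. rewrite Rabs_Ropp, Rabs_pos_eq; lra. }
  assert (Hdiff : forall c, 0 < c -> c <> 1 ->
     is_lim_seq (fun m => (a (flr (c * INR m)) / a m - 1) / (INR (flr (c * INR m)) / INR m - 1))
       ((Rpower c (- kap) - 1) / (c - 1))).
  { intros c Hc Hc1. apply lim_div_fin; [| |lra].
    - apply (is_lim_seq_minus _ _ (Rpower c (- kap)) 1); [now apply Hrv|apply is_lim_seq_const|reflexivity].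
    - apply (is_lim_seq_minus _ _ c 1); [now apply flr_scal_ratio|apply is_lim_seq_const|reflexivity]. }
  apply lim_between; intros e He; destruct (Hder (e / 2)) as (h & Hh & Hp & Hm); try lra.
  (* Upper bound on [f m] from the window that ends at [m]. *)
  - apply Rabs_def2 in Hm.
    assert (Hl := Hdiff (1 + - h) ltac:(lra) ltac:(lra)).
    destruct (ev_gt _ _ (- kap - e) Hl) as [N1 P1].
    { replace (1 + - h - 1) with (- h) by ring. lra. }
    destruct (ev_lt _ _ 1 (flr_scal_ratio (1 + - h) ltac:(lra)) ltac:(lra)) as [N2 P2].
    destruct (proj1 (lim_infty _) (flr_infty _ (lim_scal_INR (1 + - h) ltac:(lra))) 0) as [N3 P3].
    exists (S (N0 + N1 + N2 + N3)). intros m Hm'. specialize (P1 m ltac:(lia)).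
    specialize (P2 m ltac:(lia)). specialize (P3 m ltac:(lia)). cbv beta in P1, P2, P3.
    set (m1 := flr ((1 + - h) * INR m)) in *.
    assert (Hm0 := INR_gt0 m ltac:(lia)). specialize (Ha m ltac:(lia)).
    apply Rmult_lt_compat_r with (r := INR m) in P2; [|lra].
    unfold Rdiv in P2. rewrite Rmult_assoc, Rinv_l, Rmult_1_r, Rmult_1_l in P2 by lra.
    assert (Hm1 : (m1 < m)%nat) by now apply INR_lt.
    assert (Hm2 : (1 <= m1)%nat) by (change 0 with (INR 0) in P3; apply INR_lt in P3; lia).
    specialize (Hge m1 m Hm2 ltac:(lia)).
    replace ((a m1 / a m - 1) / (INR m1 / INR m - 1)) with
      (- ((a m1 - a m) / (INR m - INR m1) * INR m / a m)) in P1 by (field; lra).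
    apply Rle_trans with ((a m1 - a m) / (INR m - INR m1) * INR m / a m); [|lra].
    unfold Rdiv. apply Rmult_le_compat_r; [apply Rlt_le, Rinv_0_lt_compat, Ha|].
    rewrite Rmult_comm. apply Rmult_le_compat_r; [lra|].
    apply Rmult_le_reg_r with (INR m - INR m1); [lra|]. rewrite (Rmult_assoc (a m1 - a m)), Rinv_l by lra. lra.
  (* Lower bound on [f m] from the window that starts at [m]. *)
  - apply Rabs_def2 in Hp.
    assert (Hl := Hdiff (1 + h) ltac:(lra) ltac:(lra)).
    destruct (ev_lt _ _ (- kap + e) Hl) as [N1 P1].
    { replace (1 + h - 1) with h by ring. lra. }
    destruct (ev_gt _ _ 1 (flr_scal_ratio (1 + h) ltac:(lra)) ltac:(lra)) as [N2 P2].
    exists (S (N0 + N1 + N2)). intros m Hm'. specialize (P1 m ltac:(lia)).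
    specialize (P2 m ltac:(lia)). cbv beta in P1, P2.
    set (m1 := flr ((1 + h) * INR m)) in *.
    assert (Hm0 := INR_gt0 m ltac:(lia)). specialize (Ha m ltac:(lia)).
    apply Rmult_lt_compat_r with (r := INR m) in P2; [|lra].
    unfold Rdiv in P2. rewrite (Rmult_assoc (INR m1)), Rinv_l, Rmult_1_r, Rmult_1_l in P2 by lra.
    assert (Hm1 : (m < m1)%nat) by now apply INR_lt.
    specialize (Hle m m1 ltac:(lia) ltac:(lia)).
    replace ((a m1 / a m - 1) / (INR m1 / INR m - 1)) with
      (- ((a m - a m1) / (INR m1 - INR m) * INR m / a m)) in P1 by (field; lra).
    apply Rle_trans with ((a m - a m1) / (INR m1 - INR m) * INR m / a m); [lra|].
    unfold Rdiv. apply Rmult_le_compat_r; [apply Rlt_le, Rinv_0_lt_compat, Ha|].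
    rewrite (Rmult_comm (INR m)). apply Rmult_le_compat_r; [lra|].
    apply Rmult_le_reg_r with (INR m1 - INR m); [lra|]. rewrite (Rmult_assoc (a m - a m1)), Rinv_l by lra. lra.
Qed.

(** * Reduction to a start at height of order sqrt n *)

Section Tail.
Variables (p : nat -> R) (delta : R).
Hypothesis HR : is_lim_seq (fun x => INR x * Rerr p delta x) 0.
Variable eps0 : R.
Hypothesis Heps0 : 0 < eps0.
Hypothesis Hell : forall x, (1 <= x)%nat -> eps0 <= p x <= 1 - eps0.
Hypothesis HM : is_lim_seq (scaleM p) p_infty.
Let kap := (1 + delta) / 2.
Let Hp := p_bounds p eps0 Heps0 Hell.

Lemma Mq_scal_ratio c : 0 < c -> is_lim_seq (fun n => Mq p (INR n) / Mq p (c * INR n)) (Rpower c (- kap)).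
Proof.
  intros Hc. replace (Rpower c (- kap)) with (Rpower (/ c) kap).
  - apply (Mq_ratio p delta HR eps0 Heps0 Hell HM (fun n => c * INR n) INR); [now apply Rinv_0_lt_compat|now apply lim_scal_INR|].
    apply (lim_ext_from 1 (fun _ => / c)); [|apply is_lim_seq_const].
    intros n Hn. generalize (INR_gt0 n Hn). intros. field. lra.
  - unfold Rpower. rewrite ln_Rinv by exact Hc. f_equal. ring.
Qed.

Lemma Mq_equiv (x : nat -> R) : is_lim_seq (fun n => x n / INR n) 1 ->
  is_lim_seq (fun n => Mq p (INR n) / Mq p (x n)) 1.
Proof.
  intros Hx. assert (H := infty_of_ratio x INR 1 ltac:(lra) is_lim_seq_INR Hx).
  replace (Finite 1) with (Finite (Rpower 1 kap)) by (unfold Rpower; rewrite ln_1, Rmult_0_r, exp_0; reflexivity).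
  apply (Mq_ratio p delta HR eps0 Heps0 Hell HM x INR); [lra|exact H|].
  apply (is_lim_seq_ext (fun n => / (x n / INR n))); [intros; apply Rinv_div|].
  apply (lim_val _ (1 / 1)); [field|].
  apply (is_lim_seq_ext (fun n => 1 / (x n / INR n))); [intros; unfold Rdiv; ring|].
  apply lim_div_fin; [apply is_lim_seq_const|exact Hx|lra].
Qed.

(** Two blocks of about [theta n] steps are set aside for leaving (0,m). Staying inside costs a
    factor O(eps) for the second block, times the survival probability over the first, which
    [alive_crude] controls; hence the error O(eps) after normalisation. [Ct] depends on [theta] but
    not on [eps], so [eps] can be chosen afterwards. *)
Lemma tail_decomposition theta : 0 < theta < 1 / 2 -> exists Ct, 0 < Ct /\ forall eps, 0 < eps ->
  exists N, forall n, (N <= n)%nat -> Mq p (INR n) * alive p n 1 <=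
    Mq p (INR n) / Mq p (eps * INR n) * alive p (n - 2 * flr (theta * INR n)) (flr (sqrt (eps * INR n)))
    + Ct * eps.
Proof.
  intros Hth.
  destruct (exit_time_bound p delta HR eps0 Heps0 Hell HM) as (C & HC & Hexit).
  destruct (alive_crude p delta HR eps0 Heps0 Hell HM) as (C2 & HC2 & Hcrude).
  set (Lam := Rpower theta (- kap) + 1).
  assert (HLam : 0 < Lam) by (unfold Lam; generalize (Rpower_pos theta (- kap)); lra).
  exists (2 * C / theta * Lam * C2). split.
  { repeat apply Rmult_lt_0_compat; try lra. apply Rinv_0_lt_compat; lra. }
  intros eps Heps.
  set (h := fun n => flr (theta * INR n)).
  assert (Hh := flr_scal_ratio theta ltac:(lra)). fold h in Hh.
  assert (Hhinf : is_lim_seq (fun n => INR (h n)) p_infty) by (apply flr_infty, lim_scal_INR; lra).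
  assert (HLr : is_lim_seq (fun n => Mq p (INR n) / Mq p (INR (h n))) (Rpower theta (- kap))).
  { replace (Rpower theta (- kap)) with (Rpower (/ theta) kap)
      by (unfold Rpower; rewrite ln_Rinv by lra; f_equal; ring).
    apply (Mq_ratio p delta HR eps0 Heps0 Hell HM (fun n => INR (h n)) INR); [apply Rinv_0_lt_compat; lra|exact Hhinf|].
    apply (is_lim_seq_ext (fun n => / (INR (h n) / INR n))); [intros; apply Rinv_div|].
    apply (is_lim_seq_inv _ theta); [exact Hh|]. intros E. inversion E. lra. }
  destruct (ev_lt _ _ Lam HLr) as [N1 P1]; [unfold Lam; lra|].
  destruct (ev_gt _ _ (theta / 2) Hh) as [N2 P2]; [lra|].
  destruct (proj1 (lim_infty _) (lim_scal_INR eps Heps) 1) as [N3 P3].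
  destruct (proj1 (lim_infty _) Hhinf 1) as [N4 P4].
  exists (S (N1 + N2 + N3 + N4)). intros n Hn.
  specialize (P1 n ltac:(lia)). specialize (P2 n ltac:(lia)).
  specialize (P3 n ltac:(lia)). specialize (P4 n ltac:(lia)). cbv beta in P1, P2, P3, P4.
  assert (Hn0 := INR_gt0 n ltac:(lia)). assert (Hn1 : 1 <= INR n) by (apply (le_INR 1); lia).
  fold (h n). set (k := h n) in *.
  assert (Hk : theta / 2 * INR n < INR k).
  { apply Rmult_lt_compat_r with (r := INR n) in P2; [|exact Hn0].
    unfold Rdiv in P2. rewrite (Rmult_assoc (INR k)), Rinv_l, Rmult_1_r in P2 by lra. exact P2. }
  destruct (flr_bounds (theta * INR n)) as [Hk1 _]; [apply Rmult_le_pos; lra|]. fold (h n) in Hk1. fold k in Hk1.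
  assert (H2k : (2 * k <= n)%nat).
  { apply INR_le. rewrite mult_INR. change (INR 2) with 2. nra. }
  set (m := flr (sqrt (eps * INR n))).
  assert (Hm : (1 <= m)%nat) by (apply flr_sqrt_pos; lra).
  assert (Hm2 : INR m * INR m <= eps * INR n) by (apply flr_sqrt_sq; lra).
  assert (Hk0 : 0 < INR k) by lra.
  assert (Hs : forall y, confined p m k y <= 2 * C / theta * eps).
  { assert (0 < C * eps) by now apply Rmult_lt_0_compat.
    intros y. destruct (Nat.le_gt_cases y m) as [Hy|Hy].
    - specialize (Hexit m k y Hy).
      apply Rmult_le_reg_l with (INR k); [exact Hk0|]. eapply Rle_trans; [exact Hexit|].
      apply Rle_trans with (C * (eps * INR n)); [apply Rmult_le_compat_l; lra|].
      replace (C * (eps * INR n)) with (theta / 2 * INR n * (2 * C / theta * eps)) by (field; lra).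
      apply Rmult_le_compat_r; [|lra]. apply Rlt_le. repeat apply Rmult_lt_0_compat; try lra.
      apply Rinv_0_lt_compat; lra.
    - rewrite confined_out by lia. apply Rlt_le. repeat apply Rmult_lt_0_compat; try lra.
      apply Rinv_0_lt_compat; lra. }
  assert (Hc := confined_split p Hp m k k _ 1 Hs).
  destruct (confined_le_alive p Hp m k 1) as [_ Hca].
  assert (Hu := alive_upper p Hp m (n - 2 * k) (k + k) 1 Hm Hm).
  replace (k + k + (n - 2 * k))%nat with n in Hu by lia.
  replace (scaleM p 1) with 1 in Hu by (simpl; ring).
  assert (HMm : 0 < scaleM p m) by (now apply scaleM_pos).
  assert (HMn : 0 < Mq p (INR n)) by (apply (Mq_pos p eps0 Heps0 Hell); lra).
  assert (HMk : 0 < Mq p (INR k)) by (apply (Mq_pos p eps0 Heps0 Hell); lra).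
  change (Mq p (eps * INR n)) with (scaleM p m).
  set (s := 2 * C / theta * eps) in *.
  assert (Hs0 : 0 <= s) by (unfold s; apply Rmult_le_pos; [apply Rdiv_le_0_compat; lra|lra]).
  assert (Hu2 : alive p n 1 <= 1 / scaleM p m * alive p (n - 2 * k) m + s * alive p k 1).
  { assert (s * confined p m k 1 <= s * alive p k 1) by (apply Rmult_le_compat_l; lra). lra. }
  apply Rmult_le_compat_l with (r := Mq p (INR n)) in Hu2; [|lra].
  eapply Rle_trans; [exact Hu2|]. rewrite Rmult_plus_distr_l. apply Rplus_le_compat.
  - apply Req_le. field. lra.
  - replace (Mq p (INR n) * (s * alive p k 1)) with
      (s * (Mq p (INR n) / Mq p (INR k) * (Mq p (INR k) * alive p k 1))) by (field; lra).
    replace (2 * C / theta * Lam * C2 * eps) with (s * (Lam * C2)) by (unfold s; field; lra).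
    apply Rmult_le_compat_l; [exact Hs0|].
    apply Rmult_le_compat; [apply Rdiv_le_0_compat; lra| |lra|apply Hcrude].
    apply Rmult_le_pos; [lra|]. apply (alive_bounds p Hp).
Qed.

Lemma tail_lower eps n : 1 <= eps * INR n ->
  Mq p (INR n) / Mq p (eps * INR n) * alive p n (flr (sqrt (eps * INR n))) <= Mq p (INR n) * alive p n 1.
Proof.
  intros H. set (m := flr (sqrt (eps * INR n))).
  assert (Hm : (1 <= m)%nat) by now apply flr_sqrt_pos.
  assert (Hl := alive_lower p Hp m n 1 Hm Hm). replace (scaleM p 1) with 1 in Hl by (simpl; ring).
  assert (HMm : 0 < scaleM p m) by (now apply scaleM_pos).
  change (Mq p (eps * INR n)) with (scaleM p m).
  replace (Mq p (INR n) / scaleM p m * alive p n m) with (Mq p (INR n) * (1 / scaleM p m * alive p n m)) by (field; lra).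
  apply Rmult_le_compat_l; [|exact Hl]. apply scaleM_nonneg. exact Hp.
Qed.

Lemma ret_ge_alive n : ret_ge p (S (S n)) = alive p n 1.
Proof. apply survive_alive. Qed.

Lemma ret_ge_limit (l : R) : is_lim_seq (fun n => Mq p (INR n) * alive p n 1) l ->
  is_lim_seq (fun n => Mq p (INR n) * ret_ge p n) l.
Proof.
  intros H. apply (is_lim_seq_incr_n _ 2).
  assert (Hx : is_lim_seq (fun n => INR (n + 2) / INR n) 1).
  { apply (lim_val _ (1 + 2 * 0)); [ring|].
    apply (lim_ext_from 1 (fun n => 1 + 2 * / INR n)).
    - intros n Hn. generalize (INR_gt0 n Hn). intros. rewrite plus_INR. change (INR 2) with 2. field. lra.
    - apply lim_plus_fin; [apply is_lim_seq_const|]. apply lim_scal, lim_inv_infty, is_lim_seq_INR. }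
  assert (H1 := Mq_equiv _ Hx).
  apply (lim_val _ (l / 1)); [field|].
  apply (lim_ext_from 1 (fun n => Mq p (INR n) * alive p n 1 / (Mq p (INR n) / Mq p (INR (n + 2))))).
  - intros n Hn. replace (n + 2)%nat with (S (S n)) by lia. rewrite ret_ge_alive by exact Hp.
    assert (0 < Mq p (INR n)) by (apply (Mq_pos p eps0 Heps0 Hell); apply (le_INR 1); lia).
    assert (0 < Mq p (INR (S (S n)))) by (apply (Mq_pos p eps0 Heps0 Hell); apply (le_INR 1); lia).
    field. lra.
  - now apply lim_div_fin; [|exact H1|lra].
Qed.

(** Interpolation runs between consecutive values of [Lnat], whose ratio tends to 1 by slow
    variation. *)
Lemma Lint_equiv (x : nat -> R) : is_lim_seq x p_infty ->
  is_lim_seq (fun n => Lint p delta (x n) / Lnat p delta (flr (x n))) 1.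
Proof.
  intros Hx.
  assert (Hrv := Lnat_regvar p delta HR).
  assert (H1 : is_lim_seq (fun k => Rabs (Lnat p delta (S k) / Lnat p delta k - 1)) 0).
  { replace (Finite 0) with (Rbar_abs 0) by (simpl; now rewrite Rabs_R0). apply is_lim_seq_abs.
    apply (lim_val _ (0 * 0)); [ring|].
    apply (lim_ext_from 1 (fun n => INR n * (Lnat p delta (S n) / Lnat p delta n - 1) * / INR n)).
    - intros n Hn. generalize (INR_gt0 n Hn) (Lnat_pos p delta n). intros. field. lra.
    - apply lim_mult_fin; [apply Hrv|]. apply lim_inv_infty, is_lim_seq_INR. }
  apply lim_eps. intros e He. destruct (proj1 (lim_eps _ _) H1 e He) as [K HK].
  destruct (proj1 (lim_infty _) Hx (INR K)) as [N HN]. exists N. intros n Hn.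
  specialize (HN n Hn). assert (Hx0 : 0 <= x n) by (generalize (pos_INR K); lra).
  destruct (flr_bounds (x n) Hx0) as [Hf1 Hf2].
  unfold Lint. change (Z.to_nat (Int_part (x n))) with (flr (x n)). cbv zeta.
  set (k := flr (x n)) in *. assert (Hk : (K <= k)%nat) by (apply flr_ge; lra).
  specialize (HK k Hk). rewrite Rminus_0_r, Rabs_Rabsolu in HK.
  assert (HL := Lnat_pos p delta k).
  replace ((Lnat p delta k + (x n - INR k) * (Lnat p delta (S k) - Lnat p delta k)) / Lnat p delta k - 1)
    with ((x n - INR k) * (Lnat p delta (S k) / Lnat p delta k - 1)) by (field; lra).
  rewrite Rabs_mult, (Rabs_pos_eq (x n - INR k)) by lra.
  set (z := Rabs _) in *. assert (0 <= z) by apply Rabs_pos. nra.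
Qed.

End Tail.

(** * The case kappa > 0 *)

Section MainA.
Variables (p : nat -> R) (delta : R).
Hypothesis Hdelta : -1 < delta.
Hypothesis HR : is_lim_seq (fun x => INR x * Rerr p delta x) 0.
Variable eps0 : R.
Hypothesis Heps0 : 0 < eps0.
Hypothesis Hell : forall x, (1 <= x)%nat -> eps0 <= p x <= 1 - eps0.
Let kap := (1 + delta) / 2.
Let Hkap : 0 < kap.
Proof. unfold kap. lra. Qed.
Let Hp := p_bounds p eps0 Heps0 Hell.
Let HM := scaleM_infty p delta Hdelta HR eps0 Heps0 Hell.

Lemma Rpower_mult_base (x y s : R) : 0 < x -> 0 < y -> Rpower (x * y) s = Rpower x s * Rpower y s.
Proof. intros. symmetry. now apply Rpower_mult_distr. Qed.

(** With [m^2] about [eps n], the normalised factor [1 / M m] tends to [eps^(-kap)] and survival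
    from [m] has probability about [F (eps / 2)], so the limit is that of [eps^(-kap) F (eps / 2)]
    as [eps] tends to 0. *)
Lemma tail_limit :
  is_lim_seq (fun n => Mq p (INR n) * alive p n 1) (Rpower 2 (- kap) / (kap * Gamma kap)).
Proof.
  destruct (gamma_cdf kap Hkap) as (HG & F & F1 & F2 & F3 & F4 & F5 & F6).
  set (G := Gamma kap) in *.
  assert (HkG : 0 < kap * G) by now apply Rmult_lt_0_compat.
  apply lim_between; intros tau Htau.
  (* [theta] is fixed before [eps]: [2 theta] is the share of time set aside by
     [tail_decomposition], and a third [theta] gives the strict inequality [w0 < w1]. The upper
     bound on [F] holds for all [w], so [eps] need only make [Ct eps] small. *)
  - assert (Hth : exists theta, 0 < theta < 1 / 3 /\
      Rpower (/ (2 * (1 - 3 * theta))) kap / (kap * G) <= Rpower 2 (- kap) / (kap * G) + tau / 4).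
    { assert (H : is_lim_seq (fun n => Rpower (/ (2 * (1 + -3 * / (INR n + 4)))) kap / (kap * G))
        (Rpower (/ (2 * (1 + -3 * 0))) kap / (kap * G))).
      { apply lim_div_fin; [|apply is_lim_seq_const|lra]. apply lim_Rpower; [apply Rinv_0_lt_compat; lra|].
        apply (is_lim_seq_inv _ (2 * (1 + -3 * 0))); [|intros E; inversion E; lra].
        apply lim_scal, lim_plus_fin; [apply is_lim_seq_const|]. apply lim_scal, lim_small_inv. lra. }
      destruct (ev_lt _ _ (Rpower 2 (- kap) / (kap * G) + tau / 4) H) as [N HN].
      { replace (Rpower (/ (2 * (1 + -3 * 0))) kap) with (Rpower 2 (- kap)); [lra|].
        replace (2 * (1 + -3 * 0)) with 2 by ring. unfold Rpower. rewrite ln_Rinv by lra. f_equal. ring. }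
      exists (/ (INR N + 4)). assert (HN0 := pos_INR N). split.
      - split; [apply Rinv_0_lt_compat; lra|]. unfold Rdiv. rewrite Rmult_1_l. apply Rinv_lt_contravar; lra.
      - specialize (HN N (Nat.le_refl N)). cbv beta in HN.
        replace (1 - 3 * / (INR N + 4)) with (1 + -3 * / (INR N + 4)) by ring. lra. }
    destruct Hth as (theta & Hth & Hpow).
    destruct (tail_decomposition p delta HR eps0 Heps0 Hell HM theta ltac:(lra)) as (Ct & HCt & Hdec).
    set (eps := tau / (4 * Ct)). assert (Heps : 0 < eps) by (apply Rdiv_lt_0_compat; lra).
    destruct (Hdec eps Heps) as [N1 P1].
    (* The tolerance carries [eps^kap] because it will be multiplied by the limit [eps^(-kap)]. *)
    set (tau' := tau / 4 * Rpower eps kap). assert (Htau' : 0 < tau') by (apply Rmult_lt_0_compat; [lra|apply Rpower_pos]).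
    set (w0 := eps / (2 * (1 - 2 * theta))). set (w1 := eps / (2 * (1 - 3 * theta))).
    assert (Hw0 : 0 < w0) by (apply Rdiv_lt_0_compat; lra).
    assert (Hw01 : w0 < w1).
    { unfold w0, w1, Rdiv. apply Rmult_lt_compat_l; [lra|]. apply Rinv_lt_contravar; [|lra].
      apply Rmult_lt_0_compat; lra. }
    destruct (alive_le_cdf p delta Hdelta HR eps0 Heps0 Hell F G F2 F3 F4 F5 w0 w1 tau' Hw0 Hw01 Htau') as [N2 P2].
    set (V := Rpower eps (- kap) * (F w1 + tau')).
    assert (HV : is_lim_seq (fun n => Mq p (INR n) / Mq p (eps * INR n) * (F w1 + tau')) V).
    { apply lim_mult_fin; [|apply is_lim_seq_const]. now apply (Mq_scal_ratio p delta HR eps0 Heps0 Hell HM). }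
    destruct (ev_lt _ _ (V + tau / 4) HV) as [N3 P3]; [lra|].
    destruct (proj1 (lim_infty _) (lim_scal_INR (1 - 2 * theta) ltac:(lra)) (INR N2)) as [N4 P4].
    destruct (proj1 (lim_infty _) (lim_scal_INR eps Heps) 1) as [N5 P5].
    exists (S (N1 + N3 + N4 + N5)). intros n Hn. specialize (P1 n ltac:(lia)). specialize (P3 n ltac:(lia)).
    specialize (P4 n ltac:(lia)). specialize (P5 n ltac:(lia)). cbv beta in P3, P4, P5.
    assert (Hn1 : 1 <= INR n) by (apply (le_INR 1); lia).
    eapply Rle_trans; [exact P1|].
    set (k := flr (theta * INR n)) in *.
    destruct (flr_bounds (theta * INR n)) as [Hk1 _]; [apply Rmult_le_pos; lra|]. fold k in Hk1.
    assert (H2k : (2 * k <= n)%nat) by (apply INR_le; rewrite mult_INR; change (INR 2) with 2; nra).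
    assert (Hnk : (1 - 2 * theta) * INR n <= INR (n - 2 * k)).
    { rewrite minus_INR by exact H2k. rewrite mult_INR. change (INR 2) with 2. nra. }
    assert (Hm2 := flr_sqrt_sq (eps * INR n) ltac:(lra)).
    set (m := flr (sqrt (eps * INR n))) in *.
    assert (Hal : alive p (n - 2 * k) m <= F w1 + tau').
    { apply P2.
      - apply INR_le. lra.
      - eapply Rle_trans; [exact Hm2|].
        replace (eps * INR n) with (2 * w0 * ((1 - 2 * theta) * INR n)) by (unfold w0; field; lra).
        apply Rmult_le_compat_l; lra. }
    assert (HMr : 0 <= Mq p (INR n) / Mq p (eps * INR n)).
    { apply Rdiv_le_0_compat; [now apply scaleM_nonneg|]. apply (Mq_pos p eps0 Heps0 Hell). lra. }
    assert (HVb : V <= Rpower (/ (2 * (1 - 3 * theta))) kap / (kap * G) + tau / 4).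
    { unfold V. destruct (F6 w1 ltac:(lra)) as [_ HFw].
      assert (E1 : Rpower eps (- kap) * Rpower eps kap = 1) by (rewrite <- Rpower_plus, Rplus_opp_l; apply Rpower_O; lra).
      replace (Rpower w1 kap) with (Rpower eps kap * Rpower (/ (2 * (1 - 3 * theta))) kap) in HFw
        by (unfold w1, Rdiv; rewrite Rpower_mult_base; [reflexivity|lra|apply Rinv_0_lt_compat; lra]).
      assert (Hq := Rpower_pos eps (- kap)).
      apply Rle_trans with (Rpower eps (- kap) *
        (Rpower eps kap * Rpower (/ (2 * (1 - 3 * theta))) kap / (kap * G) + tau')).
      - apply Rmult_le_compat_l; lra.
      - apply Req_le. unfold tau'.
        transitivity (Rpower eps (- kap) * Rpower eps kap * (Rpower (/ (2 * (1 - 3 * theta))) kap / (kap * G) + tau / 4)).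
        + field. split; lra.
        + rewrite E1. ring. }
    assert (HCe : Ct * eps = tau / 4) by (unfold eps; field; lra).
    apply Rle_trans with (Mq p (INR n) / Mq p (eps * INR n) * (F w1 + tau') + Ct * eps).
    + apply Rplus_le_compat_r. now apply Rmult_le_compat_l.
    + lra.
  (* Here [eps] itself must be small: the lower bound on [F] has the factor [exp (- w)], and
     [1 - 2 eps] absorbs the floor in [m] and a strict inequality. *)
  - assert (Hep : exists eps, 0 < eps < 1 / 2 /\
      Rpower 2 (- kap) / (kap * G) - tau / 2 <= exp (- eps) * Rpower ((1 - 2 * eps) / 2) kap / (kap * G)).
    { assert (H : is_lim_seq (fun n => exp (- / (INR n + 4)) * Rpower ((1 + -2 * / (INR n + 4)) / 2) kap / (kap * G))
        (exp (- 0) * Rpower ((1 + -2 * 0) / 2) kap / (kap * G))).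
      { apply lim_div_fin; [|apply is_lim_seq_const|lra]. apply lim_mult_fin.
        - apply (is_lim_seq_continuous exp).
          + apply derivable_continuous_pt, derivable_pt_exp.
          + apply (is_lim_seq_opp _ 0), lim_small_inv. lra.
        - apply lim_Rpower; [lra|]. apply lim_div_fin; [|apply is_lim_seq_const|lra].
          apply lim_plus_fin; [apply is_lim_seq_const|]. apply lim_scal, lim_small_inv. lra. }
      destruct (ev_gt _ _ (Rpower 2 (- kap) / (kap * G) - tau / 2) H) as [N HN].
      { rewrite Ropp_0, exp_0, Rmult_1_l.
        replace (Rpower ((1 + -2 * 0) / 2) kap) with (Rpower 2 (- kap)); [lra|].
        replace ((1 + -2 * 0) / 2) with (/ 2) by field. unfold Rpower. rewrite ln_Rinv by lra. f_equal. ring. }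
      exists (/ (INR N + 4)). assert (HN0 := pos_INR N). split.
      - split; [apply Rinv_0_lt_compat; lra|]. unfold Rdiv. rewrite Rmult_1_l. apply Rinv_lt_contravar; lra.
      - specialize (HN N (Nat.le_refl N)). cbv beta in HN.
        replace (1 - 2 * / (INR N + 4)) with (1 + -2 * / (INR N + 4)) by ring. lra. }
    destruct Hep as (eps & Heps & Hpow).
    set (tau' := tau / 4 * Rpower eps kap). assert (Htau' : 0 < tau') by (apply Rmult_lt_0_compat; [lra|apply Rpower_pos]).
    (* The floor in [m] costs at most a factor [1 - eps] in [m^2], which gives [w0]; [w1] is lowered
       once more to be strictly smaller. *)
    set (w0 := eps * (1 - eps) / 2). set (w1 := eps * ((1 - 2 * eps) / 2)).
    assert (Hw1 : 0 < w1) by (unfold w1; apply Rmult_lt_0_compat; lra).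
    assert (Hw01 : w1 < w0) by (unfold w0, w1; nra).
    destruct (alive_ge_cdf p delta Hdelta HR eps0 Heps0 Hell F G HG F1 F2 F3 F4 F6 w0 w1 (eps / 2) tau' Hw1 Hw01 Htau') as [N1 P1].
    set (V := Rpower eps (- kap) * (F w1 - tau')).
    assert (HV : is_lim_seq (fun n => Mq p (INR n) / Mq p (eps * INR n) * (F w1 - tau')) V).
    { apply lim_mult_fin; [|apply is_lim_seq_const]. apply (Mq_scal_ratio p delta HR eps0 Heps0 Hell HM). lra. }
    destruct (ev_gt _ _ (V - tau / 4) HV) as [N2 P2]; [lra|].
    destruct (proj1 (lim_infty _) (lim_scal_INR eps ltac:(lra)) 1) as [N3 P3].
    assert (Hm : is_lim_seq (fun n => INR (flr (sqrt (eps * INR n))) / sqrt (eps * INR n)) 1)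
      by (apply flr_equiv, sqrt_infty, lim_scal_INR; lra).
    destruct (ev_gt _ _ (1 - eps / 2) Hm) as [N4 P4]; [lra|].
    exists (S (N1 + N2 + N3 + N4)). intros n Hn. specialize (P2 n ltac:(lia)).
    specialize (P3 n ltac:(lia)). specialize (P4 n ltac:(lia)). cbv beta in P2, P3, P4.
    assert (Hn1 : 1 <= INR n) by (apply (le_INR 1); lia).
    eapply Rle_trans; [|apply (tail_lower p eps0 Heps0 Hell eps n); lra].
    assert (Hm2 := flr_sqrt_sq (eps * INR n) ltac:(lra)).
    set (m := flr (sqrt (eps * INR n))) in *.
    assert (Hsq : 0 < sqrt (eps * INR n)) by (apply sqrt_lt_R0; lra).
    assert (Hss := sqrt_sqrt (eps * INR n) ltac:(lra)).
    set (sq := sqrt (eps * INR n)) in *.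
    apply Rmult_lt_compat_r with (r := sq) in P4; [|exact Hsq].
    unfold Rdiv in P4. rewrite (Rmult_assoc (INR m)), Rinv_l, Rmult_1_r in P4 by lra.
    assert (Hm3 : 2 * w0 * INR n <= INR m * INR m).
    { apply Rle_trans with (((1 - eps * / 2) * sq) * ((1 - eps * / 2) * sq)).
      - replace ((1 - eps * / 2) * sq * ((1 - eps * / 2) * sq)) with ((1 - eps * / 2) * (1 - eps * / 2) * (sq * sq)) by ring.
        rewrite Hss. replace (2 * w0 * INR n) with ((1 - eps) * (eps * INR n)) by (unfold w0; field).
        apply Rmult_le_compat_r; [lra|]. nra.
      - assert (0 < (1 - eps * / 2) * sq) by (apply Rmult_lt_0_compat; lra). apply Rmult_le_compat; lra. }
    assert (Hal : F w1 - tau' <= alive p n m).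
    { apply P1; [lia|]. split; [exact Hm3|]. lra. }
    assert (HMr : 0 <= Mq p (INR n) / Mq p (eps * INR n)).
    { apply Rdiv_le_0_compat; [now apply scaleM_nonneg|]. apply (Mq_pos p eps0 Heps0 Hell). lra. }
    assert (HVb : exp (- eps) * Rpower ((1 - 2 * eps) / 2) kap / (kap * G) - tau / 4 <= V).
    { unfold V. destruct (F6 w1 Hw1) as [HFw _].
      assert (E1 : Rpower eps (- kap) * Rpower eps kap = 1) by (rewrite <- Rpower_plus, Rplus_opp_l; apply Rpower_O; lra).
      replace (Rpower w1 kap) with (Rpower eps kap * Rpower ((1 - 2 * eps) / 2) kap) in HFw
        by (unfold w1; rewrite Rpower_mult_base by lra; reflexivity).
      assert (Hq := Rpower_pos eps (- kap)).
      assert (He : exp (- eps) <= exp (- w1)) by (apply exp_le; unfold w1; nra).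
      set (A := Rpower ((1 - 2 * eps) / 2) kap) in *. assert (HA : 0 < A) by apply Rpower_pos.
      assert (Hqe := Rpower_pos eps kap).
      apply Rle_trans with (Rpower eps (- kap) * (exp (- eps) * (Rpower eps kap * A) / (kap * G) - tau')).
      - apply Req_le. unfold tau'.
        transitivity (Rpower eps (- kap) * Rpower eps kap * (exp (- eps) * A / (kap * G) - tau / 4)).
        + rewrite E1. ring.
        + field. split; lra.
      - apply Rmult_le_compat_l; [lra|]. apply Rplus_le_compat_r.
        eapply Rle_trans; [|exact HFw]. apply Rmult_le_compat_r; [apply Rlt_le, Rinv_0_lt_compat; lra|].
        apply Rmult_le_compat_r; [|exact He]. apply Rlt_le, Rmult_lt_0_compat; assumption. }
    apply Rle_trans with (Mq p (INR n) / Mq p (eps * INR n) * (F w1 - tau')); [lra|].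
    now apply Rmult_le_compat_l.
Qed.

Variable K0 : R.
Hypothesis HK0 : 0 < K0.
Hypothesis Hasy : asymp (lambda p) (fun x => K0 * Rpower (INR x) (2 * kap - 1) / Lnat p delta x).

(** By Karamata's theorem [M r] is equivalent to [r lambda r / (2 kap)]. Then [r] is the floor of
    [sqrt n], which is replaced by [sqrt n] in the power and in [L]. *)
Lemma Mq_asymp :
  is_lim_seq (fun n => Mq p (INR n) * Rpower (INR n) (- kap) * Lint p delta (sqrt (INR n))) (K0 / (2 * kap)).
Proof.
  assert (H1 : is_lim_seq (fun r => scaleM p r * Lnat p delta r / Rpower (INR r) (2 * kap)) (K0 / (2 * kap))).
  { apply (lim_val _ (1 * K0 / (1 + delta))); [unfold kap; field; lra|].
    apply (lim_ext_from 1 (fun r => lambda p r / (K0 * Rpower (INR r) (2 * kap - 1) / Lnat p delta r) * K0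
      / (INR r * lambda p r / scaleM p r))).
    - intros r Hr. assert (Hr0 := INR_gt0 r Hr). assert (Hl := lambda_pos p Hp r).
      assert (HMr := scaleM_pos p Hp r Hr). assert (HL := Lnat_pos p delta r).
      assert (HRp := Rpower_pos (INR r) (2 * kap)).
      rewrite Rpower_pred by exact Hr0. field. repeat split; lra.
    - apply lim_div_fin; [|apply (scaleM_lambda p delta HR eps0 Heps0 Hell HM)|lra].
      apply lim_mult_fin; [exact Hasy|apply is_lim_seq_const]. }
  apply lim_flr_sqrt in H1.
  assert (Hs := sqrt_infty INR is_lim_seq_INR).
  assert (H2 := Lint_equiv p delta HR _ Hs).
  assert (H3 := lim_Rpower _ 1 (2 * kap) ltac:(lra) (flr_equiv _ Hs)).
  replace (Rpower 1 (2 * kap)) with 1 in H3 by (unfold Rpower; rewrite ln_1, Rmult_0_r, exp_0; reflexivity).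
  apply (lim_val _ (K0 / (2 * kap) * 1 * 1)); [ring|].
  refine (lim_ext_from 1 _ _ _ _ (lim_mult_fin _ _ _ _ (lim_mult_fin _ _ _ _ H1 H2) H3)).
  intros n Hn. cbv beta. assert (Hn1 : 1 <= INR n) by (apply (le_INR 1); lia).
  assert (Hr := INR_gt0 _ (flr_sqrt_pos (INR n) Hn1)).
  unfold Mq. set (r := flr (sqrt (INR n))) in *.
  assert (Hsq : 0 < sqrt (INR n)) by (apply sqrt_lt_R0; lra).
  assert (HL := Lnat_pos p delta r).
  assert (E : Rpower (INR r / sqrt (INR n)) (2 * kap) = Rpower (INR r) (2 * kap) * Rpower (INR n) (- kap)).
  { unfold Rdiv. rewrite Rpower_mult_base by (try apply Rinv_0_lt_compat; lra). f_equal.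
    rewrite <- sqrt_inv, Rpower_sqrt_base by (apply Rinv_0_lt_compat; lra).
    unfold Rpower. rewrite ln_Rinv by lra. f_equal. field. }
  rewrite E. assert (Hrp := Rpower_pos (INR r) (2 * kap)). field. split; lra.
Qed.

Lemma ret_ge_asymp : asymp (ret_ge p)
  (fun n => Rpower 2 (1 - kap) / (K0 * Gamma kap) * Rpower (INR n) (- kap) * Lint p delta (sqrt (INR n))).
Proof.
  destruct (gamma_cdf kap Hkap) as (HG & _).
  assert (H1 := ret_ge_limit p delta HR eps0 Heps0 Hell HM _ tail_limit).
  assert (H2 := Mq_asymp).
  assert (Hc : Rpower 2 (1 - kap) = 2 * Rpower 2 (- kap)).
  { unfold Rminus. rewrite Rpower_plus, Rpower_1 by lra. reflexivity. }
  assert (Hr := Rpower_pos 2 (- kap)).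
  unfold asymp.
  apply (lim_val _ (Rpower 2 (- kap) / (kap * Gamma kap) / (Rpower 2 (1 - kap) / (K0 * Gamma kap) * (K0 / (2 * kap))))).
  { rewrite Hc. field. repeat split; lra. }
  assert (H3 := lim_scal _ (Rpower 2 (1 - kap) / (K0 * Gamma kap)) _ H2).
  assert (Hpos : 0 < Rpower 2 (1 - kap) / (K0 * Gamma kap) * (K0 / (2 * kap))).
  { apply Rmult_lt_0_compat; apply Rdiv_lt_0_compat; try lra; try (now apply Rmult_lt_0_compat); apply Rpower_pos. }
  destruct (ev_gt _ _ 0 H3 Hpos) as [N HN].
  assert (Hq := lim_div_fin _ _ _ _ H1 H3 (not_eq_sym (Rlt_not_eq _ _ Hpos))).
  refine (lim_ext_from (S N) _ _ _ _ Hq).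
  intros n Hn. cbv beta. specialize (HN n ltac:(lia)). cbv beta in HN.
  assert (HMn : 0 < Mq p (INR n)) by (apply (Mq_pos p eps0 Heps0 Hell); apply (le_INR 1); lia).
  set (A := Rpower 2 (1 - kap) / (K0 * Gamma kap)) in *.
  set (B := Rpower (INR n) (- kap)) in *. set (L := Lint p delta (sqrt (INR n))) in *.
  assert (HA : A <> 0) by (intros E; rewrite E in HN; lra).
  assert (HB : B <> 0) by (intros E; rewrite E in HN; lra).
  assert (HL : L <> 0) by (intros E; rewrite E in HN; lra).
  field. repeat split; lra || assumption.
Qed.

(** As odd returns are impossible, the return probability at [2 m] is the drop of the tail between
    consecutive even times, and [monotone_density] applies. Passing from [m] to [n = 2 m] brings in
    the factor 2 that changes [2^(1 - kap)] into [2^(2 - kap)]. *)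
Lemma ret_eq_asymp : asymp (fun m => ret_eq p (2 * m))
  (fun m => Rpower 2 (2 - kap) * kap / (K0 * Gamma kap) * Rpower (INR (2 * m)) (- (kap + 1))
     * Lint p delta (sqrt (INR (2 * m)))).
Proof.
  destruct (gamma_cdf kap Hkap) as (HG & _).
  assert (H1 := ret_ge_limit p delta HR eps0 Heps0 Hell HM _ tail_limit).
  set (c0 := Rpower 2 (- kap) / (kap * Gamma kap)) in H1.
  assert (Hc0 : 0 < c0) by (apply Rdiv_lt_0_compat; [apply Rpower_pos|now apply Rmult_lt_0_compat]).
  assert (Hmul : forall x : nat -> nat, is_lim_seq (fun m => INR (x m)) p_infty ->
    is_lim_seq (fun m => Mq p (INR (2 * x m)) * ret_ge p (2 * x m)) c0).
  { intros x Hx. apply lim_eps. intros e He. destruct (proj1 (lim_eps _ _) H1 e He) as [N HN].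
    destruct (proj1 (lim_infty _) Hx (INR N)) as [N' HN']. exists N'. intros m Hm. specialize (HN' m Hm).
    cbv beta in HN'. apply INR_lt in HN'. apply HN. lia. }
  assert (Hbase := Hmul (fun m => m) is_lim_seq_INR).
  destruct (ev_gt _ _ 0 Hbase Hc0) as [N0 HN0].
  assert (Ha : forall m, (S N0 <= m)%nat -> 0 < ret_ge p (2 * m)).
  { intros m Hm. specialize (HN0 m ltac:(lia)). cbv beta in HN0.
    assert (HMn : 0 < Mq p (INR (2 * m))) by (apply (Mq_pos p eps0 Heps0 Hell); apply (le_INR 1); lia).
    apply Rmult_lt_reg_l with (Mq p (INR (2 * m))); [exact HMn|]. rewrite Rmult_0_r. exact HN0. }
  assert (Hmd : is_lim_seq (fun m => INR m * ret_eq p (2 * m) / ret_ge p (2 * m)) kap).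
  { apply (monotone_density (fun m => ret_ge p (2 * m)) (fun m => ret_eq p (2 * m)) kap (S N0)); [exact Ha| | |].
    - intros m. assert (E1 := ret_ge_diff p (2 * m)). assert (E2 := ret_ge_diff p (2 * m + 1)).
      rewrite ret_eq_odd in E2. replace (S (2 * m + 1)) with (2 * S m)%nat in E2 by lia.
      replace (S (2 * m)) with (2 * m + 1)%nat in E1 by lia. lra.
    - intros [|m] Hm; [lia|]. now apply ret_eq_decr.
    - intros c Hc.
      assert (Hinf : is_lim_seq (fun m => INR (flr (c * INR m))) p_infty) by (now apply flr_infty, lim_scal_INR).
      assert (Hnum := Hmul (fun m => flr (c * INR m)) Hinf).
      assert (Hratio : is_lim_seq (fun m => Mq p (INR (2 * m)) / Mq p (INR (2 * flr (c * INR m)))) (Rpower c (- kap))).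
      { replace (Rpower c (- kap)) with (Rpower (/ c) kap) by (unfold Rpower; rewrite ln_Rinv by lra; f_equal; ring).
        apply (Mq_ratio p delta HR eps0 Heps0 Hell HM (fun m => INR (2 * flr (c * INR m))) (fun m => INR (2 * m))).
        - now apply Rinv_0_lt_compat.
        - apply (is_lim_seq_le_p_loc (fun m => INR (flr (c * INR m)))); [|exact Hinf].
          exists 0%nat. intros n _. apply le_INR. lia.
        - destruct (proj1 (lim_infty _) Hinf 0) as [N HN].
          apply (lim_ext_from (S N) (fun m => / (INR (flr (c * INR m)) / INR m))).
          + intros m Hm. specialize (HN m ltac:(lia)). cbv beta in HN. rewrite !mult_INR. change (INR 2) with 2.
            assert (Hm0 := INR_gt0 m ltac:(lia)). field. lra.
          + apply (is_lim_seq_inv _ c); [now apply flr_scal_ratio|]. intros E. inversion E. lra. }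
      destruct (proj1 (lim_infty _) Hinf 0) as [N HN].
      apply (lim_val _ (c0 / c0 * Rpower c (- kap))); [field; lra|].
      refine (lim_ext_from (S (N0 + N)) _ _ _ _ (lim_mult_fin _ _ _ _
        (lim_div_fin _ _ _ _ Hnum Hbase (not_eq_sym (Rlt_not_eq _ _ Hc0))) Hratio)).
      intros m Hm. cbv beta. specialize (HN m ltac:(lia)). cbv beta in HN.
      change 0 with (INR 0) in HN. apply INR_lt in HN.
      assert (M1 : 0 < Mq p (INR (2 * m))) by (apply (Mq_pos p eps0 Heps0 Hell); apply (le_INR 1); lia).
      assert (M2 : 0 < Mq p (INR (2 * flr (c * INR m)))) by (apply (Mq_pos p eps0 Heps0 Hell); apply (le_INR 1); lia).
      specialize (Ha m ltac:(lia)). field. lra. }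
  assert (Hge := ret_ge_asymp). unfold asymp in Hge.
  assert (Hge2 := is_lim_seq_subseq _ _ (fun m => (2 * m)%nat)
    ltac:(intros P [N HN]; exists N; intros m Hm; apply HN; lia) Hge).
  cbv beta in Hge2.
  unfold asymp. apply (lim_val _ (kap * 1 / kap)); [field; lra|].
  refine (lim_ext_from (S N0) _ _ _ _ (lim_div_fin _ _ _ _ (lim_mult_fin _ _ _ _ Hmd Hge2) (is_lim_seq_const kap) _)); [|lra].
  intros m Hm. cbv beta. specialize (Ha m ltac:(lia)).
  assert (Hm0 := INR_gt0 m ltac:(lia)).
  assert (E2 : INR (2 * m) = 2 * INR m) by (rewrite mult_INR; reflexivity).
  replace (- (kap + 1)) with (- kap - 1) by ring. rewrite (Rpower_pred (INR (2 * m)) (- kap)) by lra.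
  replace (Rpower 2 (2 - kap)) with (2 * Rpower 2 (1 - kap))
    by (replace (2 - kap) with (1 + (1 - kap)) by ring; rewrite Rpower_plus, Rpower_1 by lra; reflexivity).
  set (A := Rpower 2 (1 - kap)). assert (HA : 0 < A) by apply Rpower_pos.
  set (B := Rpower (INR (2 * m)) (- kap)). assert (HB : 0 < B) by apply Rpower_pos.
  set (L := Lint p delta (sqrt (INR (2 * m)))). rewrite E2.
  (* If [L] is 0, both sides are 0 under the convention [/ 0 = 0]. *)
  destruct (Req_dec L 0) as [HL|HL].
  - rewrite HL, !Rmult_0_r. unfold Rdiv. rewrite Rinv_0. ring.
  - field. repeat split; lra || assumption.
Qed.

End MainA.

(** * The critical case kappa = 0 *)

Section MainB.
Variables (p : nat -> R).
Hypothesis HR : is_lim_seq (fun x => INR x * Rerr p (-1) x) 0.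
Variable eps0 : R.
Hypothesis Heps0 : 0 < eps0.
Hypothesis Hell : forall x, (1 <= x)%nat -> eps0 <= p x <= 1 - eps0.
Hypothesis HM : is_lim_seq (scaleM p) p_infty.
Let Hp := p_bounds p eps0 Heps0 Hell.

(** A Chebyshev-type bound: [v] is a subsolution above [m / 2], because there the mean square
    distance from [m] grows by at most [C] per step, the drift at [x] being O(1/x). With
    [q = 4 / m^2] it is nonpositive at and below [m / 2], so nothing has to be checked there. *)
Lemma alive_far : exists C, 0 < C /\ forall n m, (1 <= m)%nat ->
  1 - C * INR n / (INR m * INR m) <= alive p n m.
Proof.
  destruct (drift_bounded p (-1) HR) as (C0 & HC0 & HC0').
  set (C := 1 + 6 * C0). exists (4 * C). split; [unfold C; lra|].
  intros n m Hm. assert (Hm0 := INR_gt0 m Hm).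
  set (q := 4 / (INR m * INR m)).
  assert (Hq : 0 < q) by (apply Rdiv_lt_0_compat; [lra|now apply Rmult_lt_0_compat]).
  set (v := fun (k x : nat) => 1 - q * ((INR x - INR m) * (INR x - INR m) + C * INR k)).
  assert (Hcl : forall k x, v k x <= alive p k x).
  { assert (Hlow : forall k x, INR x <= INR m / 2 -> v k x <= 0).
    { intros k x Hx. unfold v.
      assert (Hk : 0 <= C * INR k) by (apply Rmult_le_pos; [unfold C; lra|apply pos_INR]).
      assert (H1 : INR m / 2 * (INR m / 2) <= (INR x - INR m) * (INR x - INR m)).
      { replace ((INR x - INR m) * (INR x - INR m)) with ((INR m - INR x) * (INR m - INR x)) by ring.
        apply Rmult_le_compat; lra. }
      assert (H2 : q * (INR m / 2 * (INR m / 2)) = 1) by (unfold q; field; lra).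
      assert (q * (INR m / 2 * (INR m / 2)) <= q * ((INR x - INR m) * (INR x - INR m) + C * INR k)).
      { apply Rmult_le_compat_l; lra. }
      lra. }
    induction k as [|k IH]; intros x.
    - destruct x as [|x].
      + apply Hlow. simpl. lra.
      + simpl alive. unfold v. simpl (INR 0). assert (0 <= q * ((INR (S x) - INR m) * (INR (S x) - INR m) + C * 0)); [|lra].
        apply Rmult_le_pos; [lra|]. rewrite Rmult_0_r, Rplus_0_r. apply Rle_0_sqr.
    - destruct (Rle_lt_dec (INR x) (INR m / 2)) as [Hx|Hx].
      { eapply Rle_trans; [now apply Hlow|]. apply alive_bounds. exact Hp. }
      destruct x as [|x]; [simpl in Hx; lra|].
      change (alive p (S k)) with (step p (alive p k)).
      apply Rle_trans with (step p (v k) (S x)); [|apply step_le; [exact Hp|apply IH|apply IH]].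
      specialize (HC0' (S x)). assert (Hx0 := INR_gt0 (S x) ltac:(lia)).
      assert (Hdr : (INR (S x) - INR m) * (2 * p (S x) - 1) <= 3 * C0).
      { assert (Hb : Rabs (2 * p (S x) - 1) <= C0 / INR (S x)).
        { rewrite Rabs_mult, (Rabs_pos_eq (INR (S x))) in HC0' by lra.
          apply Rmult_le_reg_l with (INR (S x)); [lra|].
          replace (INR (S x) * (C0 / INR (S x))) with C0 by (field; lra). exact HC0'. }
        apply Rle_trans with (Rabs ((INR (S x) - INR m) * (2 * p (S x) - 1))); [apply Rle_abs|].
        rewrite Rabs_mult. apply Rle_trans with (3 * INR (S x) * (C0 / INR (S x))); [|apply Req_le; field; lra].
        apply Rmult_le_compat; [apply Rabs_pos|apply Rabs_pos| |exact Hb]. apply Rabs_le. lra. }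
      rewrite step_S. unfold v. rewrite (S_INR k), (S_INR (S x)).
      replace (INR x) with (INR (S x) - 1) by (rewrite S_INR; ring).
      set (y := INR (S x)) in *. set (z := p (S x)) in *.
      replace (z * (1 - q * ((y + 1 - INR m) * (y + 1 - INR m) + C * INR k)) +
        (1 - z) * (1 - q * ((y - 1 - INR m) * (y - 1 - INR m) + C * INR k))) with
        (1 - q * ((y - INR m) * (y - INR m) + (1 + 2 * ((y - INR m) * (2 * z - 1))) + C * INR k)) by ring.
      assert (q * ((y - INR m) * (y - INR m) + (1 + 2 * ((y - INR m) * (2 * z - 1))) + C * INR k) <=
        q * ((y - INR m) * (y - INR m) + C * (INR k + 1))).
      { apply Rmult_le_compat_l; [lra|]. unfold C. lra. }
      lra. }
  eapply Rle_trans; [|apply Hcl]. unfold v, q. apply Req_le. field. lra.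
Qed.

Lemma Rpower_critical c : Rpower c (- ((1 + -1) / 2)) = 1.
Proof. replace (- ((1 + -1) / 2)) with 0 by field. unfold Rpower. rewrite Rmult_0_l. apply exp_0. Qed.

Lemma tail_limit_critical : is_lim_seq (fun n => Mq p (INR n) * alive p n 1) 1.
Proof.
  assert (Hone : forall c, 0 < c -> is_lim_seq (fun n => Mq p (INR n) / Mq p (c * INR n)) 1).
  { intros c Hc. rewrite <- (Rpower_critical c). now apply (Mq_scal_ratio p (-1) HR eps0 Heps0 Hell HM). }
  apply lim_between; intros tau Htau.
  - destruct (tail_decomposition p (-1) HR eps0 Heps0 Hell HM (1 / 4) ltac:(lra)) as (Ct & HCt & Hdec).
    set (eps := tau / (2 * Ct)). assert (Heps : 0 < eps) by (apply Rdiv_lt_0_compat; lra).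
    destruct (Hdec eps Heps) as [N1 P1].
    destruct (ev_lt _ _ (1 + tau / 2) (Hone eps Heps)) as [N2 P2]; [lra|].
    destruct (proj1 (lim_infty _) (lim_scal_INR eps Heps) 1) as [N3 P3].
    exists (N1 + N2 + N3)%nat. intros n Hn. specialize (P1 n ltac:(lia)). specialize (P2 n ltac:(lia)).
    specialize (P3 n ltac:(lia)). cbv beta in P2, P3.
    assert (HCe : Ct * eps = tau / 2) by (unfold eps; field; lra).
    eapply Rle_trans; [exact P1|]. rewrite HCe.
    match goal with |- ?r * ?a + _ <= _ => assert (Ha : 0 <= a <= 1) by (apply alive_bounds; exact Hp);
      assert (Hr : 0 <= r) end.
    { apply Rdiv_le_0_compat; [now apply scaleM_nonneg|]. apply (Mq_pos p eps0 Heps0 Hell). lra. }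
    nra.
  - destruct alive_far as (C & HC & Hfar).
    (* Since eventually [m^2 >= B n / 4], this choice makes the bound of [alive_far] at least
       [1 - tau / 4]. A large [B] costs nothing, as [Mq n / Mq (B n)] tends to 1 for every [B]. *)
    set (B := 16 * C / tau). assert (HB : 0 < B) by (apply Rdiv_lt_0_compat; lra).
    destruct (ev_gt _ _ (1 - tau / 4) (Hone B HB)) as [N1 P1]; [lra|].
    destruct (ev_lt _ _ (2) (Hone B HB)) as [N1' P1']; [lra|].
    destruct (proj1 (lim_infty _) (lim_scal_INR B HB) 1) as [N2 P2].
    assert (Hm : is_lim_seq (fun n => INR (flr (sqrt (B * INR n))) / sqrt (B * INR n)) 1)
      by (apply flr_equiv, sqrt_infty, lim_scal_INR; lra).
    destruct (ev_gt _ _ (/ 2) Hm) as [N3 P3]; [lra|].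
    exists (S (N1 + N1' + N2 + N3)). intros n Hn. specialize (P1 n ltac:(lia)). specialize (P2 n ltac:(lia)).
    specialize (P3 n ltac:(lia)). specialize (P1' n ltac:(lia)). cbv beta in P1, P1', P2, P3.
    assert (Hn0 := INR_gt0 n ltac:(lia)).
    eapply Rle_trans; [|apply (tail_lower p eps0 Heps0 Hell B n); lra].
    assert (Hm1 := flr_sqrt_pos (B * INR n) ltac:(lra)).
    set (m := flr (sqrt (B * INR n))) in *. specialize (Hfar n m Hm1).
    assert (Hsq : 0 < sqrt (B * INR n)) by (apply sqrt_lt_R0; lra).
    assert (Hss := sqrt_sqrt (B * INR n) ltac:(lra)).
    set (sq := sqrt (B * INR n)) in *.
    apply Rmult_lt_compat_r with (r := sq) in P3; [|exact Hsq].
    unfold Rdiv in P3. rewrite (Rmult_assoc (INR m)), Rinv_l, Rmult_1_r in P3 by lra.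
    assert (Hm2 : B * INR n / 4 <= INR m * INR m).
    { apply Rle_trans with ((/ 2 * sq) * (/ 2 * sq)); [|apply Rmult_le_compat; lra].
      replace (/ 2 * sq * (/ 2 * sq)) with (sq * sq / 4) by field. lra. }
    assert (Hq : C * INR n / (INR m * INR m) <= tau / 4).
    { assert (0 < B * INR n) by lra. apply Rmult_le_reg_r with (INR m * INR m); [lra|].
      unfold Rdiv at 1. rewrite Rmult_assoc, Rinv_l, Rmult_1_r by lra.
      apply Rle_trans with (tau / 4 * (B * INR n / 4)); [|apply Rmult_le_compat_l; lra].
      apply Req_le. unfold B. field. lra. }
    assert (Ha : 1 - tau / 4 <= alive p n m) by lra.
    assert (Hr : 0 <= Mq p (INR n) / Mq p (B * INR n)).
    { apply Rdiv_le_0_compat; [now apply scaleM_nonneg|]. apply (Mq_pos p eps0 Heps0 Hell). lra. }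
    set (r := Mq p (INR n) / Mq p (B * INR n)) in *.
    apply Rmult_le_compat_l with (r := r) in Ha; [|exact Hr]. nra.
Qed.

Variable K0 : R.
Hypothesis HK0 : 0 < K0.
Hypothesis Hasy : asymp (lambda p) (fun x => K0 * Rpower (INR x) (2 * ((1 + -1) / 2) - 1) / Lnat p (-1) x).

Definition nu_term (l : nat) : R :=
  if (Nat.even l && Nat.leb 2 l)%bool then / (INR l * Lint p (-1) (sqrt (INR l))) else 0.

Lemma Lint_between x : 0 <= x ->
  let k := flr x in let r := Rabs (Lnat p (-1) (S k) / Lnat p (-1) k - 1) in
  0 < Lint p (-1) x /\ Lnat p (-1) k * (1 - r) <= Lint p (-1) x <= Lnat p (-1) k * (1 + r).
Proof.
  intros Hx k r. destruct (flr_bounds x Hx) as [H1 H2]. fold k in H1, H2.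
  assert (HL := Lnat_pos p (-1) k). assert (HL1 := Lnat_pos p (-1) (S k)).
  unfold Lint. change (Z.to_nat (Int_part x)) with k. cbv zeta.
  split; [nra|].
  set (d := Lnat p (-1) (S k) / Lnat p (-1) k - 1) in r.
  replace (Lnat p (-1) (S k) - Lnat p (-1) k) with (Lnat p (-1) k * d) by (unfold d; field; lra).
  assert (Hd : - r <= d <= r) by (apply Rabs_le_between; apply Rle_refl).
  assert (Hr : 0 <= r) by apply Rabs_pos.
  replace (Lnat p (-1) k + (x - INR k) * (Lnat p (-1) k * d)) with (Lnat p (-1) k * (1 + (x - INR k) * d)) by ring.
  split; apply Rmult_le_compat_l; nra.
Qed.

Lemma nu_term_nonneg l : 0 <= nu_term l.
Proof.
  unfold nu_term. destruct (Nat.even l && Nat.leb 2 l)%bool eqn:E; [|lra].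
  apply Bool.andb_true_iff in E. destruct E as [_ E]. apply Nat.leb_le in E.
  apply Rlt_le, Rinv_0_lt_compat, Rmult_lt_0_compat; [apply INR_gt0; lia|].
  apply Lint_between, sqrt_pos.
Qed.

(** Among [2 k + 1] consecutive integers there are [k] or [k + 1] even ones, whichever parity [b]
    has. *)
Lemma psum_parity (g : nat -> R) (lo hi : R) (b k : nat) : 0 <= lo -> lo <= hi ->
  (forall i, (b <= i <= b + 2 * k)%nat -> if Nat.even i then lo <= g i <= hi else g i = 0) ->
  psum g b + INR k * lo <= psum g (b + 2 * k + 1) <= psum g b + (INR k + 1) * hi.
Proof.
  intros Hlo Hhi Hg.
  assert (H : forall j, (j <= k)%nat -> psum g b + INR j * lo <= psum g (b + 2 * j) <= psum g b + INR j * hi).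
  { induction j as [|j IH]; intros Hj.
    - rewrite Nat.mul_0_r, Nat.add_0_r. simpl INR. lra.
    - specialize (IH ltac:(lia)). replace (b + 2 * S j)%nat with (S (S (b + 2 * j))) by lia.
      cbn [psum]. rewrite S_INR.
      assert (G1 := Hg (b + 2 * j)%nat ltac:(lia)). assert (G2 := Hg (S (b + 2 * j)) ltac:(lia)).
      rewrite Nat.even_succ, <- Nat.negb_even in G2.
      destruct (Nat.even (b + 2 * j)); cbn [negb] in G2; lra. }
  specialize (H k (Nat.le_refl k)). replace (b + 2 * k + 1)%nat with (S (b + 2 * k)) by lia. cbn [psum].
  assert (G1 := Hg (b + 2 * k)%nat ltac:(lia)).
  destruct (Nat.even (b + 2 * k)); lra.
Qed.

(** For [kappa = 0] the exponent [2 kappa - 1] is -1, so [lambda r] is equivalent to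
    [K0 / (r L(r))]. *)
Lemma inv_rL_lambda : is_lim_seq (fun r => / (INR r * Lnat p (-1) r) / lambda p r) (/ K0).
Proof.
  unfold asymp in Hasy. assert (H := lim_scal _ K0 _ Hasy). rewrite Rmult_1_r in H.
  refine (lim_ext_from 1 _ _ _ _ (is_lim_seq_inv _ K0 H _)); [|intros E; inversion E; lra].
  intros r Hr. assert (Hr0 := INR_gt0 r Hr). assert (Hl := lambda_pos p Hp r). assert (HL := Lnat_pos p (-1) r).
  replace (2 * ((1 + -1) / 2) - 1) with (Ropp 1) by field. rewrite Rpower_Ropp, Rpower_1 by exact Hr0.
  field. repeat split; lra.
Qed.

(** For [i] from [r^2] to [(r + 1)^2 - 1] the floor of [sqrt i] is [r], so the block has about [r]
    even indices with terms close to [1 / (r^2 L(r))]. Its sum is about [1 / (r L(r))], that is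
    [lambda r / K0]. *)
Lemma nu_block : is_lim_seq (fun r => (psum nu_term (S r * S r) - psum nu_term (r * r)) / lambda p r) (/ K0).
Proof.
  set (rho := fun r => Rabs (Lnat p (-1) (S r) / Lnat p (-1) r - 1)).
  assert (Hrho : is_lim_seq rho 0).
  { unfold rho. replace (Finite 0) with (Rbar_abs 0) by (simpl; now rewrite Rabs_R0). apply is_lim_seq_abs.
    apply (lim_val _ (0 * 0)); [ring|].
    apply (lim_ext_from 1 (fun n => INR n * (Lnat p (-1) (S n) / Lnat p (-1) n - 1) * / INR n)).
    - intros n Hn. generalize (INR_gt0 n Hn) (Lnat_pos p (-1) n). intros. field. lra.
    - apply lim_mult_fin; [apply Lnat_regvar; exact HR|]. apply lim_inv_infty, is_lim_seq_INR. }
  assert (Hinv : is_lim_seq (fun r => / INR r) 0) by apply lim_inv_infty, is_lim_seq_INR.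
  assert (H0 := inv_rL_lambda).
  destruct (ev_lt _ _ (1 / 2) Hrho) as [N1 P1]; [lra|].
  apply (is_lim_seq_le_le_loc
    (fun r => / (INR r * Lnat p (-1) r) / lambda p r / ((1 + / INR r) * (1 + / INR r) * (1 + rho r))) _
    (fun r => / (INR r * Lnat p (-1) r) / lambda p r * (1 + / INR r) / (1 + -1 * rho r))).
  - exists (S (S N1)). intros r Hr. specialize (P1 r ltac:(lia)).
    assert (Hr0 := INR_gt0 r ltac:(lia)). assert (Hr1 : 1 <= INR r) by (apply (le_INR 1); lia).
    assert (Hl := lambda_pos p Hp r). assert (HL := Lnat_pos p (-1) r).
    assert (Hrp : 0 <= rho r) by apply Rabs_pos.
    set (lo := / ((INR r + 1) * (INR r + 1) * (Lnat p (-1) r * (1 + rho r)))).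
    set (hi := / (INR r * INR r * (Lnat p (-1) r * (1 - rho r)))).
    assert (Hd1 : 0 < Lnat p (-1) r * (1 - rho r)) by (apply Rmult_lt_0_compat; lra).
    assert (Hd2 : 0 < INR r * INR r * (Lnat p (-1) r * (1 - rho r))) by (repeat apply Rmult_lt_0_compat; lra).
    assert (Hblock : forall i, (r * r <= i <= r * r + 2 * r)%nat ->
      if Nat.even i then lo <= nu_term i <= hi else nu_term i = 0).
    { intros i Hi. unfold nu_term. destruct (Nat.even i) eqn:Ev; [|reflexivity].
      replace (Nat.leb 2 i) with true by (symmetry; apply Nat.leb_le; nia). cbn [andb].
      assert (Hi1 : INR r * INR r <= INR i) by (rewrite <- mult_INR; apply le_INR; lia).
      assert (Hi2 : INR i <= (INR r + 1) * (INR r + 1)).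
      { rewrite <- S_INR, <- mult_INR. apply le_INR. lia. }
      assert (Hi3 : INR i < (INR r + 1) * (INR r + 1)).
      { rewrite <- S_INR, <- mult_INR. apply lt_INR. lia. }
      assert (Hf : flr (sqrt (INR i)) = r).
      { destruct (flr_bounds (sqrt (INR i)) (sqrt_pos _)) as [B1 B2].
        apply Nat.le_antisymm.
        - apply Nat.lt_succ_r, INR_lt. rewrite S_INR. eapply Rle_lt_trans; [exact B1|].
          rewrite <- (sqrt_square (INR r + 1)) by lra. apply sqrt_lt_1_alt. split; [apply pos_INR|exact Hi3].
        - apply flr_ge. rewrite <- (sqrt_square (INR r)) by lra. now apply sqrt_le_1_alt. }
      destruct (Lint_between (sqrt (INR i)) (sqrt_pos _)) as (L0 & L1 & L2).
      rewrite Hf in L1, L2. fold (rho r) in L1, L2.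
      assert (Hii : 0 < INR i) by nra.
      split.
      - apply Rinv_le_contravar; [now apply Rmult_lt_0_compat|]. apply Rmult_le_compat; lra.
      - apply Rinv_le_contravar; [exact Hd2|]. apply Rmult_le_compat; nra. }
    assert (Hlo : 0 < lo) by (apply Rinv_0_lt_compat; repeat apply Rmult_lt_0_compat; lra).
    assert (Hlohi : lo <= hi).
    { apply Rinv_le_contravar; [exact Hd2|]. apply Rmult_le_compat; [nra|lra|nra|]. apply Rmult_le_compat_l; lra. }
    assert (HP := psum_parity nu_term lo hi (r * r) r (Rlt_le _ _ Hlo) Hlohi Hblock).
    replace (r * r + 2 * r + 1)%nat with (S r * S r)%nat in HP by lia.
    split.
    + apply Rle_trans with (INR r * lo / lambda p r).
      * apply Req_le. unfold lo. field. repeat split; lra.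
      * apply Rmult_le_compat_r; [apply Rlt_le, Rinv_0_lt_compat, Hl|lra].
    + apply Rle_trans with ((INR r + 1) * hi / lambda p r).
      * apply Rmult_le_compat_r; [apply Rlt_le, Rinv_0_lt_compat, Hl|lra].
      * apply Req_le. unfold hi. field. repeat split; lra.
  - apply (lim_val _ (/ K0 / ((1 + 0) * (1 + 0) * (1 + 0)))); [field; lra|].
    apply lim_div_fin; [exact H0| |lra].
    repeat apply lim_mult_fin; apply lim_plus_fin; try apply is_lim_seq_const; assumption.
  - apply (lim_val _ (/ K0 * (1 + 0) / (1 + -1 * 0))); [field; lra|].
    apply lim_div_fin; [apply lim_mult_fin; [exact H0|]| |lra]; apply lim_plus_fin; try apply is_lim_seq_const.
    + exact Hinv.
    + now apply lim_scal.
Qed.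

(** Summing the blocks by [stolz] compares [nu] at squares with [M]. Between squares the sum is
    monotone, and [M (r + 1) / M r] tends to 1. *)
Lemma nu_asymp : is_lim_seq (fun n => nu p (-1) n / Mq p (INR n)) (/ K0).
Proof.
  assert (HB : is_lim_seq (fun r => psum nu_term (r * r) / scaleM p r) (/ K0)).
  { apply (is_lim_seq_ext (fun r => psum (fun k => psum nu_term (S k * S k) - psum nu_term (k * k)) r / psum (lambda p) r)).
    - intros r. rewrite (psum_telescope (fun k => psum nu_term (k * k))), scaleM_psum. simpl (psum nu_term (0 * 0)).
      f_equal. ring.
    - apply stolz; [apply lambda_pos, Hp| |exact nu_block].
      apply (psum_lambda_infty p HM). }
  assert (HM1 : is_lim_seq (fun r => scaleM p (S r) / scaleM p r) 1).
  { apply (lim_val _ (1 + (1 + -1) * 0)); [ring|].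
    apply (lim_ext_from 1 (fun r => 1 + INR r * (scaleM p (S r) / scaleM p r - 1) * / INR r)).
    - intros r Hr. assert (Hr0 := INR_gt0 r Hr). assert (H := scaleM_pos p Hp r Hr). field. lra.
    - apply lim_plus_fin; [apply is_lim_seq_const|]. apply lim_mult_fin.
      + apply (scaleM_regvar p (-1) HR eps0 Heps0 Hell HM).
      + apply lim_inv_infty, is_lim_seq_INR. }
  assert (HB1 : is_lim_seq (fun r => psum nu_term (S r * S r) / scaleM p r) (/ K0)).
  { apply (lim_val _ (/ K0 * 1)); [ring|].
    apply (lim_ext_from 1 (fun r => psum nu_term (S r * S r) / scaleM p (S r) * (scaleM p (S r) / scaleM p r))).
    - intros r Hr. assert (H := scaleM_pos p Hp r Hr). assert (H' := scaleM_pos p Hp (S r) ltac:(lia)). field. lra.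
    - apply lim_mult_fin; [|exact HM1]. exact (proj1 (is_lim_seq_incr_1 _ _) HB). }
  apply (is_lim_seq_le_le_loc _ _ _ _) with (2 := lim_flr_sqrt _ _ HB) (3 := lim_flr_sqrt _ _ HB1).
  exists 1%nat. intros n Hn.
  (* [nu] includes the term with index [n], whereas [psum] stops before its bound. *)
  assert (E : nu p (-1) n = psum nu_term (S n)) by (unfold nu; rewrite psum_sum_f_R0; reflexivity).
  rewrite E. unfold Mq.
  assert (Hn0 := pos_INR n).
  destruct (flr_bounds (sqrt (INR n)) (sqrt_pos _)) as [B1 B2].
  assert (Hr := flr_sqrt_pos (INR n) (le_INR 1 n Hn)).
  set (r := flr (sqrt (INR n))) in *.
  assert (HMr := scaleM_pos p Hp r Hr).
  assert (Hss := sqrt_sqrt (INR n) Hn0). assert (Hsp := sqrt_pos (INR n)).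
  assert (Hr0 := pos_INR r).
  assert (H1 : (r * r <= S n)%nat).
  { apply Nat.le_trans with n; [|lia]. apply INR_le. rewrite mult_INR. nra. }
  assert (H2 : (S n <= S r * S r)%nat).
  { apply INR_lt. rewrite mult_INR, S_INR. nra. }
  split; (apply Rmult_le_compat_r; [apply Rlt_le, Rinv_0_lt_compat, HMr|]); apply psum_mono;
    (exact nu_term_nonneg || assumption).
Qed.

Lemma ret_ge_asymp_critical : asymp (ret_ge p) (fun n => / (K0 * nu p (-1) n)).
Proof.
  assert (H1 := ret_ge_limit p (-1) HR eps0 Heps0 Hell HM _ tail_limit_critical).
  assert (H2 := lim_scal _ K0 _ nu_asymp).
  unfold asymp. apply (lim_val _ (1 * (K0 * / K0))); [field; lra|].
  refine (lim_ext_from 1 _ _ _ _ (lim_mult_fin _ _ _ _ H1 H2)).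
  intros n Hn. cbv beta. unfold Rdiv. rewrite Rinv_inv.
  assert (HMn : 0 < Mq p (INR n)) by (apply (Mq_pos p eps0 Heps0 Hell); apply (le_INR 1); lia).
  field. lra.
Qed.

End MainB.

Theorem theorem2p1 (p : nat -> R) (delta K0 : R) :
  delta >= -1 ->
  (* R_x = o(1/x) *)
  is_lim_seq (fun x => INR x * Rerr p delta x) 0 ->
  (* uniform ellipticity *)
  (exists eps, eps > 0 /\ forall x, (1 <= x)%nat -> eps <= p x <= 1 - eps) ->
  (* K0 is the constant with lambda_x ~ K0 x^(2 kappa - 1) L(x)^(-1) *)
  K0 > 0 ->
  asymp (lambda p)
    (fun x => K0 * Rpower (INR x) (2 * ((1 + delta) / 2) - 1) / Lnat p delta x) ->
  let kappa := (1 + delta) / 2 in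
  (delta > -1 ->
     asymp (ret_ge p)
       (fun n => Rpower 2 (1 - kappa) / (K0 * Gamma kappa)
                 * Rpower (INR n) (- kappa) * Lint p delta (sqrt (INR n)))
     /\
     asymp (fun m => ret_eq p (2 * m))
       (fun m => Rpower 2 (2 - kappa) * kappa / (K0 * Gamma kappa)
                 * Rpower (INR (2 * m)) (- (kappa + 1))
                 * Lint p delta (sqrt (INR (2 * m)))))
  /\
  (delta = -1 -> is_lim_seq (fun x => scaleM p x) p_infty ->
     asymp (ret_ge p) (fun n => / (K0 * nu p delta n))).
Proof.
  intros _ HR (eps & Heps & Hell) HK0 Hasy kappa. split.
  - intros Hd. split.
    + exact (ret_ge_asymp p delta Hd HR eps Heps Hell K0 HK0 Hasy).
    + exact (ret_eq_asymp p delta Hd HR eps Heps Hell K0 HK0 Hasy).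
  - intros -> HM. exact (ret_ge_asymp_critical p HR eps Heps Hell HM K0 HK0 Hasy).
Qed.
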